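(* For $k>4$, every simple topological graph on $n\ge 2$ vertices with no $(k,1)$-crossing family has $O(n\log^{2k+2}n)$ edges. For $k\in\{2,3,4\}$, every simple topological graph on $n\ge 2$ vertices with no $(k,1)$-crossing family has $O(n\log^{6}n)$ edges.
   Context: A topological graph is a graph drawn in the plane with vertices as points and edges as non-self-intersecting arcs joining their endpoints, not passing through other vertices, with no tangencies; no parallel edges or loops. It is simple if every pair of edges has at most one point in common. Two edges cross if their interiors share a point; they are disjoint if they share no point (including endpoints). A $(k,1)$-crossing family consists of $k$ pairwise crossing edges together with one further edge disjoint from each of these $k$ edges. The implicit constants may depend on $k$. *)

(* Defs.v *)
From HB Require Import structures.
From mathcomp Require Import all_boot all_order all_algebra.
From mathcomp Require Import all_classical all_reals all_analysis.
Set Implicit Arguments. Unset Strict Implicit. Unset Printing Implicit Defensive.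
Import Order.TTheory GRing.Theory Num.Theory.
Import numFieldNormedType.Exports.
Local Open Scope classical_set_scope.
Local Open Scope ring_scope.

Section TopGraph.
Variable R : realType.

Local Notation pt := (R * R)%type.

Definition I01 : set R := [set t | 0 <= t <= 1].
Definition I01o : set R := [set t | 0 < t < 1].

Definition udisk : set pt := [set y | y.1 ^+ 2 + y.2 ^+ 2 < 1].

Definition is_arc (g : R -> pt) : Prop :=
  {within I01, continuous g} /\
  (forall s t, I01 s -> I01 t -> g s = g t -> s = t).

(* The point sets Se and Sf cross properly (no tangency) at p: locally around p
   there is a homeomorphism onto the open unit disk sending p to the origin,
   Se to the horizontal diameter and Sf to the vertical diameter. *)
Definition crosses_properly (Se Sf : set pt) (p : pt) : Prop :=
  exists (U : set pt) (h g : pt -> pt),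
    open U /\ U p /\
    {within U, continuous h} /\ {within udisk, continuous g} /\
    (forall x, U x -> udisk (h x) /\ g (h x) = x) /\
    (forall y, udisk y -> U (g y) /\ h (g y) = y) /\
    h p = (0, 0) /\
    h @` (U `&` Se) = udisk `&` [set y | y.2 = 0] /\
    h @` (U `&` Sf) = udisk `&` [set y | y.1 = 0].

Section Graph.
Variables (V Ed : finType) (pos : V -> pt) (ends : Ed -> V * V)
          (curve : Ed -> R -> pt).

Definition edge_pts (e : Ed) : set pt := curve e @` I01.
Definition edge_int (e : Ed) : set pt := curve e @` I01o.

Definition simple_topgraph : Prop :=
  injective pos /\
  (forall e, (ends e).1 <> (ends e).2) /\
  (forall e f, e <> f -> ends e <> ends f /\
                         ends e <> ((ends f).2, (ends f).1)) /\
  (forall e, is_arc (curve e) /\ curve e 0 = pos (ends e).1 /\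
             curve e 1 = pos (ends e).2) /\
  (forall e w, ~ edge_int e (pos w)) /\
  (forall e f p, e <> f -> edge_int e p -> edge_int f p ->
                 crosses_properly (edge_pts e) (edge_pts f) p) /\
  (forall e f p q, e <> f -> edge_pts e p -> edge_pts f p ->
                   edge_pts e q -> edge_pts f q -> p = q).

Definition ecross (e f : Ed) : Prop := exists p, edge_int e p /\ edge_int f p.
Definition edisjoint (e f : Ed) : Prop :=
  forall p, ~ (edge_pts e p /\ edge_pts f p).

Definition has_k1_family (k : nat) : Prop :=
  exists (F : 'I_k -> Ed) (d : Ed),
    [/\ injective F,
        (forall i j, i <> j -> ecross (F i) (F j)) &
        (forall i, edisjoint (F i) d)].
End Graph.
End TopGraph.

(* Main.v *)
Require Import Defs.
From HB Require Import structures.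
From mathcomp Require Import all_boot all_order all_algebra.
From mathcomp Require Import all_classical all_reals all_analysis.
From mathcomp Require Import complex.
From mathcomp Require Import ring lra zify.
Import Order.TTheory GRing.Theory Num.Theory.
Import numFieldNormedType.Exports.
Set Implicit Arguments. Unset Strict Implicit. Unset Printing Implicit Defensive.
Local Open Scope ring_scope.

(* Let [e] and [f] be arcs such that no end of one lies on the other. Continuing a square
   root of [e(s) - f(t)] around the boundary of the unit square gives a sign, which is [1] if
   [e] and [f] are disjoint and [-1] if they cross properly at exactly one point. Over the
   pairs of independent edges of K_{3,3} these signs have product [-1]. Hence K_{3,3} has no
   drawing with independent edges disjoint, and, the sign being multiplicative along walks,
   there are no nine walks of even length forming a K_{3,3} such that every edge of a walk
   crosses every edge of each walk independent from it.

   The first fact excludes K_6 from a minor-closed class of graphs drawn with independent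
   edges disjoint, so these graphs have linearly many edges. By induction on k, a graph
   without k pairwise crossing edges has at most [q n] edges with [q = O(log^(k-2) n)]: among
   the edges crossed about y times, sample edges and vertices at random, and join an edge to
   a vertex when the edge is crossed by an edge at this vertex; this graph is in the class.

   Without a (k,1)-crossing family every edge therefore misses at most [(q + 2) u] of the
   edges spanned by [u] vertices. A minimal vertex set spanning more than [K q n log^4 n]
   edges of a bipartite subgraph is an expander: even after the removal of a few edges most
   of its vertices are joined by walks of length [O(log^(3/2) n)]. So a maximal routing of
   bounded congestion connects almost all pairs inside one colour class, and the bound on
   missed edges shows that most pairs of routes cross edge by edge. Random ends then give an
   even K_{3,3} as above. Altogether there are [O(n log^(k+2) n)] edges. *)

(** * Winding signs of pairs of arcs *)

(** The sign of a pair of arcs splits into four factors, each attached to one arc and one end of the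
    other, and the square of a factor depends on end points only. Hence the signs over K_{3,3} can
    be multiplied without any knowledge of the arcs, and they compose along walks: if every edge of
    one walk crosses every edge of another, the sign is (-1)^(a b) for lengths a and b. Even walks
    thus behave like disjoint arcs, and they are obtained by taking all their ends in one class of a
    bipartite graph.

    The exponent 4 is a balance. Let D be the number of edges per vertex, L = 1 + ln n and r the
    length of the walks. The expander tolerates the loss of about D n / L edges, so a congestion c
    of order r n L / D suffices. A route fails to cross completely at most r c (q + 2) n others,
    which must be a small fraction of n^2; hence D is of order q r^2 L, that is q L^4 for r^2 of
    order L^3. The resulting exponent k + 2 is at most 2 k + 2, and at most 6 for k <= 4. *)

Section SquareRootLifts.
Variable R : rcfType.
Local Notation C := R[i].
Implicit Types (a b x y z : C) (f : nat -> C) (h : nat -> nat -> C).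

(** The quotient lies in the open right half-plane, where the principal root is unambiguous: one
    admissible step of a discrete path along which a square root is continued. Both points are then
    non-zero. *)
Definition nearby z a := 0 < complex.Re (a / z).

Lemma Re_mulE x y : complex.Re (x * y) =
  complex.Re x * complex.Re y - complex.Im x * complex.Im y.
Proof. by case: x => ? ?; case: y. Qed.

Lemma sqr_eq_Re_gt0 x y :
  0 < complex.Re x -> 0 < complex.Re y -> x ^+ 2 = y ^+ 2 -> x = y.
Proof.
move=> hx hy /eqP; rewrite eqf_sqr => /orP [/eqP //|/eqP e]; move: hx.
by rewrite e; case: y hy {e} => u v /= h1 h2; exfalso; lra.
Qed.

Lemma sqrtc_Re_ge0 a : 0 <= complex.Re (sqrtc a).
Proof. by case: a => u v; rewrite /sqrtc /= sqrtr_ge0. Qed.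

Lemma sqrtc_sector a : 0 < complex.Re a ->
  `|complex.Im (sqrtc a)| < complex.Re (sqrtc a).
Proof.
have h0 := sqrtc_Re_ge0 a; rewrite -[X in complex.Re X > 0]sqr_sqrtc.
move: (sqrtc a) h0 => x h0; rewrite expr2 Re_mulE => h.
rewrite -ltr_sqr ?nnegrE ?normr_ge0 // real_normK ?num_real //.
by rewrite !expr2; lra.
Qed.

Lemma sqrtc_mul_Re_gt0 a b : 0 < complex.Re a -> 0 < complex.Re b ->
  0 < complex.Re (sqrtc a * sqrtc b).
Proof.
move=> /sqrtc_sector ha /sqrtc_sector hb; rewrite Re_mulE subr_gt0.
apply: le_lt_trans (ler_norm _) _; rewrite normrM.
exact: ltr_pM.
Qed.

(** Principal roots of the right half-plane have argument below pi/4 in absolute value, so a product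
    of two of them has positive real part and is determined by its square. *)
Lemma sqrtcM_sector a b : 0 < complex.Re a -> 0 < complex.Re b ->
  forall c d, 0 < complex.Re c -> 0 < complex.Re d -> a * b = c * d ->
  sqrtc a * sqrtc b = sqrtc c * sqrtc d.
Proof.
move=> ha hb c d hc hd e; apply: sqr_eq_Re_gt0; try exact: sqrtc_mul_Re_gt0.
by rewrite !exprMn !sqr_sqrtc.
Qed.

Lemma sqrtcV_sector a : 0 < complex.Re a -> sqrtc a^-1 = (sqrtc a)^-1.
Proof.
move=> ha; have a0 : a != 0 by apply: contraTneq ha => ->; rewrite /= ltxx.
have s0 : sqrtc a != 0 by rewrite sqrtc_eq0.
have ha' : 0 < complex.Re a^-1.
  case: a ha a0 {s0} => u v /= hu _; rewrite divr_gt0 //.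
  by rewrite ltr_pwDl ?exprn_gt0 ?sqr_ge0.
have := sqrtcM_sector ha ha' (c := 1) (d := 1).
rewrite mulfV // mulr1 sqrtc1 mulr1 => /(_ ltr01 ltr01 erefl) e.
by apply: (mulfI s0); rewrite e mulfV.
Qed.

(** Ratio of the last to the first value of a square root continued along [f]. *)
Definition lift f m n : C := \prod_(m <= i < n) sqrtc (f i.+1 / f i).

Lemma lift_nil f m : lift f m m = 1.
Proof. by rewrite /lift big_geq. Qed.

Lemma lift_cat f m n p : (m <= n <= p)%N -> lift f m n * lift f n p = lift f m p.
Proof. by case/andP=> h1 h2; rewrite /lift -big_cat_nat. Qed.

Lemma eq_lift f g m n : (forall i, (m <= i <= n)%N -> f i = g i) ->
  lift f m n = lift g m n.
Proof.
move=> e; apply: eq_big_nat => i /andP [h1 h2].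
by rewrite !e ?h1 ?h2 ?(ltnW h2) ?(leqW h1).
Qed.

Lemma lift_neq0 f m n : (forall i, (m <= i <= n)%N -> f i != 0) -> lift f m n != 0.
Proof.
move=> h; rewrite /lift prodf_seq_neq0; apply/allP => i.
rewrite mem_index_iota => /andP [h1 h2]; rewrite implyTb.
by rewrite sqrtc_eq0 mulf_neq0 ?invr_eq0 ?h ?h1 ?h2 ?(ltnW h2) ?(leqW h1).
Qed.

Lemma lift_sqr f m n : (m <= n)%N -> (forall i, (m <= i <= n)%N -> f i != 0) ->
  lift f m n ^+ 2 = f n / f m.
Proof.
move=> mn h; rewrite /lift -prodrXl.
rewrite (eq_bigr (fun i => f i.+1 / f i)) => [|i _]; last by rewrite sqr_sqrtc.
elim: n mn h => [|n IH] mn h.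
  by move: mn; rewrite leqn0 => /eqP e; subst m; rewrite big_geq ?mulfV // h.
case: (ltngtP m n.+1) mn => // [hm|hm] _; last first.
  by rewrite hm big_geq ?mulfV // h // hm leqnn.
rewrite big_nat_recr //= IH //; last first.
  by move=> i /andP[h1 h2]; rewrite h // h1 leqW.
rewrite mulrC mulrA divfK // h //; lia.
Qed.

Lemma lift_shift f m n p : lift (fun i => f (i + p)%N) m n = lift f (m + p) (n + p).
Proof. by rewrite /lift big_addn addnK. Qed.

Lemma lift_rev f n : (forall i, (i < n)%N -> nearby (f i) (f i.+1)) ->
  lift (fun i => f (n - i)%N) 0 n = (lift f 0 n)^-1.
Proof.
move=> h; rewrite /lift big_nat_rev /= -prodfV; apply: eq_big_nat => i hi.
rewrite -sqrtcV_sector; last exact: h.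
rewrite add0n; have -> : (n - (n - i.+1).+1 = i)%N by lia.
have -> : (n - (n - i.+1) = i.+1)%N by lia.
by rewrite invfM invrK mulrC.
Qed.

(* The factor by which a square root of [h] is multiplied when it is continued once around
   the boundary of the rectangle; it is a sign as soon as [h] does not vanish there. *)
Definition box h i0 i1 j0 j1 : C :=
  lift (h ^~ j0) i0 i1 * lift (h i1) j0 j1 /
  (lift (h ^~ j1) i0 i1 * lift (h i0) j0 j1).

Lemma eq_box h h' i0 i1 j0 j1 : (i0 <= i1)%N -> (j0 <= j1)%N ->
  (forall i j, (i0 <= i <= i1)%N -> (j0 <= j <= j1)%N -> h i j = h' i j) ->
  box h i0 i1 j0 j1 = box h' i0 i1 j0 j1.
Proof.
move=> hi hj e; rewrite /box (eq_lift (f := h ^~ j0) (g := h' ^~ j0)).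
  rewrite (eq_lift (f := h ^~ j1) (g := h' ^~ j1)).
    by rewrite (eq_lift (f := h i0) (g := h' i0)) ?(eq_lift (f := h i1) (g := h' i1)) // => k hk;
      apply: e; lia.
  by move=> k hk; apply: e; lia.
by move=> k hk; apply: e; lia.
Qed.

Lemma box_shift h i0 m j0 n :
  box (fun i j => h (i + i0)%N (j + j0)%N) 0 m 0 n = box h i0 (m + i0) j0 (n + j0).
Proof.
rewrite /box !add0n -[i0 in LHS]add0n.
by rewrite !(lift_shift (h ^~ _)) !(lift_shift (h _)) !add0n.
Qed.

Definition fine_on h i0 i1 j0 j1 :=
  (forall i j, (i0 <= i < i1)%N -> (j0 <= j <= j1)%N -> nearby (h i j) (h i.+1 j)) /\
  (forall i j, (i0 <= i <= i1)%N -> (j0 <= j < j1)%N -> nearby (h i j) (h i j.+1)).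

Lemma nearby_neq0 z a : nearby z a -> (z != 0) && (a != 0).
Proof.
rewrite /nearby => h; apply/andP; split; apply: contraTneq h => ->.
  by rewrite invr0 mulr0 /= ltxx.
by rewrite mul0r /= ltxx.
Qed.

(** A ladder between two nearby paths. In each of its squares the two ways across are products of
    two roots with the same square, so they agree by [sqrtcM_sector]. *)
Lemma lift_swap (f g : nat -> C) m n : (m <= n)%N ->
  (forall i, (m <= i < n)%N -> nearby (f i) (f i.+1)) ->
  (forall i, (m <= i < n)%N -> nearby (g i) (g i.+1)) ->
  (forall i, (m <= i <= n)%N -> nearby (f i) (g i)) ->
  lift f m n * sqrtc (g n / f n) = sqrtc (g m / f m) * lift g m n.
Proof.
elim: n => [|n IH] mn hf hg hfg.
  by move: mn; rewrite leqn0 => /eqP ->; rewrite /lift !big_geq // mulr1 mul1r.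
case: (ltngtP m n.+1) mn => // [hm|hm] _; last first.
  by rewrite hm /lift !big_geq // mulr1 mul1r.
rewrite /lift !big_nat_recr //= -/(lift f m n) -/(lift g m n).
have e : sqrtc (f n.+1 / f n) * sqrtc (g n.+1 / f n.+1) =
         sqrtc (g n / f n) * sqrtc (g n.+1 / g n).
  have [ff gg] : nearby (f n) (f n.+1) /\ nearby (g n) (g n.+1).
    by split; [apply: hf|apply: hg]; lia.
  apply: sqrtcM_sector => //; try (by apply: hfg; lia).
  have /andP[f0 f1] := nearby_neq0 ff; have /andP[g0 g1] := nearby_neq0 gg.
  by field; rewrite f0 f1 g0.
rewrite -mulrA e !mulrA; congr (_ * _); apply: IH => //.
- by move=> i hi; apply: hf; lia.
- by move=> i hi; apply: hg; lia.
- by move=> i hi; apply: hfg; lia.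
Qed.

Lemma rect_lift h i0 i1 j0 j1 : (i0 <= i1)%N -> (j0 <= j1)%N ->
  fine_on h i0 i1 j0 j1 ->
  lift (h ^~ j0) i0 i1 * lift (h i1) j0 j1 =
  lift (h i0) j0 j1 * lift (h ^~ j1) i0 i1.
Proof.
move=> hi; elim: j1 => [|j1 IH] hj [hh hv].
  by move: hj; rewrite leqn0 => /eqP ->; rewrite !lift_nil mulr1 mul1r.
case: (ltngtP j0 j1.+1) hj => // [hm|->] _; last first.
  by rewrite !lift_nil mulr1 mul1r.
have st : forall k, lift (h k) j0 j1.+1 = lift (h k) j0 j1 * sqrtc (h k j1.+1 / h k j1).
  by move=> k; rewrite /lift big_nat_recr.
rewrite !st mulrA IH //; last by split=> i j h1 h2; [apply: hh|apply: hv]; lia.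
rewrite -!mulrA; congr (_ * _); apply: lift_swap => //.
- by move=> i h1; apply: hh; lia.
- by move=> i h1; apply: hh; lia.
- by move=> i h1; apply: hv; lia.
Qed.

Definition nz_on h i0 i1 j0 j1 :=
  forall i j, (i0 <= i <= i1)%N -> (j0 <= j <= j1)%N -> h i j != 0.

Lemma fine_on_nz h i0 i1 j0 j1 : (i0 < i1)%N -> fine_on h i0 i1 j0 j1 ->
  nz_on h i0 i1 j0 j1.
Proof.
move=> lt [hh _] i j hi hj; case: (ltnP i i1) => h1.
  by have /andP[] := nearby_neq0 (hh i j ltac:(lia) hj).
have /andP[_ ] := nearby_neq0 (hh i1.-1 j ltac:(lia) hj).
by rewrite prednK; [have -> : i1 = i by lia|lia].
Qed.

Lemma box_fine h i0 i1 j0 j1 : (i0 < i1)%N -> (j0 <= j1)%N ->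
  fine_on h i0 i1 j0 j1 -> box h i0 i1 j0 j1 = 1.
Proof.
move=> hi hj hf; have e := rect_lift (ltnW hi) hj hf; rewrite /box e.
rewrite mulrC [X in _ * X]mulrC; apply: mulVf.
have nz := fine_on_nz hi hf.
by rewrite mulf_neq0 // lift_neq0 // => k hk; apply: nz; lia.
Qed.

Definition trans h i j := h j i.

Lemma box_trans h i0 i1 j0 j1 : box (trans h) j0 j1 i0 i1 = (box h i0 i1 j0 j1)^-1.
Proof. by rewrite /box invf_div; congr (_ / _); rewrite mulrC. Qed.

Lemma box_cat h i0 i1 i2 j0 j1 : (i0 <= i1 <= i2)%N -> (j0 <= j1)%N ->
  (forall j, (j0 <= j <= j1)%N -> h i1 j != 0) ->
  box h i0 i1 j0 j1 * box h i1 i2 j0 j1 = box h i0 i2 j0 j1.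
Proof.
move=> hi hj nz; rewrite /box -(lift_cat (h ^~ j0) hi) -(lift_cat (h ^~ j1) hi).
have := lift_neq0 nz; rewrite !invfM => l0.
move: (lift (h i1) j0 j1) l0 => x; move: (lift _ _ _)^-1 => a x0.
move: (lift _ _ _)^-1 => b; move: (lift _ _ _) => c; move: (lift _ _ _)^-1 => d.
by move: (lift _ _ _) => e; move: (lift _ _ _) => g; field.
Qed.

Lemma box_cat_vert h i0 i1 j0 j1 j2 : (j0 <= j1 <= j2)%N -> (i0 <= i1)%N ->
  (forall i, (i0 <= i <= i1)%N -> h i j1 != 0) ->
  box h i0 i1 j0 j1 * box h i0 i1 j1 j2 = box h i0 i1 j0 j2.
Proof.
move=> hj hi nz; apply: invr_inj; rewrite invfM -!box_trans mulrC mulrC.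
exact: box_cat.
Qed.

(** The grid is cut along four lines and the outer pieces, being trivial, are dropped. Only the
    cutting lines must avoid zeros, so the inner box may contain some. *)
Lemma box_concentrate h N i0 i1 j0 j1 : (i0 <= i1 <= N)%N -> (j0 <= j1 <= N)%N ->
  (forall j, (j <= N)%N -> h i0 j != 0 /\ h i1 j != 0) ->
  (forall i, (i <= N)%N -> h i j0 != 0 /\ h i j1 != 0) ->
  box h 0 i0 0 N = 1 -> box h i1 N 0 N = 1 ->
  box h i0 i1 0 j0 = 1 -> box h i0 i1 j1 N = 1 ->
  box h 0 N 0 N = box h i0 i1 j0 j1.
Proof.
move=> hi hj nzi nzj e1 e2 e3 e4.
rewrite -(@box_cat h 0 i0 N 0 N) //; [|lia|by move=> j hj'; have [] := nzi j].
rewrite e1 mul1r -(@box_cat h i0 i1 N 0 N) //; [|by move=> j hj'; have [] := nzi j].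
rewrite e2 mulr1 -(@box_cat_vert h i0 i1 0 j0 N) //; [|lia|lia|]; last first.
  by move=> i hi'; have [] := nzj i ltac:(lia).
rewrite e3 mul1r -(@box_cat_vert h i0 i1 j0 j1 N) //; [|lia|]; last first.
  by move=> i hi'; have [] := nzj i ltac:(lia).
by rewrite e4 mulr1.
Qed.

(* A grid function that changes sign under the half turn has box value -1: opposite
   sides contribute equally, and half the boundary lifts [z(i1,j1)/z(i0,j0) = -1]. *)
Lemma box_odd h m n :
  (forall i j, (i <= m)%N -> (j <= n)%N -> h (m - i)%N (n - j)%N = - h i j) ->
  (forall i j, (i < m)%N -> (j == 0)%N || (j == n) -> nearby (h i j) (h i.+1 j)) ->
  (forall i j, (i == 0)%N || (i == m) -> (j < n)%N -> nearby (h i j) (h i j.+1)) ->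
  (0 < m)%N -> (0 < n)%N ->
  box h 0 m 0 n = -1.
Proof.
move=> odd hh hv m0 n0.
have e1 : lift (h ^~ n) 0 m = (lift (h ^~ 0%N) 0 m)^-1.
  rewrite -lift_rev; last by move=> i hi; apply: hh.
  rewrite /lift; apply: eq_big_nat => i hi.
  have e k : (k <= m)%N -> h k n = - h (m - k)%N 0%N.
    by move=> hk; rewrite -odd ?leq_subr // subKn // subn0.
  by rewrite !e ?invrN ?mulrNN //; lia.
have e2 : lift (h 0%N) 0 n = (lift (h m) 0 n)^-1.
  rewrite -lift_rev; last by move=> i hi; apply: hv; rewrite ?eqxx ?orbT.
  rewrite /lift; apply: eq_big_nat => i hi.
  have e k : (k <= n)%N -> h 0%N k = - h m (n - k)%N.
    by move=> hk; rewrite -[in RHS](subn0 m) odd // opprK.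
  by rewrite !e ?invrN ?mulrNN //; lia.
have nz1 i : (0 <= i <= m)%N -> h i 0%N != 0.
  move=> hi; case: (ltnP i m) => im.
    by have /andP[] := nearby_neq0 (hh i 0%N im ltac:(by [])).
  have /andP[_] := nearby_neq0 (hh m.-1 0%N ltac:(lia) ltac:(by [])).
  by rewrite prednK; [have -> : m = i by lia|lia].
have nz2 i : (0 <= i <= n)%N -> h m i != 0.
  move=> hi; case: (ltnP i n) => im.
    by have /andP[] := nearby_neq0 (hv m i ltac:(by rewrite eqxx orbT) im).
  have /andP[_] := nearby_neq0 (hv m n.-1 ltac:(by rewrite eqxx orbT) ltac:(lia)).
  by rewrite prednK; [have -> : n = i by lia|lia].
rewrite /box e1 e2 invfM !invrK mulrACA -!expr2.
rewrite !lift_sqr // mulrC mulrA divfK ?nz1 ?leqnn //.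
have -> : h m n = - h 0%N 0%N by rewrite -odd // !subn0.
by rewrite mulNr mulfV // nz1.
Qed.

(** Only the boundary has to move through nearby values. By [lift_swap] each side changes by the
    factors of the steps at its two corners, and these cancel in the quotient. *)
Lemma box_homotopy (H : nat -> nat -> nat -> C) m n L : (0 < m)%N -> (0 < n)%N ->
  (forall l i j, (l < L)%N -> (i <= m)%N -> (j <= n)%N ->
     [|| i == 0, i == m, j == 0 | j == n]%N -> nearby (H l i j) (H l.+1 i j)) ->
  (forall l i j, (l <= L)%N -> (i < m)%N -> (j == 0)%N || (j == n) ->
     nearby (H l i j) (H l i.+1 j)) ->
  (forall l i j, (l <= L)%N -> (i == 0)%N || (i == m) -> (j < n)%N ->
     nearby (H l i j) (H l i j.+1)) ->
  box (H 0%N) 0 m 0 n = box (H L) 0 m 0 n.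
Proof.
move=> m0 n0 hl hi hj; elim: L hl hi hj => // L IH hl hi hj.
rewrite IH //; last first.
- by move=> l i j h1 h2 h3; apply: hj => //; lia.
- by move=> l i j h1 h2 h3; apply: hi => //; lia.
- by move=> l i j h1 h2 h3; apply: hl => //; lia.
pose s i j := sqrtc (H L.+1 i j / H L i j).
have sw1 j : (j == 0)%N || (j == n) ->
    lift (H L ^~ j) 0 m * s m j = s 0%N j * lift (H L.+1 ^~ j) 0 m.
  move=> h; apply: (@lift_swap (H L ^~ j) (H L.+1 ^~ j)) => // i h1.
  - by apply: hi => //; lia.
  - by apply: hi => //; lia.
  - by apply: hl => //; lia.
have sw2 i : (i == 0)%N || (i == m) ->
    lift (H L i) 0 n * s i n = s i 0%N * lift (H L.+1 i) 0 n.
  move=> h; apply: (@lift_swap (H L i) (H L.+1 i)) => // j h1.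
  - by apply: hj => //; lia.
  - by apply: hj => //; lia.
  - by apply: hl => //; lia.
have s0 i j : (i <= m)%N -> (j <= n)%N ->
    [|| i == 0, i == m, j == 0 | j == n]%N -> s i j != 0.
  move=> h1 h2 h3; have /andP[z1 z2] := nearby_neq0 (hl L i j (leqnn _) h1 h2 h3).
  by rewrite sqrtc_eq0 mulf_neq0 // invr_eq0.
have l0 l i : (l <= L.+1)%N -> (i == 0)%N || (i == m) -> lift (H l i) 0 n != 0.
  move=> h1 h; apply: lift_neq0 => j h2; case: (ltnP j n) => jn.
    by have /andP[] := nearby_neq0 (hj l i j h1 h jn).
  have /andP[_] := nearby_neq0 (hj l i n.-1 h1 h ltac:(lia)).
  by rewrite prednK; [have -> : n = j by lia|lia].
have l1 l j : (l <= L.+1)%N -> (j == 0)%N || (j == n) -> lift (H l ^~ j) 0 m != 0.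
  move=> h1 h; apply: lift_neq0 => i h2; case: (ltnP i m) => im.
    by have /andP[] := nearby_neq0 (hi l i j h1 im h).
  have /andP[_] := nearby_neq0 (hi l m.-1 j h1 ltac:(lia) h).
  by rewrite prednK; [have -> : m = i by lia|lia].
have em : (m == 0)%N || (m == m) by rewrite eqxx orbT.
have en : (n == 0)%N || (n == n) by rewrite eqxx orbT.
have := sw1 0%N isT; have := sw1 n en; have := sw2 0%N isT; have := sw2 m em.
have := s0 0%N 0%N isT isT isT; have := s0 m 0%N (leqnn _) isT ltac:(by rewrite eqxx orbT).
have := s0 0%N n isT (leqnn _) isT; have := s0 m n (leqnn _) (leqnn _) ltac:(by rewrite eqxx orbT).
have := l0 L 0%N (leqnSn _) isT; have := l0 L m (leqnSn _) em.
have := l0 L.+1 0%N (leqnn _) isT; have := l0 L.+1 m (leqnn _) em.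
have := l1 L 0%N (leqnSn _) isT; have := l1 L n (leqnSn _) en.
have := l1 L.+1 0%N (leqnn _) isT; have := l1 L.+1 n (leqnn _) en.
rewrite /box; move: (lift (H L.+1 ^~ n) _ _) => A1; move: (lift (H L.+1 ^~ 0%N) _ _) => A2.
move: (lift (H L.+1 m) _ _) => A3; move: (lift (H L.+1 0%N) _ _) => A4.
move: (lift (H L ^~ n) _ _) => B1; move: (lift (H L ^~ 0%N) _ _) => B2.
move: (lift (H L m) _ _) => B3; move: (lift (H L 0%N) _ _) => B4.
move: (s m n) (s m 0%N) (s 0%N n) (s 0%N 0%N) => smn sm0 s0n s00.
move=> a1 a2 b1 b2 a3 a4 b3 b4 c1 c2 c3 c4 e1 e2 e3 e4.
have -> : B3 = sm0 * A3 / smn by rewrite -e1 mulfK.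
have -> : B4 = s00 * A4 / s0n by rewrite -e2 mulfK.
have -> : B1 = s0n * A1 / smn by rewrite -e3 mulfK.
have -> : B2 = s00 * A2 / sm0 by rewrite -e4 mulfK.
by field; rewrite ?a1 ?a4 ?c1 ?c2 ?c3 ?c4.
Qed.
End SquareRootLifts.

(* Multiplying the relations over the six pairs [j != l] turns the [Sa] into squares, so
   that [B k := \prod_(j != l) Sb k l j] is determined by the points up to a common
   factor; going around the triangle 0, 1, 2 then gives [1 = -1]. *)
Lemma K33_signs (F : fieldType) (a b : 'I_3 -> F) (Sa Sb : 'I_3 -> 'I_3 -> 'I_3 -> F) :
  (2 : F) != 0 -> injective a -> (forall i j, a i != b j) ->
  (forall i j k, i != k -> Sa i j k ^+ 2 = (b j - a k) / (a i - a k)) ->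
  (forall i j l, j != l -> Sb i j l != 0) ->
  (forall i j k l, i != k -> j != l ->
     Sa i j k * Sb k l j = Sb i j l * Sa k l i) -> False.
Proof.
move=> F2 inja ab hA hB hchi.
pose o0 : 'I_3 := ord0; pose o1 : 'I_3 := Ordinal (erefl (1 < 3)%N).
pose o2 : 'I_3 := Ordinal (erefl (2 < 3)%N).
pose A i k := Sa i o0 k ^+ 2 * Sa i o1 k ^+ 2 * Sa i o2 k ^+ 2.
pose B k := Sb k o1 o0 * Sb k o2 o0 * Sb k o0 o1 * Sb k o2 o1 * Sb k o0 o2 * Sb k o1 o2.
have E i k : i != k -> A i k * B k = B i * A k i.
  move=> ik.
  transitivity ((Sa i o0 k * Sb k o1 o0) * (Sa i o0 k * Sb k o2 o0) *
    (Sa i o1 k * Sb k o0 o1) * (Sa i o1 k * Sb k o2 o1) *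
    (Sa i o2 k * Sb k o0 o2) * (Sa i o2 k * Sb k o1 o2)); first by rewrite /A /B; ring.
  by rewrite !hchi // /A /B; ring.
have B0 k : B k != 0 by rewrite /B !mulf_neq0 // hB.
pose c k := (b o0 - a k) * (b o1 - a k) * (b o2 - a k).
have A_E i k : i != k -> A i k = c k / (a i - a k) ^+ 3.
  move=> ik; have d0 : a i - a k != 0 by rewrite subr_eq0 (inj_eq inja).
  by rewrite /A !hA // /c; field.
have c0 k : c k != 0 by rewrite /c !mulf_neq0 // subr_eq0 eq_sym ab.
have d0 i k : i != k -> a i - a k != 0 by move=> ik; rewrite subr_eq0 (inj_eq inja).
have e01 := E o0 o1 isT; have e12 := E o1 o2 isT; have e02 := E o0 o2 isT.
(* Around the triangle the factors [B] cancel. By [A_E] both sides carry the same numerator, while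
   the three cubed differences are all reversed on the right: the two sides are opposite as well as
   equal. *)
have key : A o0 o1 * A o1 o2 * A o2 o0 = A o1 o0 * A o2 o1 * A o0 o2.
  apply: (mulfI (B0 o0)); apply: (mulfI (B0 o1)); apply: (mulfI (B0 o2)).
  transitivity ((A o0 o1 * B o1) * (A o1 o2 * B o2) * (B o0 * A o2 o0)); first ring.
  by rewrite e01 e12 -e02; ring.
move: key; rewrite !A_E // => key.
have : (2 : F) * (c o0 * c o1 * c o2 /
    ((a o0 - a o1) ^+ 3 * (a o1 - a o2) ^+ 3 * (a o2 - a o0) ^+ 3)) = 0.
  move: key; set p := (X in X = _); set q := (X in _ = X).
  have -> : q = - p.
    rewrite /p /q -(opprB (a o0) (a o1)) -(opprB (a o1) (a o2)) -(opprB (a o2) (a o0)).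
    move: (d0 o0 o1 isT) (d0 o1 o2 isT) (d0 o2 o0 isT).
    move: (a o0 - a o1) (a o1 - a o2) (a o2 - a o0) => x y z x0 y0 z0.
    by field; rewrite ?oppr_eq0 x0 y0 z0.
  move=> /eqP; rewrite -addr_eq0 => /eqP h; transitivity (p + p) => //.
  by rewrite /p; field; rewrite !d0.
apply/eqP; apply: mulf_neq0 => //; apply: mulf_neq0.
  exact: (mulf_neq0 (mulf_neq0 (c0 _) (c0 _)) (c0 _)).
have dd i k : i != k -> (a i - a k) ^+ 3 != 0 by move=> ik; rewrite expf_neq0 ?d0.
move: (dd o0 o1 isT) (dd o1 o2 isT) (dd o2 o0 isT).
set x := (a o0 - a o1) ^+ 3; set y := (a o1 - a o2) ^+ 3; set z := (a o2 - a o0) ^+ 3.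
by move: x y z => x y z x0 y0 z0; rewrite invr_eq0 !mulf_neq0.
Qed.

(** * Continuity and compactness in the plane *)

Section PlaneContinuity.
Variable R : realType.
Local Notation pt := (R * R)%type.
Local Open Scope classical_set_scope.

Definition toC (p : pt) : R[i] := Complex p.1 p.2.
Definition dot (p q : pt) : R := p.1 * q.1 + p.2 * q.2.

Lemma toCB p q : toC (p - q) = toC p - toC q.
Proof. by case: p => ? ?; case: q. Qed.

Lemma toC_inj : injective toC.
Proof. by case=> ? ? [? ?] [-> ->]. Qed.

Lemma nearby_dot p q : 0 < dot p q -> nearby (toC p) (toC q).
Proof.
rewrite /nearby /dot; case: p q => [a b] [c d] /= h.
have h0 : 0 < a ^+ 2 + b ^+ 2.
  rewrite lt_neqAle addr_ge0 ?sqr_ge0 // andbT eq_sym paddr_eq0 ?sqr_ge0 //.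
  by rewrite !expf_eq0 /=; apply: contraTN h => /andP[/eqP -> /eqP ->]; rewrite !mul0r addr0 ltxx.
rewrite (_ : _ - _ = (a * c + b * d) / (a ^+ 2 + b ^+ 2)) ?divr_gt0 //.
by field; rewrite gt_eqF.
Qed.

Lemma within_continuous_comp (S T W : topologicalType) (A : set T) (f : T -> W) (k : S -> T) :
  continuous k -> (forall x, A (k x)) -> {within A, continuous f} -> continuous (f \o k).
Proof.
move=> ck kA /subspace_continuousP cf x.
apply: cvg_trans (cf (k x) (kA x)) => B /= hB.
have := ck x _ hB; rewrite nbhs_simpl /=; apply: filterS => y /=.
by apply; apply: kA.
Qed.

(** For [a <= b], the retraction of the line onto the segment; composing with it turns continuity
    within a set into continuity everywhere. *)
Definition clamp (a b t : R) := Order.max a (Order.min b t).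

Lemma clamp_continuous a b : continuous (clamp a b).
Proof.
move=> x; apply: (@continuous_max R R (fun=> a) (fun t => Order.min b t)).
  exact: cst_continuous.
apply: (@continuous_min R R (fun=> b) id); first exact: cst_continuous.
exact: cvg_id.
Qed.

Lemma clamp_in a b t : a <= b -> a <= clamp a b t <= b.
Proof.
move=> ab; rewrite /clamp le_max lexx /= ge_max ab /=.
by rewrite ge_min lexx.
Qed.

Lemma clamp_id a b t : a <= t <= b -> clamp a b t = t.
Proof. by case/andP=> h1 h2; rewrite /clamp (min_idPr h2) (max_idPr h1). Qed.

Lemma dot_gt0 p : p != 0 -> 0 < dot p p.
Proof.
case: p => a b h; rewrite /dot /= -!expr2 lt_neqAle addr_ge0 ?sqr_ge0 // andbT eq_sym.
rewrite paddr_eq0 ?sqr_ge0 // !expf_eq0 /=; apply: contraNN h => /andP[/eqP -> /eqP ->].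
by [].
Qed.

(** A Lebesgue number argument: the neighbourhoods of the diagonal points have a common radius by
    compactness. *)
Lemma compact_near_diag (T : pseudoMetricType R) (K : set T) (W : T -> T -> Prop) :
  compact K -> (forall x, K x -> \forall z \near (x, x), W z.1 z.2) ->
  exists2 eta : R, 0 < eta & forall x y, K x -> K y -> ball x eta y -> W x y.
Proof.
move=> /compact_near_coveringP cK hW.
pose P (e : R) x := forall y, K y -> ball x e y -> W x y.
have : \forall e \near 0^'+, K `<=` P e.
  apply: cK => x /hW [-[A B] /= [nA nB] hAB].
  have /nbhs_ballP [r /= r0 hr] : nbhs x (A `&` B) by apply: filterI.
  have r2 : 0 < r / 2 by rewrite divr_gt0.
  exists (ball x (r / 2), [set e : R | e < r / 2]) => /=.
    split; first exact: nbhsx_ballx.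
    by near=> e; near: e; apply: nbhs_right_lt.
  case=> y e [/= hy he] z Kz hz; apply: (hAB (y, z)); split => /=.
    by have [] : (A `&` B) y by apply: hr; apply: le_ball hy; rewrite ler_pdivrMr // ler_peMr // ?ltW //; lra.
  have [] // : (A `&` B) z; apply: hr; rewrite [r]splitr.
  by apply: ball_triangle hy _; apply: le_ball hz; apply: ltW.
move=> h; have : \forall e \near 0^'+, (0 < e) /\ K `<=` P e.
  by apply: filterI => //; apply: nbhs_right_gt.
by move=> /filter_ex [e [e0 he]]; exists e => // x y Kx Ky; apply: he.
Unshelve. all: by end_near. Qed.

Lemma compact_dot (T : pseudoMetricType R) (K : set T) (F : T -> pt) :
  compact K -> continuous F -> (forall x, K x -> F x != 0) ->
  exists2 eta : R, 0 < eta & forall x y, K x -> K y -> ball x eta y -> 0 < dot (F x) (F y).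
Proof.
move=> cK cF nz; apply: compact_near_diag => // x Kx.
have cd : continuous (fun z : T * T => dot (F z.1) (F z.2)).
  move=> z; rewrite /dot.
  have c1 : (F w.1 @[w --> z]) --> F z.1 by apply: (continuous_comp (@cvg_fst _ _ _ _ _) (cF _)).
  have c2 : (F w.2 @[w --> z]) --> F z.2 by apply: (continuous_comp (@cvg_snd _ _ _ _ _) (cF _)).
  have d1 : ((F w.1).1 @[w --> z]) --> (F z.1).1 by apply: (cvg_comp _ _ c1 (@cvg_fst _ _ _ _ _)).
  have d2 : ((F w.1).2 @[w --> z]) --> (F z.1).2 by apply: (cvg_comp _ _ c1 (@cvg_snd _ _ _ _ _)).
  have d3 : ((F w.2).1 @[w --> z]) --> (F z.2).1 by apply: (cvg_comp _ _ c2 (@cvg_fst _ _ _ _ _)).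
  have d4 : ((F w.2).2 @[w --> z]) --> (F z.2).2 by apply: (cvg_comp _ _ c2 (@cvg_snd _ _ _ _ _)).
  exact: cvgD (cvgM d1 d3) (cvgM d2 d4).
have pos : 0 < dot (F x) (F x) by apply: dot_gt0; apply: nz.
exact: (cd (x, x) _ (lt_nbhsr pos)).
Qed.

Lemma uniform_on_segment (x : R -> R) a b (eta : R) : continuous x -> 0 < eta ->
  exists2 nu : R, 0 < nu & forall s s', a <= s <= b -> a <= s' <= b -> `|s - s'| < nu ->
    `|x s - x s'| < eta.
Proof.
move=> cx eta0; have [|nu nu0 h] := @compact_near_diag R `[a, b] (fun s s' => `|x s - x s'| < eta)
  (@segment_compact _ a b).
  move=> s _; have c : continuous (fun z : R * R => `|x z.1 - x z.2|).
    move=> z; apply: cvg_norm.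
    have c1 : (x w.1 @[w --> z]) --> x z.1 by apply: (continuous_comp (@cvg_fst _ _ _ _ _) (cx _)).
    have c2 : (x w.2 @[w --> z]) --> x z.2 by apply: (continuous_comp (@cvg_snd _ _ _ _ _) (cx _)).
    exact: cvgB c1 c2.
  have lt : `|x (s, s).1 - x (s, s).2| < eta by rewrite /= subrr normr0.
  exact: (c (s, s) _ (lt_nbhsl lt)).
by exists nu => // s s' hs hs' d; apply: h => //; rewrite /= in_itv.
Qed.

Lemma rect_nearby (e f : R -> pt) a b c d : continuous e -> continuous f ->
  (forall s t, a <= s <= b -> c <= t <= d -> e s != f t) ->
  exists2 eta : R, 0 < eta & forall s s' t t',
    a <= s <= b -> a <= s' <= b -> c <= t <= d -> c <= t' <= d ->
    `|s - s'| < eta -> `|t - t'| < eta ->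
    nearby (toC (e s - f t)) (toC (e s' - f t')).
Proof.
move=> ce cf ne.
have cK : compact (`[a, b] `*` `[c, d]) by apply: compact_setX; apply: segment_compact.
have cF : continuous (fun z : pt => e z.1 - f z.2).
  move=> z.
  have c1 : (e w.1 @[w --> z]) --> e z.1 by apply: (continuous_comp (@cvg_fst _ _ _ _ _) (ce _)).
  have c2 : (f w.2 @[w --> z]) --> f z.2 by apply: (continuous_comp (@cvg_snd _ _ _ _ _) (cf _)).
  exact: cvgB c1 c2.
have [|eta eta0 h] := compact_dot cK cF.
  by move=> -[s t] [/= h1 h2]; rewrite subr_eq0; apply: ne; rewrite -?in_itv.
exists eta => // s s' t t' hs hs' ht ht' ds dt; apply: nearby_dot.
by apply: (h (s, t) (s', t')); split; rewrite /= ?in_itv.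
Qed.
End PlaneContinuity.

Section InnerBox.
Variable R : realType.
Local Notation pt := (R * R)%type.
Local Open Scope classical_set_scope.

Definition in_box (p : pt) := (`|p.1| <= 1 / 2 :> R) && (`|p.2| <= 1 / 2 :> R).

(** The pairs in the square whose coordinates differ by at least [delta] form a compact set, on
    which [g p - g q] cannot vanish by injectivity; [compact_dot] applies there. *)
Lemma disk_nearby (g : pt -> pt) (delta : R) : continuous g ->
  (forall p q, in_box p -> in_box q -> g p = g q -> p = q) -> 0 < delta ->
  exists2 eta : R, 0 < eta & forall p q p' q',
    in_box p -> in_box q -> in_box p' -> in_box q' ->
    (delta <= `|p.1 - q.1|) || (delta <= `|p.2 - q.2|) ->
    (delta <= `|p'.1 - q'.1|) || (delta <= `|p'.2 - q'.2|) ->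
    `|p.1 - p'.1| < eta -> `|p.2 - p'.2| < eta ->
    `|q.1 - q'.1| < eta -> `|q.2 - q'.2| < eta ->
    nearby (toC (g p - g q)) (toC (g p' - g q')).
Proof.
move=> cg ig d0; pose I := (`[- (1 / 2), 1 / 2] : set R).
have inI (x : R) : `|x| <= 1 / 2 -> I x by rewrite /I /= in_itv /= ler_norml.
have outI (x : R) : I x -> `|x| <= 1 / 2 by rewrite /I /= in_itv /= ler_norml.
have cI : compact I by apply: segment_compact.
pose D := [set z : pt * pt | delta <= `|z.1.1 - z.2.1|] `|`
          [set z : pt * pt | delta <= `|z.1.2 - z.2.2|].
have c1 (z : pt * pt) : (w.1 @[w --> z]) --> z.1 by exact: cvg_fst.
have c2 (z : pt * pt) : (w.2 @[w --> z]) --> z.2 by exact: cvg_snd.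
have cD : closed D.
  apply: closedU.
    apply: (@closed_comp _ _ (fun z : pt * pt => `|z.1.1 - z.2.1|) [set x | delta <= x]).
      move=> z _; apply: cvg_norm; apply: cvgB.
        exact: (cvg_comp _ _ (c1 z) (@cvg_fst _ _ _ _ _)).
      exact: (cvg_comp _ _ (c2 z) (@cvg_fst _ _ _ _ _)).
    exact: closed_ge.
  apply: (@closed_comp _ _ (fun z : pt * pt => `|z.1.2 - z.2.2|) [set x | delta <= x]).
    move=> z _; apply: cvg_norm; apply: cvgB.
      exact: (cvg_comp _ _ (c1 z) (@cvg_snd _ _ _ _ _)).
    exact: (cvg_comp _ _ (c2 z) (@cvg_snd _ _ _ _ _)).
  exact: closed_ge.
have cK : compact (((I `*` I) `*` (I `*` I)) `&` D).
  by apply: compact_closedI => //; do !apply: compact_setX.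
have cF : continuous (fun z : pt * pt => g z.1 - g z.2).
  move=> z.
  have e1 : (g w.1 @[w --> z]) --> g z.1 by apply: (continuous_comp (@cvg_fst _ _ _ _ _) (cg _)).
  have e2 : (g w.2 @[w --> z]) --> g z.2 by apply: (continuous_comp (@cvg_snd _ _ _ _ _) (cg _)).
  exact: cvgB e1 e2.
have [|eta eta0 h] := compact_dot cK cF.
  case=> p q [[[/= p1 p2] [/= q1 q2]] /= hD]; rewrite subr_eq0; apply/eqP => /ig e.
  have {e} e : p = q.
    by apply: e; apply/andP; split; apply: outI.
  by case: hD => /=; rewrite e subrr normr0 leNgt d0.
exists eta => // p q p' q' /andP[a1 a2] /andP[a3 a4] /andP[b1 b2] /andP[b3 b4] hd hd' e1 e2 e3 e4.
apply: nearby_dot; apply: (h (p, q) (p', q')).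
- by split; [split; split; apply: inI|case/orP: hd; [left|right]].
- by split; [split; split; apply: inI|case/orP: hd'; [left|right]].
- by [].
Qed.

(* Interpolates between [x] and the odd affine sequence from [-+ delta] to [+- delta],
   staying away from [0] at both ends because the signs agree there. *)
Lemma linearize (x : nat -> R) m (delta eta : R) : (0 < m)%N -> 0 < delta ->
  (forall i, (i <= m)%N -> `|x i| <= 1 / 2) ->
  (forall i, (i < m)%N -> `|x i.+1 - x i| < eta) ->
  delta <= `|x 0%N| -> delta <= `|x m| -> x 0%N * x m < 0 ->
  exists X : R -> nat -> R,
    [/\ forall i, X 0 i = x i,
        forall i, (i <= m)%N -> X 1 (m - i)%N = - X 1 i,
        forall l i, 0 <= l <= 1 -> (i <= m)%N -> `|X l i| <= 1 / 2,
        forall l i, 0 <= l <= 1 -> (i < m)%N -> `|X l i.+1 - X l i| < eta &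
        (forall l, 0 <= l <= 1 -> delta <= `|X l 0%N| /\ delta <= `|X l m|) /\
        (forall l l' i, (i <= m)%N -> `|X l i - X l' i| <= `|l - l'|)].
Proof.
move=> m0 d0 hx hs h0 hm hopp.
have mR : 0 < m%:R :> R by rewrite ltr0n.
pose s := Num.sg (x m); pose t i : R := s * delta * (2 * i%:R / m%:R - 1).
have xm0 : x m != 0 by rewrite -normr_gt0 (lt_le_trans d0).
have s2 : s * s = 1 by rewrite /s -expr2 sqr_sg xm0.
have sm : s * x m = `|x m| by rewrite normrEsg.
have s0 : s * x 0%N <= - delta.
  have : s * x 0%N < 0.
    have : 0 < `|x m| by rewrite normr_gt0.
    move: hopp; rewrite -sm -[x 0%N * x m]mul1r -s2 => h1 h2.
    by rewrite -(pmulr_llt0 _ h2); move: h1; congr (_ < _); ring.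
  have e : `|s * x 0%N| = `|x 0%N| by rewrite normrM normr_sg xm0 mul1r.
  by move=> h; move: h0; rewrite -e ltr0_norm //; lra.
have ns (z : R) : `|s * z| = `|z| by rewrite normrM normr_sg xm0 mul1r.
have dh : delta <= 1 / 2 by apply: le_trans h0 (hx 0%N _).
have ir i : (i <= m)%N -> 0 <= (i%:R / m%:R : R) <= 1.
  by move=> im; rewrite divr_ge0 ?ler0n //= ler_pdivrMr // mul1r ler_nat.
have tb i : (i <= m)%N -> `|t i| <= delta.
  move=> /ir hi; rewrite /t -mulrA ns normrM gtr0_norm // ger_pMr // ler_norml -mulrA.
  by move: (i%:R / m%:R) hi => u hu; lra.
(* Up to the sign [s], the sequence climbs from at most [- delta] to at least [delta] in [m] steps
   shorter than [eta]; hence the affine sequence, whose steps are [2 * delta / m], is fine enough as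
   well. *)
have step : 2 * delta < m%:R * eta.
  apply: (@le_lt_trans _ _ `|x m - x 0%N|).
    by rewrite -ns mulrBr sm; apply: le_trans (ler_norm _); lra.
  rewrite -telescope_sumr // (le_lt_trans (ler_norm_sum _ _ _)) //.
  rewrite -[m in m%:R]subn0 mulr_natl -sumr_const_nat.
  by apply: ltr_sum_nat => // i /andP[_ hi]; apply: hs.
have ts i : `|t i.+1 - t i| < eta.
  have -> : t i.+1 - t i = s * (2 * delta / m%:R) by rewrite /t; field; rewrite gt_eqF.
  have h : 0 <= 2 * delta / m%:R by apply: divr_ge0; [lra|apply: ltW].
  by rewrite ns (ger0_norm h) ltr_pdivrMr // [eta * _]mulrC.
have cv (l u v : R) : 0 <= l <= 1 -> `|(1 - l) * u + l * v| <= (1 - l) * `|u| + l * `|v|.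
  move=> /andP[l0 l1]; apply: le_trans (ler_normD _ _) _.
  by rewrite !normrM (ger0_norm l0) (@ger0_norm _ (1 - l)) ?subr_ge0.
exists (fun l i => (1 - l) * x i + l * t i); split.
- by move=> i; rewrite subr0 mul0r mul1r addr0.
- move=> i im; rewrite subrr !mul0r !add0r !mul1r /t natrB //.
  by field; rewrite gt_eqF.
- move=> l i hl im; apply: le_trans (cv _ _ _ hl) _.
  move: (hx i im) (le_trans (tb i im) dh) (hl).
  by move: (`|x i|) (`|t i|) => u v hu hv /andP[l0 l1]; nra.
- move=> l i hl im.
  have -> : (1 - l) * x i.+1 + l * t i.+1 - ((1 - l) * x i + l * t i) =
    (1 - l) * (x i.+1 - x i) + l * (t i.+1 - t i) by ring.
  apply: le_lt_trans (cv _ _ _ hl) _.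
  move: (hs i im) (ts i) (hl); move: (`|x i.+1 - x i|) (`|t i.+1 - t i|).
  by move=> u v hu hv /andP[l0 l1]; have [hh|hh] := leP l (1 / 2); nra.
split.
  have t0 : t 0%N = - (s * delta) by rewrite /t mulr0 mul0r; ring.
  have tm : t m = s * delta by rewrite /t mulfK ?gt_eqF //; ring.
  move=> l /andP[l0 l1]; rewrite -(ns (_ + _)) -(ns ((1 - l) * x m + _)) t0 tm.
  have -> : s * ((1 - l) * x 0%N + l * - (s * delta)) =
            (1 - l) * (s * x 0%N) - l * (s * s) * delta by ring.
  have -> : s * ((1 - l) * x m + l * (s * delta)) =
            (1 - l) * (s * x m) + l * (s * s) * delta by ring.
  rewrite s2 sm; split.
    rewrite -normrN; apply: le_trans (ler_norm _); move: (s * x 0%N) s0 => u hu.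
    by nra.
  by apply: le_trans (ler_norm _); move: (`|x m|) hm => u hu; nra.
move=> l l' i im.
have -> : (1 - l) * x i + l * t i - ((1 - l') * x i + l' * t i) = (l - l') * (t i - x i) by ring.
rewrite normrM ler_piMr // (le_trans (ler_normB _ _)) //.
have := hx i im; have := le_trans (tb i im) dh; lra.
Qed.

(** The inverse chart [g] is merely a homeomorphism onto its image, so the two arcs cannot be
    straightened in the plane. Instead the arguments of [g] are moved inside the chart until the
    difference becomes odd under the half turn, and [box_odd] applies. *)
Lemma inner_box (g : pt -> pt) (delta : R) : continuous g ->
  (forall p q, in_box p -> in_box q -> g p = g q -> p = q) -> 0 < delta ->
  exists2 eta : R, 0 < eta & forall (x y : nat -> R) m n, (0 < m)%N -> (0 < n)%N ->
    (forall i, (i <= m)%N -> `|x i| <= 1 / 2) ->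
    (forall i, (i < m)%N -> `|x i.+1 - x i| < eta) ->
    delta <= `|x 0%N| -> delta <= `|x m| -> x 0%N * x m < 0 ->
    (forall j, (j <= n)%N -> `|y j| <= 1 / 2) ->
    (forall j, (j < n)%N -> `|y j.+1 - y j| < eta) ->
    delta <= `|y 0%N| -> delta <= `|y n| -> y 0%N * y n < 0 ->
    box (fun i j => toC (g (x i, 0) - g (0, y j))) 0 m 0 n = -1.
Proof.
move=> cg ig d0; have [eta eta0 h] := disk_nearby cg ig d0; exists eta => //.
move=> x y m n m0 n0 xb xs x0 xm xx yb ys y0 yn yy.
have [X [X0 X1 Xb Xs [Xd Xl]]] := linearize m0 d0 xb xs x0 xm xx.
have [Y [Y0 Y1 Yb Ys [Yd Yl]]] := linearize n0 d0 yb ys y0 yn yy.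
pose L := (Num.truncn (2 / eta)).+1.
have L0 : 0 < L%:R :> R by rewrite ltr0n.
have hL : 2 / L%:R < eta.
  rewrite ltr_pdivrMr // mulrC -ltr_pdivrMr //.
  exact: truncnS_gt.
pose lam l : R := l%:R / L%:R.
have lamI l : (l <= L)%N -> 0 <= lam l <= 1.
  by move=> hl; rewrite divr_ge0 //= ler_pdivrMr // mul1r ler_nat.
have lamS l : lam l.+1 - lam l = 1 / L%:R by rewrite /lam; field; rewrite gt_eqF.
(* For all parameters [P - Q = (X, - Y)], so on the boundary the two points stay [delta] apart in
   some coordinate. At the end [Q = - P], and since [X] and [Y] are odd by then, reversing both
   indices exchanges [P] and [Q]. *)
pose P l i j : pt := ((1 - lam l / 2) * X (lam l) i, - (lam l / 2) * Y (lam l) j).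
pose Q l i j : pt := (- (lam l / 2) * X (lam l) i, (1 - lam l / 2) * Y (lam l) j).
pose H l i j := toC (g (P l i j) - g (Q l i j)).
have cb (c z : R) : -1 <= c <= 1 -> `|z| <= 1 / 2 -> `|c * z| <= 1 / 2.
  move=> hc hz; rewrite normrM; apply: le_trans hz; rewrite ler_piMl //.
  by rewrite ler_norml.
have Pb l i j : (l <= L)%N -> (i <= m)%N -> (j <= n)%N -> in_box (P l i j) /\ in_box (Q l i j).
  move=> hl hi hj; have hl' := lamI l hl; have hu := Xb _ _ hl' hi; have hv := Yb _ _ hl' hj.
  by split; apply/andP; split; apply: cb => //; lra.
have Pd l i j : (l <= L)%N -> [|| i == 0, i == m, j == 0 | j == n]%N ->
    (delta <= `|(P l i j).1 - (Q l i j).1|) || (delta <= `|(P l i j).2 - (Q l i j).2|).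
  move=> hl; have hl' := lamI l hl; rewrite /=.
  have -> : (1 - lam l / 2) * X (lam l) i - - (lam l / 2) * X (lam l) i = X (lam l) i by ring.
  have -> : - (lam l / 2) * Y (lam l) j - (1 - lam l / 2) * Y (lam l) j = - Y (lam l) j by ring.
  rewrite normrN; have [a1 a2] := Xd _ hl'; have [b1 b2] := Yd _ hl'.
  by case/or4P=> /eqP ->; rewrite ?a1 ?a2 ?b1 ?b2 ?orbT.
have cs (c z z' : R) : -1 <= c <= 1 -> `|z' - z| < eta -> `|c * z - c * z'| < eta.
  move=> hc hz; rewrite -mulrBr normrM distrC; apply: le_lt_trans hz; rewrite ler_piMl //.
  by rewrite ler_norml.
have cl (c c' z z' k : R) : -1 <= c <= 1 -> `|z'| <= 1 / 2 -> `|z - z'| <= k -> `|c - c'| <= k ->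
    `|c * z - c' * z'| <= 2 * k.
  move=> hc hz hk hk'; have -> : c * z - c' * z' = c * (z - z') + (c - c') * z' by ring.
  rewrite (le_trans (ler_normD _ _)) // !normrM.
  have h1 : `|c| <= 1 by rewrite ler_norml.
  have := ler_pM (normr_ge0 _) (normr_ge0 _) h1 hk.
  have := ler_pM (normr_ge0 _) (normr_ge0 _) hk' hz.
  have := le_trans (normr_ge0 _) hk; lra.
have stepi l i j : (l <= L)%N -> (i < m)%N -> (j == 0)%N || (j == n) -> nearby (H l i j) (H l i.+1 j).
  move=> hl hi hj; have hl' := lamI l hl.
  have hj' : (j <= n)%N by case/orP: hj => /eqP ->.
  have [p1 p2] := Pb l i j hl (ltnW hi) hj'; have [p3 p4] := Pb l i.+1 j hl hi hj'.
  have s1 := Xs _ i hl' hi.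
  apply: h => //; try (by apply: Pd => //; case/orP: hj => ->; rewrite ?orbT);
    rewrite /= ?subrr ?normr0 //; apply: cs => //; lra.
have stepj l i j : (l <= L)%N -> (i == 0)%N || (i == m) -> (j < n)%N -> nearby (H l i j) (H l i j.+1).
  move=> hl hi hj; have hl' := lamI l hl.
  have hi' : (i <= m)%N by case/orP: hi => /eqP ->.
  have [p1 p2] := Pb l i j hl hi' (ltnW hj); have [p3 p4] := Pb l i j.+1 hl hi' hj.
  have s1 := Ys _ j hl' hj.
  apply: h => //; try (by apply: Pd => //; case/orP: hi => ->; rewrite ?orbT);
    rewrite /= ?subrr ?normr0 //; apply: cs => //; lra.
have stepl l i j : (l < L)%N -> (i <= m)%N -> (j <= n)%N ->
     [|| i == 0, i == m, j == 0 | j == n]%N -> nearby (H l i j) (H l.+1 i j).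
  move=> hl hi hj hb; have hl1 := lamI l (ltnW hl); have hl2 := lamI l.+1 hl.
  have [p1 p2] := Pb l i j (ltnW hl) hi hj; have [p3 p4] := Pb l.+1 i j hl hi hj.
  have dl : `|lam l - lam l.+1| <= 1 / L%:R.
    by rewrite distrC lamS ger0_norm // divr_ge0 // ltW.
  have x1 := le_trans (Xl (lam l) (lam l.+1) i hi) dl.
  have y1 := le_trans (Yl (lam l) (lam l.+1) j hj) dl.
  have x2 := Xb _ _ hl2 hi; have y2 := Yb _ _ hl2 hj.
  have hL' : 2 * (1 / L%:R) < eta by rewrite mulrA mulr1.
  have dl2 : `|lam l / 2 - lam l.+1 / 2| <= 1 / L%:R.
    by rewrite -mulrBl normrM; move: dl; move: (`|lam l - _|) (normr_ge0 (lam l - lam l.+1)) => u u0 hu; rewrite ger0_norm; lra.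
  have dl3 : `|(1 - lam l / 2) - (1 - lam l.+1 / 2)| <= 1 / L%:R.
    by rewrite (_ : _ - _ = lam l.+1 / 2 - lam l / 2) 1?distrC //; ring.
  have dl4 : `|- (lam l / 2) - - (lam l.+1 / 2)| <= 1 / L%:R.
    by rewrite -opprD normrN.
  have c1 : -1 <= 1 - lam l / 2 <= 1 by clear -hl1; lra.
  have c2 : -1 <= - (lam l / 2) <= 1 by clear -hl1; lra.
  apply: h => //; [exact: Pd (ltnW hl) hb|exact: Pd hl hb| | | | ];
    apply: le_lt_trans hL'; exact: cl.
have e0 : (fun i j => toC (g (x i, 0) - g (0, y j))) = H 0%N.
  apply/funext => i; apply/funext => j; rewrite /H /P /Q.
  have -> : lam 0%N = 0 by rewrite /lam mul0r.
  by rewrite mul0r subr0 !mul1r oppr0 !mul0r X0 Y0.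
rewrite e0 (box_homotopy m0 n0 stepl stepi stepj).
have lL : lam L = 1 by rewrite /lam mulfV // gt_eqF.
apply: box_odd => //; last 2 first.
- by move=> i j hi hj; apply: stepi.
- by move=> i j hi hj; apply: stepj.
move=> i j hi hj; rewrite /H /P /Q lL X1 // Y1 //.
have -> : (1 - 1 / 2 : R) = 1 / 2 by lra.
by rewrite !mulNr !mulrN !opprK !toCB opprB.
Qed.
End InnerBox.

Section GridSigns.
Variable R : realType.
Local Notation pt := (R * R)%type.
Local Open Scope classical_set_scope.

Definition gpt (N i : nat) : R := i%:R / N%:R.
(** A value for every grid size; it is the winding sign of the pair only on fine grids, whence the
    threshold in the statements about it. *)
Definition gbox N (e f : R -> pt) : R[i] :=
  box (fun i j => toC (e (gpt N i) - f (gpt N j))) 0 N 0 N.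

Lemma gpt_in N i : (0 < N)%N -> (i <= N)%N -> 0 <= gpt N i <= 1.
Proof.
move=> N0 iN; rewrite divr_ge0 //= ler_pdivrMr ?ltr0n // mul1r ler_nat.
exact: iN.
Qed.

Lemma gptS N i : (0 < N)%N -> `|gpt N i - gpt N i.+1| = 1 / N%:R.
Proof.
move=> N0; have NR : 0 < N%:R :> R by rewrite ltr0n.
rewrite distrC (_ : _ - _ = 1 / N%:R) ?ger0_norm ?divr_ge0 ?ltW //.
by rewrite /gpt; field; rewrite gt_eqF.
Qed.

Lemma gpt_le N i j : (0 < N)%N -> (i <= j)%N -> gpt N i <= gpt N j.
Proof. by move=> N0 ij; rewrite ler_pM2r ?invr_gt0 ?ltr0n // ler_nat. Qed.

Lemma large_grid (eta : R) : 0 < eta ->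
  exists N0, forall N, (N0 <= N)%N -> (0 < N)%N /\ 1 / N%:R < eta.
Proof.
move=> h; exists (Num.truncn (1 / eta)).+1 => N hN.
have N0 : (0 < N)%N by apply: leq_trans hN.
split=> //; rewrite ltr_pdivrMr ?ltr0n // mulrC -ltr_pdivrMr //.
by apply: lt_le_trans (truncnS_gt _) _; rewrite ler_nat.
Qed.

Lemma gbox_fine (e f : R -> pt) a b c d : continuous e -> continuous f ->
  (forall s t, a <= s <= b -> c <= t <= d -> e s != f t) ->
  exists N0, forall N, (N0 <= N)%N -> (0 < N)%N /\ forall i0 i1 j0 j1,
    a <= gpt N i0 -> gpt N i1 <= b -> c <= gpt N j0 -> gpt N j1 <= d ->
    (i0 < i1)%N -> (j0 <= j1)%N ->
    box (fun i j => toC (e (gpt N i) - f (gpt N j))) i0 i1 j0 j1 = 1.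
Proof.
move=> ce cf ne; have [eta eta0 h] := rect_nearby ce cf ne.
have [N0 hN] := large_grid eta0; exists N0 => N /hN [N1 lt]; split=> //.
move=> i0 i1 j0 j1 ha hb hc hd hi hj; apply: box_fine => //.
have ii i : (i0 <= i <= i1)%N -> a <= gpt N i <= b.
  by move=> /andP[h1 h2]; rewrite (le_trans ha) ?gpt_le //= (le_trans _ hb) ?gpt_le.
have jj j : (j0 <= j <= j1)%N -> c <= gpt N j <= d.
  by move=> /andP[h1 h2]; rewrite (le_trans hc) ?gpt_le //= (le_trans _ hd) ?gpt_le.
by split=> i j h1 h2; apply: h; rewrite ?subrr ?normr0 ?gptS //; do ?[apply: ii|apply: jj]; lia.
Qed.

Lemma gbox_disjoint (e f : R -> pt) : continuous e -> continuous f ->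
  (forall s t, 0 <= s <= 1 -> 0 <= t <= 1 -> e s != f t) ->
  exists N0, forall N, (N0 <= N)%N -> gbox N e f = 1.
Proof.
move=> ce cf ne; have [N0 h] := gbox_fine ce cf ne; exists N0 => N /h [N1].
have NR : N%:R != 0 :> R by rewrite pnatr_eq0 -lt0n.
by apply=> //; rewrite /gpt ?mul0r // divff.
Qed.

(** By the intermediate value theorem a small positive value would be taken on both sides of the
    zero. *)
Lemma inj_sign (x : R -> R) a b c : continuous x -> a < b -> b < c ->
  (forall s t, a <= s <= c -> a <= t <= c -> x s = x t -> s = t) -> x b = 0 ->
  0 < x a -> 0 < x c -> False.
Proof.
move=> cx ab bc inj xb xa xc; pose v := Order.min (x a) (x c).
have v0 : 0 < v by rewrite lt_min xa.
have va : v <= x a by rewrite /v ge_min lexx.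
have vc : v <= x c by rewrite /v ge_min lexx orbT.
have cw A : {within A, continuous x} by apply: continuous_subspaceT.
have [] := @IVT _ x a b v (ltW ab) (cw _).
  by rewrite ge_min le_max xb (ltW v0) va orbT.
move=> s; rewrite in_itv /= => hs xs.
have [] := @IVT _ x b c v (ltW bc) (cw _).
  by rewrite ge_min le_max xb (ltW v0) vc orbT.
move=> t; rewrite in_itv /= => ht xt.
have st : s = t by apply: inj; rewrite ?xs ?xt //; lra.
have sb : s = b by lra.
by move: v0; rewrite -xs sb xb ltxx.
Qed.

Lemma inj_opposite (x : R -> R) a b c : continuous x -> a < b -> b < c ->
  (forall s t, a <= s <= c -> a <= t <= c -> x s = x t -> s = t) -> x b = 0 ->
  x a * x c < 0.
Proof.
move=> cx ab bc inj xb.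
have xa : x a != 0.
  apply/eqP => h; suff : a = b by lra.
  by apply: inj; rewrite ?h ?xb //; lra.
have xc : x c != 0.
  apply/eqP => h; suff : c = b by lra.
  by apply: inj; rewrite ?h ?xb //; lra.
rewrite ltNge; apply/negP => h.
have {}h : 0 < x a * x c by rewrite lt_neqAle h eq_sym mulf_neq0.
have [pa|na] := ltP 0 (x a).
  by apply: (inj_sign cx ab bc inj xb pa); move: h; rewrite pmulr_rgt0.
have {}na : x a < 0 by rewrite lt_neqAle xa.
apply: (@inj_sign (fun s => - x s) a b c) => //.
- by move=> s; apply: cvgN; apply: cx.
- by move=> s t hs ht /oppr_inj; apply: inj.
- by rewrite xb oppr0.
- by rewrite oppr_gt0.
- by rewrite oppr_gt0; move: h; rewrite nmulr_rgt0.
Qed.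

(* The chart [h] sends the curve into the axis with coordinate [c], on which the
   transversal coordinate [o] vanishes. *)
Lemma axis_coord (e : R -> pt) s0 (U : set pt) (h : pt -> pt) (c o : pt -> R) :
  continuous e -> (forall s t, I01 s -> I01 t -> e s = e t -> s = t) ->
  0 < s0 < 1 -> open U -> U (e s0) -> {within U, continuous h} ->
  (forall p q, U p -> U q -> h p = h q -> p = q) ->
  continuous c -> (forall p q, c p = c q -> o p = o q -> p = q) ->
  c (h (e s0)) = 0 -> (forall s, I01 s -> U (e s) -> o (h (e s)) = 0) ->
  exists (eps : R) (x : R -> R),
    [/\ 0 < eps /\ 0 < s0 - eps /\ s0 + eps < 1, continuous x,
        forall s, s0 - eps <= s <= s0 + eps ->
          [/\ U (e s), x s = c (h (e s)) & `|x s| <= 1 / 2],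
        forall a b, s0 - eps <= a -> a < s0 -> s0 < b -> b <= s0 + eps -> x a * x b < 0 &
        exists2 delta, 0 < delta & forall s, s0 - eps <= s <= s0 + eps ->
          eps / 2 <= `|s - s0| -> delta <= `|x s|].
Proof.
move=> ce ie s01 oU Us ch ih cc co ch0 ho.
have /nbhs_ballP [r /= r0 hr] : nbhs s0 [set s | U (e s) /\ `|c (h (e s))| < 1 / 2].
  apply: filterI; first by apply: ce; apply: open_nbhs_nbhs.
  have k : (c (h (e s)) @[s --> s0]) --> c (h (e s0)).
    have k1 : (h p @[p --> e s0]) --> h (e s0).
      move/subspace_continuousP: ch => /(_ _ Us).
      move=> k B /k; rewrite nbhs_simpl /within /= => hB.
      have nU : nbhs (e s0) U by apply: open_nbhs_nbhs.
      have hB' : nbhs (e s0) [set p | U p -> B (h p)] := hB.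
      suff : nbhs (e s0) [set p | B (h p)] by [].
      have : nbhs (e s0) ([set p | U p -> B (h p)] `&` U) by apply: filterI.
      by apply: filterS => p [hp up]; exact: hp.
    exact: (cvg_comp _ _ (cvg_comp _ _ (ce s0) k1) (cc _)).
  have l : `|c (h (e s0))| < 1 / 2 by rewrite ch0 normr0.
  have k' : (`|c (h (e s))| @[s --> s0]) --> `|c (h (e s0))| by apply: cvg_norm.
  exact: (k' _ (lt_nbhsl l)).
pose eps := Order.min (r / 2) (Order.min (s0 / 2) ((1 - s0) / 2)).
have e0 : 0 < eps by rewrite !lt_min; apply/and3P; split; lra.
have [e1 [e2 e3]] : eps <= r / 2 /\ eps <= s0 / 2 /\ eps <= (1 - s0) / 2.
  by rewrite /eps !ge_min !lexx ?orbT.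
exists eps, (c \o (h \o (e \o clamp (s0 - eps) (s0 + eps)))).
have ci : s0 - eps <= s0 + eps by lra.
have hU s : s0 - eps <= s <= s0 + eps -> U (e s) /\ `|c (h (e s))| < 1 / 2.
  move=> hs; apply: hr; rewrite /ball /= ltr_norml; lra.
have cx : continuous (c \o (h \o (e \o clamp (s0 - eps) (s0 + eps)))).
  have k2 : continuous (e \o clamp (s0 - eps) (s0 + eps)).
    by move=> s; apply: continuous_comp; [apply: clamp_continuous|apply: ce].
  have k3 : continuous (h \o (e \o clamp (s0 - eps) (s0 + eps))).
    by apply: within_continuous_comp k2 _ ch => s; have [] := hU _ (clamp_in s ci).
  by move=> s; apply: continuous_comp; [apply: k3|apply: cc].
set x := c \o _ in cx *.
have xE s : s0 - eps <= s <= s0 + eps -> x s = c (h (e s)) by move=> hs; rewrite /x /= clamp_id.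
have I s : s0 - eps <= s <= s0 + eps -> I01 s by move=> hs; rewrite /I01 /=; lra.
have ix s t : s0 - eps <= s <= s0 + eps -> s0 - eps <= t <= s0 + eps -> x s = x t -> s = t.
  move=> hs ht; rewrite !xE // => hc; apply: ie; [exact: I|exact: I|].
  have [u1 _] := hU _ hs; have [u2 _] := hU _ ht.
  by apply: ih => //; apply: co => //; rewrite !ho //; apply: I.
have x0 : x s0 = 0 by rewrite xE //; lra.
split=> //.
- by split=> //; split; lra.
- by move=> s hs; have [u1 u2] := hU _ hs; split; rewrite ?xE // ltW.
- move=> a b h1 h2 h3 h4; apply: (@inj_opposite x a s0 b) => // s t hs ht.
  by apply: ix; lra.
have mn a b : a <= b -> s0 - eps <= a -> b <= s0 + eps -> b < s0 \/ s0 < a ->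
    exists2 d, 0 < d & forall s, a <= s <= b -> d <= `|x s|.
  move=> ab ha hb hab.
  have [|t] := @EVT_min R (fun s => `|x s|) a b ab.
    apply: continuous_subspaceT => s; exact: (cvg_norm (cx s)).
  rewrite in_itv /= => ht hmin; exists `|x t|.
    rewrite normr_gt0; apply/eqP => xt; suff : t = s0 by lra.
    by apply: ix; rewrite ?xt ?x0 //; lra.
  by move=> s hs; apply: hmin; rewrite in_itv.
have [||||d1 d10 h1] := mn (s0 - eps) (s0 - eps / 2); try lra.
have [||||d2 d20 h2] := mn (s0 + eps / 2) (s0 + eps); try lra.
exists (Order.min d1 d2); first by rewrite lt_min d10.
move=> s hs hd; rewrite ge_min; have [ss|ss] := leP s s0.
  by rewrite h1 //; move: hd; rewrite ler0_norm; lra.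
by rewrite h2 ?orbT //; move: hd; rewrite gtr0_norm; lra.
Qed.
End GridSigns.

Section CrossingSign.
Variable R : realType.
Local Notation pt := (R * R)%type.
Local Open Scope classical_set_scope.

(** Locates two opposite sides of the inner box: within the chart, but at least [eps / 2] away from
    the crossing, where the chart coordinate is bounded away from 0. *)
Lemma clamp_grid_bounds (N : nat) (s0 eps : R) : (0 < N)%N -> 0 < eps -> 0 < s0 - eps ->
  s0 + eps < 1 -> 1 / N%:R < eps / 2 ->
  exists i0 i1 : nat, [/\ (0 < i0)%N /\ (i0 < i1)%N /\ (i1 < N)%N,
    s0 - eps <= gpt R N i0 /\ gpt R N i0 <= s0 - eps / 2 &
    s0 + eps / 2 <= gpt R N i1 /\ gpt R N i1 <= s0 + eps].
Proof.
move=> N0 e0 h0 h1 hN; have NR : 0 < N%:R :> R by rewrite ltr0n.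
have iN : 1 / N%:R * N%:R = 1 :> R by rewrite divfK // gt_eqF.
pose u := N%:R * (s0 - eps / 2); pose v := N%:R * (s0 + eps / 2).
have u0 : 0 <= u by apply: mulr_ge0; lra.
have v0 : 0 <= v by apply: mulr_ge0; lra.
have [u1 u2] := andP (truncn_itv u0); have [v1 v2] := andP (truncn_itv v0).
have g1 i : gpt R N i * N%:R = i%:R by rewrite /gpt divfK // gt_eqF.
have eN : N%:R * (eps / 2) > 1 by rewrite -[X in X < _]iN mulrC ltr_pM2l.
have ge a i : (a <= gpt R N i) = (a * N%:R <= i%:R) by rewrite /gpt ler_pdivlMr.
have le a i : (gpt R N i <= a) = (i%:R <= a * N%:R) by rewrite /gpt ler_pdivrMr.
have h3 : 0 < (s0 - eps) * N%:R by apply: mulr_gt0.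
have h4 : (s0 + eps) * N%:R < N%:R by rewrite gtr_pMl.
set i0 := Num.truncn u in u1 u2; set i1 := Num.truncn v in v1 v2.
have nS k : k.+1%:R = k%:R + 1 :> R by rewrite -addn1 natrD.
rewrite (nS i0) in u2; rewrite (nS i1) in v2.
exists i0, i1.+1; rewrite !ge !le !(nS i1); split; first last.
- by rewrite /v in v1 v2; split; nra.
- by rewrite /u in u1 u2; split; nra.
split; first by rewrite -(ltr_nat R); rewrite /u in u2; nra.
split; last by rewrite -(ltr_nat R) (nS i1); rewrite /v in v1; nra.
by rewrite -(ltr_nat R) (nS i1); rewrite /u in u1; rewrite /v in v2; nra.
Qed.

Lemma udisk_in_box (p : pt) : in_box p -> udisk p.
Proof.
case: p => a b /andP[/=]; rewrite !ler_norml /udisk /= => h1 h2.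
have : a ^+ 2 <= 1 / 4 by rewrite expr2; nra.
have : b ^+ 2 <= 1 / 4 by rewrite expr2; nra.
lra.
Qed.

(** Off the crossing the arcs are disjoint, so the four strips around a small box are trivial by
    [gbox_fine]. [box_concentrate] leaves the box inside the chart, and [inner_box] evaluates it. *)
Lemma gbox_cross (e f : R -> pt) (s0 t0 : R) : continuous e -> continuous f ->
  (forall s t, I01 s -> I01 t -> e s = e t -> s = t) ->
  (forall s t, I01 s -> I01 t -> f s = f t -> s = t) ->
  0 < s0 < 1 -> 0 < t0 < 1 -> e s0 = f t0 ->
  (forall s t, I01 s -> I01 t -> e s = f t -> s = s0 /\ t = t0) ->
  crosses_properly (e @` (@I01 R)) (f @` (@I01 R)) (e s0) ->
  exists N0, forall N, (N0 <= N)%N -> gbox N e f = -1.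
Proof.
move=> ce cf ie jf s01 t01 est uniq [U [h [g [oU [Up [ch [cg [hg [gh [hp [he hf]]]]]]]]]]].
have Up' : U (f t0) by rewrite -est.
have ih p q : U p -> U q -> h p = h q -> p = q.
  by move=> /hg [_ e1] /hg [_ e2] e3; rewrite -e1 -e2 e3.
have ho1 s : I01 s -> U (e s) -> (h (e s)).2 = 0.
  move=> Is Us; have : (h @` (U `&` (e @` (@I01 R)))) (h (e s)).
    by exists (e s) => //; split=> //; exists s.
  by rewrite he => -[].
have ho2 s : I01 s -> U (f s) -> (h (f s)).1 = 0.
  move=> Is Us; have : (h @` (U `&` (f @` (@I01 R)))) (h (f s)).
    by exists (f s) => //; split=> //; exists s.
  by rewrite hf => -[].
have [ex [x [[ex0 [ex1 ex2]] cx xE xs [dx dx0 hdx]]]] :=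
  @axis_coord R e s0 U h fst snd ce ie s01 oU Up ch ih (fun p => @cvg_fst _ _ _ _ _)
   ltac:(by case=> ? ? [? ?] /= -> ->) ltac:(by rewrite hp) ho1.
have [ey [y [[ey0 [ey1 ey2]] cy yE ys [dy dy0 hdy]]]] :=
  @axis_coord R f t0 U h snd fst cf jf t01 oU Up' ch ih (fun p => @cvg_snd _ _ _ _ _)
   ltac:(by case=> ? ? [? ?] /= -> ->) ltac:(by rewrite -est hp) ho2.
(* Clamping to a square inside the disk makes the inverse chart continuous on the whole plane
   without changing it where it is used. *)
pose k (p : pt) : pt := (clamp (- (1 / 2)) (1 / 2) p.1, clamp (- (1 / 2)) (1 / 2) p.2).
have ck : continuous k.
  move=> p; pose c := @clamp_continuous R (- (1 / 2)) (1 / 2).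
  have k1 : (clamp (- (1 / 2)) (1 / 2) w.1 @[w --> p]) --> clamp (- (1 / 2)) (1 / 2) p.1.
    exact: (continuous_comp (@cvg_fst _ _ _ _ _) (c _)).
  have k2 : (clamp (- (1 / 2)) (1 / 2) w.2 @[w --> p]) --> clamp (- (1 / 2)) (1 / 2) p.2.
    exact: (continuous_comp (@cvg_snd _ _ _ _ _) (c _)).
  exact: (cvg_pair k1 k2).
have hh : - (1 / 2) <= 1 / 2 :> R by lra.
have kb p : in_box (k p) by apply/andP; split; rewrite ler_norml; apply: clamp_in.
have kid p : in_box p -> k p = p.
  by case: p => a b /andP[/= h1 h2]; rewrite /k !clamp_id // -ler_norml.
pose g' := g \o k.
have cg' : continuous g'.
  by apply: within_continuous_comp ck _ cg => p; apply: udisk_in_box.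
have ig' p q : in_box p -> in_box q -> g' p = g' q -> p = q.
  move=> bp bq; rewrite /g' /= !kid // => e1.
  by have [_ <-] := gh _ (udisk_in_box bp); have [_ <-] := gh _ (udisk_in_box bq); rewrite e1.
pose d := Order.min dx dy.
have d0 : 0 < d by rewrite lt_min dx0.
have [eta eta0 hin] := inner_box cg' ig' d0.
have [nx nx0 ux] := uniform_on_segment (s0 - ex) (s0 + ex) cx eta0.
have [ny ny0 uy] := uniform_on_segment (t0 - ey) (t0 + ey) cy eta0.
have neq s t : (s != s0) || (t != t0) -> 0 <= s <= 1 -> 0 <= t <= 1 -> e s != f t.
  by move=> h1 h2 h3; apply/eqP => /uniq [] // e1 e2; move: h1; rewrite e1 e2 !eqxx.
have [|N1 H1] := @gbox_fine R e f 0 (s0 - ex / 2) 0 1 ce cf.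
  by move=> s t hs ht; apply: neq => //; clear - hs ex0 s01 ex1 ex2; [apply/orP; left; apply/eqP; lra|lra].
have [|N2 H2] := @gbox_fine R e f (s0 + ex / 2) 1 0 1 ce cf.
  by move=> s t hs ht; apply: neq => //; clear - hs ex0 s01 ex1 ex2; [apply/orP; left; apply/eqP; lra|lra].
have [|N3 H3] := @gbox_fine R e f 0 1 0 (t0 - ey / 2) ce cf.
  by move=> s t hs ht; apply: neq => //; clear - ht ey0 t01 ey1 ey2; [apply/orP; right; apply/eqP; lra|lra].
have [|N4 H4] := @gbox_fine R e f 0 1 (t0 + ey / 2) 1 ce cf.
  by move=> s t hs ht; apply: neq => //; clear - ht ey0 t01 ey1 ey2; [apply/orP; right; apply/eqP; lra|lra].
have [N5 H5] := large_grid nx0; have [N6 H6] := large_grid ny0.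
have ex3 : 0 < ex / 2 by rewrite divr_gt0.
have ey3 : 0 < ey / 2 by rewrite divr_gt0.
have [N7 H7] := large_grid ex3; have [N8 H8] := large_grid ey3.
exists (\max_(j <- [:: N1; N2; N3; N4; N5; N6; N7; N8]) j)%N => N hN.
have le j : j \in [:: N1; N2; N3; N4; N5; N6; N7; N8] -> (j <= N)%N.
  by move=> hj; apply: leq_trans hN; apply: leq_bigmax_seq.
have [N0 {}H1] := H1 N (le N1 ltac:(by rewrite !inE eqxx ?orbT)).
have [_ {}H2] := H2 N (le N2 ltac:(by rewrite !inE eqxx ?orbT)).
have [_ {}H3] := H3 N (le N3 ltac:(by rewrite !inE eqxx ?orbT)).
have [_ {}H4] := H4 N (le N4 ltac:(by rewrite !inE eqxx ?orbT)).
have [_ {}H5] := H5 N (le N5 ltac:(by rewrite !inE eqxx ?orbT)).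
have [_ {}H6] := H6 N (le N6 ltac:(by rewrite !inE eqxx ?orbT)).
have [_ {}H7] := H7 N (le N7 ltac:(by rewrite !inE eqxx ?orbT)).
have [_ {}H8] := H8 N (le N8 ltac:(by rewrite !inE eqxx ?orbT)).
have [i0 [i1 [[i00 [i01 i1N]] [ia ib] [ic id]]]] := clamp_grid_bounds N0 ex0 ex1 ex2 H7.
have [j0 [j1 [[j00 [j01 j1N]] [ja jb] [jc jd]]]] := clamp_grid_bounds N0 ey0 ey1 ey2 H8.
have g0 : gpt R N 0%N = 0 by rewrite /gpt mul0r.
have gN : gpt R N N = 1 by rewrite /gpt divff // pnatr_eq0 -lt0n.
have gm i j : (i <= j)%N -> gpt R N i <= gpt R N j by apply: gpt_le.
rewrite /gbox; set H := fun i j => _ in H1 H2 H3 H4 *.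
have Hnz i j : (i <= N)%N -> (j <= N)%N -> (gpt R N i != s0) || (gpt R N j != t0) -> H i j != 0.
  move=> hi hj hn; rewrite /H -[0](_ : toC (0, 0) = 0) // (inj_eq (@toC_inj R)) subr_eq0.
  by apply: neq => //; apply: gpt_in.
have nei0 : gpt R N i0 != s0 by clear - ib ex0; apply/eqP; lra.
have nei1 : gpt R N i1 != s0 by clear - ic ex0; apply/eqP; lra.
have nej0 : gpt R N j0 != t0 by clear - jb ey0; apply/eqP; lra.
have nej1 : gpt R N j1 != t0 by clear - jc ey0; apply/eqP; lra.
have i0N : (i0 <= N)%N by clear - i01 i1N; lia.
have j0N : (j0 <= N)%N by clear - j01 j1N; lia.
have gm0 i : 0 <= gpt R N i by rewrite -g0; apply: gm.
have gm1 i : (i <= N)%N -> gpt R N i <= 1 by move=> hi; rewrite -gN; apply: gm.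
have -> : box H 0 N 0 N = box H i0 i1 j0 j1.
  apply: box_concentrate.
  - by rewrite (ltnW i01) (ltnW i1N).
  - by rewrite (ltnW j01) (ltnW j1N).
  - by move=> j hj; split; apply: Hnz; rewrite ?nei0 ?nei1 ?(ltnW i1N).
  - by move=> i hi; split; apply: Hnz; rewrite ?nej0 ?nej1 ?orbT ?(ltnW j1N).
  - by apply: H1; rewrite ?g0 ?gN ?lexx.
  - by apply: H2; rewrite ?g0 ?gN ?lexx.
  - by apply: H3; rewrite ?g0 ?lexx // gm1 // ltnW.
  - by apply: H4; rewrite ?gN ?lexx // ?gm1 // ltnW.
have hi1 : i1 = ((i1 - i0) + i0)%N by rewrite subnK // ltnW.
have hj1 : j1 = ((j1 - j0) + j0)%N by rewrite subnK // ltnW.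
rewrite hi1 hj1 -box_shift.
pose X i := x (gpt R N (i + i0)); pose Y j := y (gpt R N (j + j0)).
have rx i : (i <= i1 - i0)%N -> s0 - ex <= gpt R N (i + i0) <= s0 + ex.
  move=> hi; rewrite (le_trans ia) /=; last by apply: gm; rewrite leq_addl.
  by apply: le_trans id; apply: gm; rewrite hi1 leq_add2r.
have ry j : (j <= j1 - j0)%N -> t0 - ey <= gpt R N (j + j0) <= t0 + ey.
  move=> hj; rewrite (le_trans ja) /=; last by apply: gm; rewrite leq_addl.
  by apply: le_trans jd; apply: gm; rewrite hj1 leq_add2r.
have Ix i : (i <= i1 - i0)%N -> I01 (gpt R N (i + i0)).
  by move=> hi; apply: gpt_in => //; rewrite (leq_trans _ (ltnW i1N)) // hi1 leq_add2r.
have Iy j : (j <= j1 - j0)%N -> I01 (gpt R N (j + j0)).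
  by move=> hj; apply: gpt_in => //; rewrite (leq_trans _ (ltnW j1N)) // hj1 leq_add2r.
have bx (u v : R) : `|u| <= 1 / 2 -> in_box (u, 0) /\ in_box (0, u).
  by move=> hu; rewrite /in_box /= hu normr0 divr_ge0.
rewrite (@eq_box _ _ (fun i j => toC (g' (X i, 0) - g' (0, Y j)))) //; last first.
  move=> i j /andP[_ hi] /andP[_ hj]; rewrite /H /g' /=.
  have [u1 u2 u3] := xE _ (rx i hi); have [v1 v2 v3] := yE _ (ry j hj).
  have [b1 _] := bx _ 0 u3; have [_ b2] := bx _ 0 v3.
  rewrite !kid //; congr (toC (_ - _)).
    have [_ {1}<-] := hg _ u1; congr g; rewrite /X u2.
    by rewrite -[0](ho1 _ _ u1) -?surjective_pairing //; apply: Ix.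
  have [_ {1}<-] := hg _ v1; congr g; rewrite /Y v2.
  by rewrite -[0](ho2 _ _ v1) -?surjective_pairing //; apply: Iy.
have ddx : d <= dx by rewrite /d ge_min lexx.
have ddy : d <= dy by rewrite /d ge_min lexx orbT.
have iX : X (i1 - i0)%N = x (gpt R N i1) by rewrite /X -hi1.
have iY : Y (j1 - j0)%N = y (gpt R N j1) by rewrite /Y -hj1.
have far (z a r : R) : (a <= z - r / 2) || (z + r / 2 <= a) -> r / 2 <= `|a - z|.
  by clear; case/orP=> ?; [rewrite distrC|]; apply: le_trans (ler_norm _); lra.
have lex1 : gpt R N i0 < s0 by clear - ib ex0; lra.
have lex2 : s0 < gpt R N i1 by clear - ic ex0; lra.
have ley1 : gpt R N j0 < t0 by clear - jb ey0; lra.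
have ley2 : t0 < gpt R N j1 by clear - jc ey0; lra.
have hx0 : d <= `|X 0%N|.
  by apply: le_trans ddx _; apply: hdx; [exact: rx|apply: far; rewrite add0n ib].
have hx1 : d <= `|X (i1 - i0)%N|.
  apply: le_trans ddx _; apply: hdx; first exact: rx.
  by apply: far; rewrite -hi1 ic orbT.
have hy0 : d <= `|Y 0%N|.
  by apply: le_trans ddy _; apply: hdy; [exact: ry|apply: far; rewrite add0n jb].
have hy1 : d <= `|Y (j1 - j0)%N|.
  apply: le_trans ddy _; apply: hdy; first exact: ry.
  by apply: far; rewrite -hj1 jc orbT.
apply: hin => //; rewrite ?subn_gt0 //.
- by move=> i hi; have [] := xE _ (rx i hi).
- move=> i hi; apply: ux; [exact: rx|apply: rx; exact: ltnW|].
  by rewrite distrC gptS.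
- by rewrite iX /X add0n; apply: xs.
- by move=> i hi; have [] := yE _ (ry i hi).
- move=> i hi; apply: uy; [exact: ry|apply: ry; exact: ltnW|].
  by rewrite distrC gptS.
- by rewrite iY /Y add0n; apply: ys.
Qed.
End CrossingSign.

(** * Drawings of K_{3,3} *)

Section NonPlanarity.
Variable R : realType.
Local Notation pt := (R * R)%type.
Local Open Scope classical_set_scope.

(** Contribution of one side of a box, where the other arc is frozen at its end [w]: a root of
    [g - w] continued along [g]. *)
Definition chain (N : nat) (g : R -> pt) (w : pt) : R[i] :=
  lift (fun i => toC (g (gpt R N i) - w)) 0 N.

Lemma lift_opp (f : nat -> R[i]) m n : lift (fun i => - f i) m n = lift f m n.
Proof. by apply: eq_big_nat => i _; rewrite invrN mulrNN. Qed.

(** Each side of the box freezes one arc at an end. Passing from [e - f] to [f - e] is harmless,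
    because [lift] only sees quotients. *)
Lemma gboxE N (e f : R -> pt) : (0 < N)%N ->
  gbox N e f = chain N e (f 0) * chain N f (e 1) / (chain N e (f 1) * chain N f (e 0)).
Proof.
move=> N0; have g0 : gpt R N 0%N = 0 by rewrite /gpt mul0r.
have gN : gpt R N N = 1 by rewrite /gpt divff // pnatr_eq0 -lt0n.
rewrite /gbox /box /chain g0 gN; congr (_ * _ / (_ * _)).
  by rewrite -[RHS]lift_opp; apply: eq_lift => i _; rewrite !toCB opprB.
by rewrite -[RHS]lift_opp; apply: eq_lift => i _; rewrite !toCB opprB.
Qed.

Lemma chain_nz N (g : R -> pt) w : (0 < N)%N -> (forall s, 0 <= s <= 1 -> g s != w) ->
  forall i, (0 <= i <= N)%N -> toC (g (gpt R N i) - w) != 0.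
Proof.
move=> N0 h i /andP[_ hi]; rewrite -[0](_ : toC (0, 0) = 0) // (inj_eq (@toC_inj R)) subr_eq0.
exact/h/gpt_in.
Qed.

Lemma chain_neq0 N (g : R -> pt) w : (0 < N)%N -> (forall s, 0 <= s <= 1 -> g s != w) ->
  chain N g w != 0.
Proof. by move=> N0 h; apply: lift_neq0; apply: chain_nz. Qed.

Lemma chain_sqr N (g : R -> pt) w : (0 < N)%N -> (forall s, 0 <= s <= 1 -> g s != w) ->
  chain N g w ^+ 2 = (toC (g 1) - toC w) / (toC (g 0) - toC w).
Proof.
move=> N0 h; rewrite /chain lift_sqr //; last exact: chain_nz.
have g0 : gpt R N 0%N = 0 by rewrite /gpt mul0r.
have gN : gpt R N N = 1 by rewrite /gpt divff // pnatr_eq0 -lt0n.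
by rewrite g0 gN !toCB.
Qed.

Lemma common_N (T : finType) (P : T -> nat -> Prop) :
  (forall t, exists N0, forall N, (N0 <= N)%N -> P t N) ->
  exists2 N, (0 < N)%N & forall t, P t N.
Proof.
move=> /choice [F hF]; exists (\max_t F t).+1 => // t.
by apply: hF; apply: leqW; apply: leq_bigmax.
Qed.

Lemma other3 (i : 'I_3) : exists k : 'I_3, i != k.
Proof.
by case: (eqVneq i ord0) => [->|]; [exists ord_max|exists ord0].
Qed.

(** Disjoint pairs have sign 1, and by [gboxE] this is the multiplicative relation required in
    [K33_signs]. *)
Lemma no_K33_paths (a b : 'I_3 -> pt) (g : 'I_3 -> 'I_3 -> R -> pt) :
  (forall i j, continuous (g i j)) ->
  (forall i j, g i j 0 = a i) -> (forall i j, g i j 1 = b j) ->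
  (forall i j k l s t, i != k -> j != l -> 0 <= s <= 1 -> 0 <= t <= 1 ->
     g i j s != g k l t) -> False.
Proof.
move=> cg g0 g1 dis.
have I0 : 0 <= (0 : R) <= 1 by rewrite lexx ler01.
have I1 : 0 <= (1 : R) <= 1 by rewrite lexx ler01.
have [N N0 hN] : exists2 N, (0 < N)%N & forall t : ('I_3 * 'I_3) * ('I_3 * 'I_3),
    t.1.1 != t.2.1 -> t.1.2 != t.2.2 -> gbox N (g t.1.1 t.1.2) (g t.2.1 t.2.2) = 1.
  apply: common_N => -[[i j] [k l]] /=.
  case: (boolP ((i != k) && (j != l))) => [/andP[ik jl]|h]; last first.
    by exists 0%N => N _ ik jl; rewrite ik jl in h.
  have [|N1 h] := gbox_disjoint (cg i j) (cg k l); last by exists N1 => N /h.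
  by move=> s t; apply: dis.
(* The vertex [a k] starts some path [g k l] with [l] other than [j], which is independent from
   [g i j]; likewise for [b] below. *)
have da i j k s : i != k -> 0 <= s <= 1 -> g i j s != a k.
  by move=> ik hs; have [l jl] := other3 j; rewrite -(g0 k l); apply: dis.
have db i j l s : j != l -> 0 <= s <= 1 -> g i j s != b l.
  by move=> jl hs; have [k ik] := other3 i; rewrite -(g1 k l); apply: dis.
refine (@K33_signs R[i] (fun i => toC (a i)) (fun i => toC (b i)) (fun i j k => chain N (g i j) (a k))
  (fun i j l => chain N (g i j) (b l)) _ _ _ _ _ _).
- by rewrite pnatr_eq0.
- move=> i k /= /toC_inj e; apply/eqP/negPn/negP => ik.
  by have := da i ord0 k 0 ik I0; rewrite g0 e eqxx.
- move=> i l; rewrite /= (inj_eq (@toC_inj R)); have [j lj] := other3 l.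
  by rewrite -(g0 i j); apply: db => //; rewrite eq_sym.
- by move=> i j k ik; rewrite chain_sqr ?g0 ?g1 // => s; apply: da.
- by move=> i j l jl; apply: chain_neq0 => // s; apply: db.
move=> i j k l ik jl; have := hN ((i, j), (k, l)) ik jl; rewrite /= gboxE // !g0 !g1 => /divr1_eq.
by [].
Qed.

End NonPlanarity.

(** * Walks and their signs *)

Section Walks.
Variables (V Ed : finType) (ends : Ed -> V * V).

(** Darts are edges with an orientation; the boolean [true] stands for the reversed one. *)
Definition dsrc (d : Ed * bool) := if d.2 then (ends d.1).2 else (ends d.1).1.
Definition dtgt (d : Ed * bool) := if d.2 then (ends d.1).1 else (ends d.1).2.

Fixpoint is_walk (a : V) (p : seq (Ed * bool)) (b : V) : bool :=
  if p is d :: p' then (dsrc d == a) && is_walk (dtgt d) p' b else a == b.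

Definition incident (e : Ed) (v : V) := ((ends e).1 == v) || ((ends e).2 == v).

Lemma incident_src d : incident d.1 (dsrc d).
Proof. by case: d => e [] /=; rewrite /incident /dsrc eqxx ?orbT. Qed.

Lemma incident_tgt d : incident d.1 (dtgt d).
Proof. by case: d => e [] /=; rewrite /incident /dtgt eqxx ?orbT. Qed.

Lemma walk_src a p b : is_walk a p b -> a != b -> exists2 d, d \in p & incident d.1 a.
Proof.
case: p => [/= ->//|d p /= /andP[/eqP <- _] _]; exists d; first exact: mem_head.
exact: incident_src.
Qed.

Lemma walk_tgt a p b : is_walk a p b -> a != b -> exists2 d, d \in p & incident d.1 b.
Proof.
elim: p a => [a /= ->//|d p IH a /= /andP[/eqP <- h] _].
have [e|/(IH _ h) [d' h1 h2]] := eqVneq (dtgt d) b; last by exists d'; rewrite ?inE ?h1 ?orbT.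
by exists d; rewrite ?mem_head // -e incident_tgt.
Qed.
End Walks.

Section WalkSigns.
Variable R : realType.
Local Notation pt := (R * R)%type.
Local Open Scope classical_set_scope.
Variables (V Ed : finType) (pos : V -> pt) (ends : Ed -> V * V) (curve : Ed -> R -> pt).
Hypothesis G : simple_topgraph pos ends curve.

(** Distinctness is built in, since every edge shares its interior with itself. *)
Definition xcross (e f : Ed) : bool := (e != f) && `[< ecross curve e f >].

Lemma pos_inj : injective pos. Proof. by case: G. Qed.

Lemma crossC e f : xcross e f = xcross f e.
Proof.
rewrite /xcross eq_sym; congr (_ && _); apply/asboolP/asboolP => -[p [h1 h2]];
  by exists p.
Qed.

Definition ccurve e : R -> pt := curve e \o clamp 0 1.

Lemma ccurveE e s : 0 <= s <= 1 -> ccurve e s = curve e s.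
Proof. by move=> hs; rewrite /ccurve /= clamp_id. Qed.

Lemma ccurve0 e : ccurve e 0 = pos (ends e).1.
Proof.
rewrite ccurveE ?lexx ?ler01 //.
by case: G => _ [_ [_ [h _]]]; have [_ []] := h e.
Qed.

Lemma ccurve1 e : ccurve e 1 = pos (ends e).2.
Proof.
rewrite ccurveE ?lexx ?ler01 //.
by case: G => _ [_ [_ [h _]]]; have [_ []] := h e.
Qed.

Lemma ccurve_continuous e : continuous (ccurve e).
Proof.
case: G => _ [_ [_ [h _]]]; have [[c _] _] := h e.
apply: within_continuous_comp c; first exact: clamp_continuous.
by move=> s; apply: clamp_in; apply: ler01.
Qed.

Lemma ccurve_inj e s t : I01 s -> I01 t -> ccurve e s = ccurve e t -> s = t.
Proof.
move=> hs ht; rewrite !ccurveE //.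
by case: G => _ [_ [_ [h _]]]; have [[_ i] _] := h e; apply: i.
Qed.

Lemma incident_pts e v : incident ends e v -> edge_pts curve e (pos v).
Proof.
have I0 : I01 (0 : R) by rewrite /I01 /= lexx ler01.
have I1 : I01 (1 : R) by rewrite /I01 /= lexx ler01.
case/orP=> /eqP <-; first by exists 0 => //; rewrite -ccurve0 ccurveE.
by exists 1 => //; rewrite -ccurve1 ccurveE.
Qed.

Lemma pts_int e p : edge_pts curve e p ->
  edge_int curve e p \/ exists2 v, incident ends e v & p = pos v.
Proof.
move=> [s hs <-]; have hs' : 0 <= s <= 1 := hs.
have [->|s0] := eqVneq s 0.
  by right; exists (ends e).1; rewrite /incident ?eqxx // -ccurve0 ccurveE // lexx ler01.
have [->|s1] := eqVneq s 1.
  by right; exists (ends e).2; rewrite /incident ?eqxx ?orbT // -ccurve1 ccurveE // lexx ler01.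
by left; exists s => //; rewrite /I01o /= !lt_neqAle eq_sym s0 s1.
Qed.

Lemma int_pts e p : edge_int curve e p -> edge_pts curve e p.
Proof. by move=> [s /andP[h1 h2] <-]; exists s => //; rewrite /I01 /= !ltW. Qed.

Lemma pos_off_edge e v : ~~ incident ends e v -> ~ edge_pts curve e (pos v).
Proof.
move=> h /pts_int [hi|[w hw /pos_inj e1]]; last by rewrite e1 hw in h.
by case: G => _ [_ [_ [_ [k _]]]]; apply: k hi.
Qed.

Lemma ccurve_off e v : ~~ incident ends e v -> forall s, 0 <= s <= 1 -> ccurve e s != pos v.
Proof.
move=> h s hs; apply/eqP => e1; apply: (pos_off_edge h).
by exists s => //; rewrite -e1 ccurveE.
Qed.

(** Two edges of a simple drawing have one common point at most, so a common end would be the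
    crossing point; but no vertex lies in the interior of an edge. *)
Lemma cross_indep e f v : xcross e f -> incident ends e v -> ~~ incident ends f v.
Proof.
case/andP=> ef /asboolP [p [h1 h2]] iv; apply/negP => jv.
case: G => _ [_ [_ [_ [k [_ u]]]]].
have e1 : p = pos v by apply: (u e f); [apply/eqP|exact: int_pts|exact: int_pts|exact: incident_pts|exact: incident_pts].
by rewrite e1 in h1; apply: k h1.
Qed.

Lemma cross_gbox e f : xcross e f ->
  exists N0, forall N, (N0 <= N)%N -> gbox N (ccurve e) (ccurve f) = -1.
Proof.
case/andP=> /eqP ef /asboolP [p [[s0 hs0 e1] [t0 ht0 e2]]].
have hs' : 0 <= s0 <= 1 by case/andP: hs0 => ? ?; rewrite !ltW.
have ht' : 0 <= t0 <= 1 by case/andP: ht0 => ? ?; rewrite !ltW.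
have im g : ccurve g @` (@I01 R) = edge_pts curve g.
  apply/seteqP; split=> _ [s hs <-]; exists s => //; by rewrite ccurveE.
apply: (@gbox_cross R (ccurve e) (ccurve f) s0 t0) => //.
- exact: ccurve_continuous.
- exact: ccurve_continuous.
- exact: ccurve_inj.
- exact: ccurve_inj.
- by rewrite !ccurveE // e1 e2.
- move=> s t hs ht est; case: G => _ [_ [_ [_ [_ [_ u]]]]].
  have q1 : ccurve e s = p.
    apply: (u e f) => //; [by exists s => //; rewrite ccurveE| |by exists s0|by exists t0].
    by exists t => //; rewrite est ccurveE.
  split; first by apply: (@ccurve_inj e) => //; rewrite q1 ccurveE.
  by apply: (@ccurve_inj f) => //; rewrite -est q1 ccurveE.
rewrite !im ccurveE // e1; case: G => _ [_ [_ [_ [_ [c _]]]]].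
by apply: c => //; [exists s0|exists t0].
Qed.

Section Fixed.
Variable N : nat.
Hypothesis N0 : (0 < N)%N.
Hypothesis hN : forall e f, xcross e f -> gbox N (ccurve e) (ccurve f) = -1.
Local Notation src := (dsrc ends).
Local Notation tgt := (dtgt ends).

Definition dsign (d : Ed * bool) (v : V) : R[i] :=
  if d.2 then (chain N (ccurve d.1) (pos v))^-1 else chain N (ccurve d.1) (pos v).

Lemma dsign_neq0 d v : ~~ incident ends d.1 v -> dsign d v != 0.
Proof.
move=> h; have := chain_neq0 N0 (ccurve_off h).
by rewrite /dsign; case: ifP; rewrite ?invr_eq0.
Qed.

Lemma dsign_sqr d v : ~~ incident ends d.1 v -> dsign d v ^+ 2 =
  (toC (pos (tgt d)) - toC (pos v)) / (toC (pos (src d)) - toC (pos v)).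
Proof.
move=> h; have := chain_sqr N0 (ccurve_off h); rewrite ccurve0 ccurve1.
rewrite /dsign /dsrc /dtgt; case: ifP => // _ e.
by rewrite exprVn e invf_div.
Qed.

(** This is [gboxE] with the value -1. Reversing a dart inverts its factors and exchanges its ends,
    which leaves the relation unchanged. *)
Lemma dsign_cross d d' : xcross d.1 d'.1 ->
  dsign d (src d') * dsign d' (tgt d) = - (dsign d (tgt d') * dsign d' (src d)).
Proof.
move=> c; have := hN c; rewrite gboxE // !ccurve0 !ccurve1.
have nz v : incident ends d'.1 v -> chain N (ccurve d.1) (pos v) != 0.
  by move=> h; apply: chain_neq0 => //; apply: ccurve_off; move: c h; rewrite crossC; apply: cross_indep.
have nz' v : incident ends d.1 v -> chain N (ccurve d'.1) (pos v) != 0.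
  by move=> h; apply: chain_neq0 => //; apply: ccurve_off; apply: cross_indep c h.
have i1 := nz (ends d'.1).1 ltac:(by rewrite /incident eqxx); have i2 := nz (ends d'.1).2 ltac:(by rewrite /incident eqxx orbT).
have j1 := nz' (ends d.1).1 ltac:(by rewrite /incident eqxx); have j2 := nz' (ends d.1).2 ltac:(by rewrite /incident eqxx orbT).
move/(canRL (divfK (mulf_neq0 i2 j1))); rewrite mulN1r.
rewrite /dsign /dsrc /dtgt; move: i1 i2 j1 j2.
set x := chain N _ (pos (ends d'.1).1); set y := chain N _ (pos (ends d'.1).2).
set z := chain N _ (pos (ends d.1).1); set w := chain N _ (pos (ends d.1).2).
move=> x0 y0 z0 w0 e; have ex : x = - (y * z) / w by rewrite -e mulfK.
by case: d.2; case: d'.2 => //; rewrite -/x -/y -/z -/w ex; field; rewrite ?x0 ?y0 ?z0 ?w0.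
Qed.

Definition wsign (p : seq (Ed * bool)) v : R[i] := \prod_(d <- p) dsign d v.

Lemma wsign_dart d p a b : is_walk ends a p b -> (forall d', d' \in p -> xcross d.1 d'.1) ->
  dsign d a * wsign p (tgt d) = (-1) ^+ size p * (dsign d b * wsign p (src d)).
Proof.
elim: p a => [a /= /eqP -> _|d' p IH a /= /andP[/eqP <- hw] hc].
  by rewrite /wsign !big_nil expr0 mul1r.
rewrite /wsign !big_cons -!/(wsign _ _) mulrA dsign_cross ?hc ?mem_head //.
rewrite mulNr mulrAC (IH (tgt d')) // => [|d'' h]; last by apply: hc; rewrite inE h orbT.
by rewrite exprS; ring.
Qed.

(** The relations of single darts telescope along both walks, and each of the [size p * size q]
    crossings contributes one factor -1. *)
Lemma wsign_walk p q a b c d : is_walk ends a p b -> is_walk ends c q d ->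
  (forall x y, x \in p -> y \in q -> xcross x.1 y.1) ->
  wsign p c * wsign q b = (-1) ^+ (size p * size q) * (wsign p d * wsign q a).
Proof.
move=> hp hq; elim: p a hp => [a /= /eqP -> _|x p IH a /= /andP[/eqP <- hw] hc].
  by rewrite mul0n expr0 mul1r /wsign !big_nil.
rewrite /wsign !big_cons -!/(wsign _ _) -mulrA (IH (tgt x)) // => [|y z h]; last first.
  by apply: hc; rewrite inE h orbT.
rewrite mulrCA [dsign x c * _]mulrCA (wsign_dart hq) => [|y hy]; last first.
  by apply: hc; rewrite ?mem_head.
by rewrite mulSn exprD; ring.
Qed.

Lemma wsign_neq0 p v : (forall d, d \in p -> ~~ incident ends d.1 v) -> wsign p v != 0.
Proof. by move=> h; rewrite /wsign prodf_seq_neq0; apply/allP => d /h; apply: dsign_neq0. Qed.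

Lemma wsign_sqr p a b v : is_walk ends a p b -> a != v ->
  (forall d, d \in p -> ~~ incident ends d.1 v) ->
  wsign p v ^+ 2 = (toC (pos b) - toC (pos v)) / (toC (pos a) - toC (pos v)).
Proof.
have nz u w : u != w -> toC (pos u) - toC (pos w) != 0.
  by move=> h; rewrite subr_eq0 (inj_eq (@toC_inj R)) (inj_eq pos_inj).
elim: p a => [a /= /eqP -> av _|d p IH a /= /andP[/eqP <- hw] av h].
  by rewrite /wsign big_nil expr1n divff // nz.
have hd : ~~ incident ends d.1 v by apply: h; apply: mem_head.
have tv : tgt d != v by apply: contraNneq hd => <-; apply: incident_tgt.
rewrite /wsign big_cons -/(wsign _ _) exprMn dsign_sqr // (IH (tgt d)) //; last first.
  by move=> d' h'; apply: h; rewrite inE h' orbT.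
by field; rewrite !nz.
Qed.
End Fixed.

(** Even lengths turn the sign of every independent pair into 1, so that [K33_signs] applies as for
    disjoint paths. Edges of one walk, or of walks with a common end, are not compared at all; walks
    may therefore repeat vertices and edges. *)
Lemma no_even_K33 (a b : 'I_3 -> V) (W : 'I_3 -> 'I_3 -> seq (Ed * bool)) :
  injective a -> (forall i j, a i != b j) ->
  (forall i j, is_walk ends (a i) (W i j) (b j)) ->
  (forall i j, ~~ odd (size (W i j))) ->
  (forall i j k l x y, i != k -> j != l -> x \in W i j -> y \in W k l -> xcross x.1 y.1) ->
  False.
Proof.
move=> inja ab hW ev hc.
have [N N0 hN] : exists2 N, (0 < N)%N &
    forall t : Ed * Ed, xcross t.1 t.2 -> gbox N (ccurve t.1) (ccurve t.2) = -1.
  apply: common_N => -[e f] /=; case c : (xcross e f); last by exists 0%N.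
  by have [N1 h] := cross_gbox c; exists N1 => N /h.
have {}hN e f : xcross e f -> gbox N (ccurve e) (ccurve f) = -1 by apply: (hN (e, f)).
have oa i j k d : i != k -> d \in W i j -> ~~ incident ends d.1 (a k).
  move=> ik hd; have [l jl] := other3 j; have [d' h1 h2] := walk_src (hW k l) (ab k l).
  by apply: cross_indep h2; rewrite crossC; apply: hc ik jl hd h1.
have ob i j l d : j != l -> d \in W i j -> ~~ incident ends d.1 (b l).
  move=> jl hd; have [k ik] := other3 i; have [d' h1 h2] := walk_tgt (hW k l) (ab k l).
  by apply: cross_indep h2; rewrite crossC; apply: hc ik jl hd h1.
refine (@K33_signs R[i] (fun i => toC (pos (a i))) (fun i => toC (pos (b i)))
  (fun i j k => wsign N (W i j) (a k)) (fun i j l => wsign N (W i j) (b l)) _ _ _ _ _ _).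
- by rewrite pnatr_eq0.
- by move=> i k /= /toC_inj /pos_inj /inja.
- by move=> i j /=; rewrite (inj_eq (@toC_inj R)) (inj_eq pos_inj).
- move=> i j k ik; rewrite (wsign_sqr N0 (hW i j)) //; first by rewrite (inj_eq inja).
  by move=> d; apply: oa.
- by move=> i j l jl; apply: wsign_neq0 => // d; apply: ob.
move=> i j k l ik jl.
rewrite (wsign_walk N0 hN (hW i j) (hW k l)); last by move=> x y; apply: hc.
by rewrite -signr_odd oddM (negbTE (ev i j)) expr0 mul1r.
Qed.
End WalkSigns.

(** * Sparsity of graphs drawn with independent edges disjoint *)

Section Mader.
Variable X : finType.
Implicit Types (A B S : {set X}) (r : rel X).

Definition arcs_in A r := (\sum_(u in A) \sum_(v in A) r u v)%N.

(** The vertex [x] inherits the neighbours of [y]; [y] itself leaves through the vertex set, as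
    [minor_contract] passes to [A :\ y]. *)
Definition contract r x y : rel X := fun u v =>
  [|| r u v, [&& u == x, r y v & v != x] | [&& v == x, r y u & u != x]].

Definition clique r S := forall u v, u \in S -> v \in S -> u != v -> r u v.

Record minor_class (C : {set X} -> rel X -> Prop) : Prop := MinorClass {
  minor_sym : forall A r, C A r -> symmetric r;
  minor_irr : forall A r, C A r -> irreflexive r;
  minor_sub : forall A B r, B \subset A -> C A r -> C B r;
  minor_contract : forall A r x y, x \in A -> y \in A -> r x y -> C A r ->
    C (A :\ y) (contract r x y) }.

(** The contraction loses the edge [x y] and one edge for every common neighbour, each in both
    directions. *)
Lemma arcs_contract A r x y : symmetric r -> irreflexive r -> x \in A -> y \in A -> r x y ->
  (arcs_in A r <= arcs_in (A :\ y) (contract r x y) +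
    (\sum_(w in A) (r x w && r y w)).*2 + 2)%N.
Proof.
move=> sr ir xA yA rxy; set B := A :\ y.
have xy : x != y by apply: contraTneq rxy => ->; rewrite ir.
have xB : x \in B by rewrite !inE xy.
pose new w := [&& r y w, ~~ r x w & w != x].
have e1 : arcs_in A r = (arcs_in B r + (\sum_(w in B) r y w).*2)%N.
  rewrite /arcs_in (big_setD1 y) //= [X in (X + _)%N](big_setD1 y) //= ir add0n.
  under [X in (_ + X)%N]eq_bigr => u uB do rewrite (big_setD1 y) //= sr.
  by rewrite big_split /= -/B; lia.
have e2 : (\sum_(w in B) r y w <= \sum_(w in B) new w + \sum_(w in A) (r x w && r y w) + 1)%N.
  rewrite [X in (_ + X + _)%N](big_setD1 y) //= ir andbF add0n -/B -big_split /=.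
  rewrite (bigD1 x) //= [X in (_ <= X + _)%N](bigD1 x) //= addnC.
  have : (\sum_(w in B | w != x) r y w <= \sum_(w in B | w != x) (new w + (r x w && r y w)))%N.
    by apply: leq_sum => w /andP[_ wx]; rewrite /new wx; case: (r y w); case: (r x w).
  by have := leq_b1 (r y x); lia.
have e3 : (arcs_in B r + (\sum_(w in B) new w).*2 <= arcs_in B (contract r x y))%N.
  have s1 : (\sum_(u in B) \sum_(v in B) ((u == x) && new v) = \sum_(w in B) new w)%N.
    rewrite (bigD1 x) //= eqxx [X in (_ + X)%N]big1 ?addn0 // => u /andP[_ /negbTE ->].
    by rewrite big1.
  have s2 : (\sum_(u in B) \sum_(v in B) ((v == x) && new u) = \sum_(w in B) new w)%N.
    by rewrite exchange_big /= s1.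
  rewrite -addnn -{1}s1 -s2 /arcs_in -!big_split /=; apply: leq_sum => u uB.
  rewrite -!big_split /=; apply: leq_sum => v vB; rewrite /contract /new.
  have [->|ux] := eqVneq u x; have [->|vx] := eqVneq v x; rewrite ?eqxx ?andbF ?ir //=.
  - by case: (r x v); case: (r y v).
  - by rewrite (sr u x); case: (r x u); case: (r y u).
  by rewrite !addn0; case: (r u v).
rewrite e1; lia.
Qed.

(* Either some edge lies in few triangles, and contracting it loses few edges, or the
   neighbourhood of a vertex is dense and, by induction, too dense to exclude a clique. *)
Lemma mader h (C : {set X} -> rel X -> Prop) : minor_class C ->
  (forall A r S, C A r -> S \subset A -> #|S| = h.+2 -> clique r S -> False) ->
  forall A r, C A r -> (arcs_in A r <= (2 ^ h).-1.*2 * #|A|)%N.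
Proof.
elim: h C => [|h IH] C mC noK A r CA.
  rewrite mul0n leqn0 /arcs_in big1 // => u uA; rewrite big1 // => v vA.
  case ruv: (r u v) => //; exfalso.
  have uv : u != v by apply: contraTneq ruv => ->; rewrite (minor_irr mC CA).
  apply: (noK A r [set u; v]) => //; first by rewrite finset.subUset !finset.sub1set uA.
    by rewrite cards2 uv.
  move=> a b; rewrite !inE => /orP[] /eqP -> /orP[] /eqP -> //; rewrite ?eqxx //.
  by rewrite (minor_sym mC CA).
set c := (2 ^ h.+1).-1; have cE : c = ((2 ^ h).-1.*2 + 1)%N.
  have : (0 < 2 ^ h)%N by rewrite expn_gt0.
  by rewrite /c expnS; lia.
(* Subsets of the neighbourhood of an outside vertex [x]. Contractions among them keep [x] adjacent
   to all, and adding [x] enlarges any clique by one, so [C'] satisfies the hypotheses for [h]. *)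
pose C' B r' := exists A' x, [/\ C A' r', x \in A', x \notin B, B \subset A' &
  forall b, b \in B -> r' x b].
have mC' : minor_class C'.
  split.
  - by move=> A0 r0 [A' [x [/(minor_sym mC)]]].
  - by move=> A0 r0 [A' [x [/(minor_irr mC)]]].
  - move=> A0 B0 r0 sB [A' [x [h1 h2 h3 h4 h5]]]; exists A', x; split=> //.
    + by apply: contraNN h3; apply: (fintype.subsetP sB).
    + exact: fintype.subset_trans sB h4.
    + by move=> b /(fintype.subsetP sB); apply: h5.
  - move=> A0 r0 u v uA vA ruv [A' [x [h1 h2 h3 h4 h5]]].
    have uA' := fintype.subsetP h4 _ uA; have vA' := fintype.subsetP h4 _ vA.
    exists (A' :\ v), x; split.
    + exact: (minor_contract mC).
    + by rewrite !inE h2 andbT; apply: contraNneq h3 => ->.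
    + by rewrite !inE negb_and h3 orbT.
    + exact: finset.setSD.
    + by move=> b; rewrite !inE => /andP[_ /h5 h6]; rewrite /contract h6.
have noK' A0 r0 S : C' A0 r0 -> S \subset A0 -> #|S| = h.+2 -> clique r0 S -> False.
  move=> [A' [x [h1 h2 h3 h4 h5]]] sS cS kS.
  have xS : x \notin S by apply: contraNN h3; apply: (fintype.subsetP sS).
  apply: (noK A' r0 (x |: S)) => //.
  - by rewrite finset.subUset finset.sub1set h2 (fintype.subset_trans sS).
  - by rewrite cardsU1 xS cS.
  move=> u v; rewrite !inE => /orP[/eqP ->|uS] /orP[/eqP ->|vS] //; rewrite ?eqxx // => uv.
  - by apply: h5; apply: (fintype.subsetP sS).
  - by rewrite (minor_sym mC h1); apply: h5; apply: (fintype.subsetP sS).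
  - exact: kS.
have {}IH := IH C' mC' noK'.
have [n] := ubnP #|A|; elim: n A r CA => // n IHn A r CA ltn.
rewrite leqNgt; apply/negP => big.
have sr := minor_sym mC CA; have ir := minor_irr mC CA.
(* Otherwise contracting the edge would lose at most [c.*2] arcs, and the bound for the smaller
   graph would give the bound for this one. *)
have common x y : x \in A -> y \in A -> r x y -> (c <= \sum_(w in A) (r x w && r y w))%N.
  move=> xA yA rxy; have := arcs_contract sr ir xA yA rxy.
  have cA : #|A| = #|A :\ y|.+1 by rewrite (cardsD1 y) yA.
  have := IHn _ _ (minor_contract mC xA yA rxy CA) ltac:(by move: ltn; rewrite cA).
  by move: big; rewrite cA mulnS; lia.
have [x xA [y0 y0A rxy0]] : exists2 x, x \in A & exists2 y, y \in A & r x y.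
  apply: contrapT => hno; move: big; rewrite /arcs_in big1 // => u uA; rewrite big1 // => v vA.
  by case ruv: (r u v) => //; exfalso; apply: hno; exists u => //; exists v.
pose B := [set w in A | r x w].
have sBA : B \subset A by apply/fintype.subsetP => w; rewrite inE => /andP[].
have := IH B r; have CB : C' B r.
  exists A, x; split=> //; first by rewrite !inE ir andbF.
  by move=> b; rewrite inE => /andP[].
move=> /(_ CB); rewrite leqNgt => /negP; apply.
have y0B : y0 \in B by rewrite inE y0A.
have B0 : (0 < #|B|)%N by apply/card_gt0P; exists y0.
apply: (@leq_trans (c * #|B|)); first by rewrite cE mulnDl mul1n -[X in (X < _)%N]addn0 ltn_add2l.
rewrite mulnC -sum_nat_const /arcs_in; apply: leq_sum => y yB.
move: (yB); rewrite inE => /andP[yA rxy]; apply: leq_trans (common x y xA yA rxy) _.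
rewrite (bigID (mem B)) /= [X in (_ + X)%N]big1 ?addn0; last first.
  by move=> w /andP[wA]; rewrite inE wA /= => /negbTE ->.
have -> : (\sum_(w in A | w \in B) (r x w && r y w) = \sum_(w in B) (r x w && r y w))%N.
  apply: eq_bigl => w; rewrite !inE; by case: (w \in A).
by apply: leq_sum => w _; case: (r x w).
Qed.
End Mader.

Section ThinGraphs.
Variable R : realType.
Local Notation pt := (R * R)%type.
Local Open Scope classical_set_scope.

Lemma fun_comp_continuous (S T W : topologicalType) (f : S -> T) (g : T -> W) :
  continuous f -> continuous g -> continuous (fun x => g (f x)).
Proof. by move=> cf cg x; apply: (continuous_comp (cf x) (cg _)). Qed.

Lemma affine_continuous (a b : R) : continuous (fun t : R => a * t + b).
Proof.
move=> t; apply: cvgD; last exact: cvg_cst.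
by apply: cvgM; [exact: cvg_cst|exact: cvg_id].
Qed.

Definition pconn (S : set pt) := forall p q, S p -> S q -> exists g : R -> pt,
  [/\ continuous g, g 0 = p, g 1 = q & forall t, 0 <= t <= 1 -> S (g t)].

Lemma pconnU (S T : set pt) p : pconn S -> pconn T -> S p -> T p -> pconn (S `|` T).
Proof.
move=> cS cT Sp Tp.
have sub (A B : set pt) x y : A `<=` B -> A x -> A y -> pconn A ->
    exists g : R -> pt, [/\ continuous g, g 0 = x, g 1 = y & forall t, 0 <= t <= 1 -> B (g t)].
  by move=> AB Ax Ay /(_ x y Ax Ay) [g [h1 h2 h3 h4]]; exists g; split=> // t /h4; apply: AB.
have cat x y z : (exists g : R -> pt, [/\ continuous g, g 0 = x, g 1 = y &
      forall t, 0 <= t <= 1 -> (S `|` T) (g t)]) ->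
    (exists g : R -> pt, [/\ continuous g, g 0 = y, g 1 = z &
      forall t, 0 <= t <= 1 -> (S `|` T) (g t)]) ->
    exists g : R -> pt, [/\ continuous g, g 0 = x, g 1 = z &
      forall t, 0 <= t <= 1 -> (S `|` T) (g t)].
  move=> [g [cg g0 g1 gS]] [h [ch h0 h1 hS]].
  pose k1 (t : R) := clamp 0 1 (2 * t); pose k2 (t : R) := clamp 0 1 (2 * t - 1).
  have ck1 : continuous k1.
    have -> : k1 = fun t => clamp 0 1 (2 * t + 0) by apply/funext => t; rewrite addr0.
    exact: fun_comp_continuous (@affine_continuous _ _) (@clamp_continuous _ _ _).
  have ck2 : continuous k2.
    exact: fun_comp_continuous (@affine_continuous _ _) (@clamp_continuous _ _ _).
  have c0 (t : R) : t <= 0 -> clamp 0 1 t = 0.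
    by move=> ht; rewrite /clamp (min_idPr _) ?(max_idPl _) //; lra.
  have c1 (t : R) : 1 <= t -> clamp 0 1 t = 1.
    by move=> ht; rewrite /clamp (min_idPl _) ?(max_idPr _) //; lra.
  (* Concatenation without a case distinction: on each half one of the two summands is constantly
     [y]. *)
  exists (fun t => g (k1 t) + h (k2 t) - y); split.
  - move=> t; apply: cvgB; last exact: cvg_cst.
    by apply: cvgD; [exact: (fun_comp_continuous ck1 cg)|exact: (fun_comp_continuous ck2 ch)].
  - have -> : k1 0 = 0 by apply: c0; lra.
    have -> : k2 0 = 0 by apply: c0; lra.
    by rewrite g0 h0 addrK.
  - have -> : k1 1 = 1 by apply: c1; lra.
    have -> : k2 1 = 1 by apply: c1; lra.
    by rewrite g1 h1 [y + z]addrC addrK.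
  - move=> t ht; have [h2|h2] := leP t (1 / 2).
      have -> : k2 t = 0 by apply: c0; lra.
      by rewrite h0 addrK; apply: gS; apply: clamp_in; apply: ler01.
    have -> : k1 t = 1 by apply: c1; lra.
    by rewrite g1 [y + _]addrC addrK; apply: hS; apply: clamp_in; apply: ler01.
move=> x y [Sx|Tx] [Sy|Ty].
- by apply: (sub S) => // z; left.
- by apply: (cat x p y); [apply: (sub S) => // z; left|apply: (sub T) => // z; right].
- by apply: (cat x p y); [apply: (sub T) => // z; right|apply: (sub S) => // z; left].
- by apply: (sub T) => // z; right.
Qed.

Lemma pconn_curve (c : R -> pt) (I : set R) : continuous c ->
  (forall s t u, I s -> I t -> 0 <= u <= 1 -> I (s + u * (t - s))) -> pconn (c @` I).
Proof.
move=> cc hI _ _ [s Is <-] [t It <-]; exists (fun u => c (s + u * (t - s))); split.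
- have -> : (fun u => c (s + u * (t - s))) = fun u => c ((t - s) * u + s).
    by apply/funext => u; rewrite addrC mulrC.
  exact: fun_comp_continuous (@affine_continuous _ _) cc.
- by rewrite mul0r addr0.
- by rewrite mul1r subrKC.
- by move=> u hu; exists (s + u * (t - s)) => //; apply: hI.
Qed.

Variable X : finType.
Implicit Types (A B S : {set X}) (r : rel X).

(** Edges are drawn as path-connected sets instead of arcs, so that a contraction just takes unions.
    Adjacent edges may meet anywhere; only independent ones are kept apart. *)
Definition thin A r : Prop := [/\ symmetric r, irreflexive r &
  exists (p : X -> pt) (E : X -> X -> set pt),
    (forall x y, x \in A -> y \in A -> r x y -> [/\ pconn (E x y), E x y (p x) & E x y (p y)]) /\
    (forall x y z w, x \in A -> y \in A -> z \in A -> w \in A -> r x y -> r z w ->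
       x != z -> x != w -> y != z -> y != w -> forall q, E x y q -> E z w q -> False)].

(* After contracting [y] into [x], the arc set of a new edge is a union of old arc sets
   whose end points stay in the merged edge. *)
Lemma thin_contract A r x y : x \in A -> y \in A -> r x y -> thin A r ->
  thin (A :\ y) (contract r x y).
Proof.
move=> xA yA rxy [sr ir [p [E [h1 h2]]]].
have ryx : r y x by rewrite sr.
have [cxy px py] := h1 x y xA yA rxy.
have sr' : symmetric (contract r x y).
  by move=> u v; rewrite /contract sr; congr (_ || _); rewrite orbC.
have ir' : irreflexive (contract r x y).
  by move=> u; rewrite /contract ir /=; case: eqP; rewrite ?andbF.
split=> //.
pose E' u v := if u == x then E x y `|` (if r x v then E x v else E y v)
  else if v == x then E x y `|` (if r u x then E u x else E u y) else E u v.
have AD u : u \in A :\ y -> u \in A /\ u != y by rewrite !inE => /andP[].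
have spec u v : contract r x y u v ->
  [\/ [/\ u != x, v != x, r u v & E' u v = E u v],
      [/\ u = x, v != x & exists z, [/\ z = x \/ z = y, r z v & E' u v = E x y `|` E z v]] |
      [/\ u != x, v = x & exists z, [/\ z = x \/ z = y, r u z & E' u v = E x y `|` E u z]]].
  rewrite /contract /E'.
  have [->|ux] := eqVneq u x; have [->|vx] := eqVneq v x; rewrite ?ir ?andbF ?orbF ?andbT //=.
  - case rxv : (r x v) => /= h; apply: Or32; split=> //; first by exists x; split=> //; left.
    by exists y; split=> //; right.
  - case rux : (r u x) => /= h; apply: Or33; split=> //; first by exists x; split=> //; left.
    by exists y; split=> //; [right|rewrite sr].
  - by move=> h; apply: Or31.
exists p, E'; split.
  move=> u v /AD[uA uy] /AD[vA vy] /spec [] [].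
  - by move=> _ _ ruv ->; apply: h1.
  - move=> -> vx [z [hz rzv ->]].
    have zA : z \in A by case: hz => ->.
    have pz : E x y (p z) by case: hz => ->.
    have [k1 k2 k3] := h1 z v zA vA rzv.
    by split; [exact: pconnU cxy k1 pz k2|left|right].
  - move=> ux -> [z [hz ruz ->]].
    have zA : z \in A by case: hz => ->.
    have pz : E x y (p z) by case: hz => ->.
    have [k1 k2 k3] := h1 u z uA zA ruz.
    by split; [exact: pconnU cxy k1 pz k3|right|left].
pose tok u v c := [|| c == u, c == v | (c == y) && ((u == x) || (v == x))].
have parts u v q : u \in A -> v \in A -> contract r x y u v -> E' u v q ->
    exists c d, [/\ c \in A, d \in A, r c d, E c d q & tok u v c && tok u v d].
  rewrite /tok => uA vA /spec [] [].
  - by move=> _ _ ruv -> h; exists u, v; rewrite !eqxx ?orbT.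
  - move=> -> vx [z [hz rzv ->]] [] h; first by exists x, y; rewrite !eqxx ?orbT.
    by exists z, v; rewrite !eqxx ?orbT /=; case: hz rzv h => -> rzv h; rewrite eqxx ?orbT.
  - move=> ux -> [z [hz ruz ->]] [] h; first by exists x, y; rewrite !eqxx ?orbT.
    by exists u, z; rewrite !eqxx ?orbT /=; case: hz ruz h => -> ruz h; rewrite eqxx ?orbT.
move=> a b z w /AD[aA ay] /AD[bA by_] /AD[zA zy] /AD[wA wy] rab rzw az aw bz bw q.
move=> /(parts a b q aA bA rab) [c [d [cA dA rcd Ec /andP[tc td]]]].
move=> /(parts z w q zA wA rzw) [c' [d' [c'A d'A rcd' Ec' /andP[tc' td']]]].
have ne k l : tok a b k -> tok z w l -> k != l.
  rewrite /tok => /or3P[/eqP->|/eqP->|/andP[/eqP-> h]] /or3P[/eqP->|/eqP->|/andP[/eqP-> h']] //.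
  - by rewrite eq_sym.
  - by rewrite eq_sym.
  - case/orP: h h' az aw bz bw => /eqP -> /orP[] /eqP ->; rewrite ?eqxx //.
by apply: (h2 c d c' d' cA dA c'A d'A rcd rcd' _ _ _ _ q Ec Ec'); apply: ne.
Qed.

Lemma thin_minor : minor_class thin.
Proof.
split.
- by move=> A r [].
- by move=> A r [].
- move=> A B r sBA [sr ir [p [E [h1 h2]]]]; have s := fintype.subsetP sBA.
  split=> //; exists p, E; split=> [x y /s xA /s yA|x y z w /s xA /s yA /s zA /s wA]; first exact: h1.
  exact: h2.
exact: thin_contract.
Qed.

(** Splitting the six vertices into two triples gives a K_{3,3}, and path-connectedness provides its
    nine paths. *)
Lemma thin_no_K6 A r S : thin A r -> S \subset A -> #|S| = 6 -> clique r S -> False.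
Proof.
move=> [sr ir [p [E [h1 h2]]]] sSA cS kS; have sS := fintype.subsetP sSA.
have x0 : X by move: (enum_val (cast_ord (esym cS) ord0)).
pose s (i : nat) := nth x0 (enum S) i.
have sz : size (enum S) = 6 by rewrite -cardE.
have sI i : (i < 6)%N -> s i \in S by move=> hi; rewrite -mem_enum mem_nth ?sz.
have sinj i j : (i < 6)%N -> (j < 6)%N -> i != j -> s i != s j.
  by move=> hi hj; apply: contra => /eqP /eqP; rewrite nth_uniq ?sz ?enum_uniq.
have lt6 (i : 'I_3) : (i < 6)%N by apply: leq_trans (ltn_ord i) _.
have lt6' (i : 'I_3) : (i + 3 < 6)%N by rewrite -[6%N]/(3 + 3)%N ltn_add2r.
have ex (ij : 'I_3 * 'I_3) : exists g : R -> pt, [/\ continuous g, g 0 = p (s ij.1),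
    g 1 = p (s (ij.2 + 3)%N) & forall t, 0 <= t <= 1 -> E (s ij.1) (s (ij.2 + 3)%N) (g t)].
  case: ij => i j /=; have rij : r (s i) (s (j + 3)%N).
    by apply: kS; rewrite ?sI ?lt6 ?lt6' // sinj ?lt6 ?lt6' //; have := ltn_ord i; lia.
  have [c pi pj] := h1 _ _ (sS _ (sI _ (lt6 i))) (sS _ (sI _ (lt6' j))) rij.
  exact: c.
have [g hg] := choice ex.
apply: (@no_K33_paths R (fun i => p (s i)) (fun j : 'I_3 => p (s (j + 3)%N)) (fun i j => g (i, j))).
- by move=> i j; have [] := hg (i, j).
- by move=> i j; have [] := hg (i, j).
- by move=> i j; have [] := hg (i, j).
move=> i j k l u v ik jl hu hv; apply/eqP => e.
have [_ _ _ /(_ u hu) e1] := hg (i, j); have [_ _ _ /(_ v hv) e2] := hg (k, l).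
rewrite e /= in e1.
have rr (a b : 'I_3) : r (s a) (s (b + 3)%N).
  by apply: kS; rewrite ?sI ?lt6 ?lt6' // sinj ?lt6 ?lt6' //; have := ltn_ord a; lia.
apply: (h2 _ _ _ _ _ _ _ _ (rr i j) (rr k l) _ _ _ _ _ e1 e2); try (by apply: sS; apply: sI).
- by apply: sinj.
- by apply: sinj => //; have := ltn_ord i; lia.
- by apply: sinj => //; have := ltn_ord k; lia.
- by apply: sinj => //; rewrite eqn_add2r.
Qed.

(** Here 30 is 2 (2^4 - 1), every edge being counted in both directions. *)
Lemma thin_bound A r : thin A r -> (arcs_in A r <= 30 * #|A|)%N.
Proof. exact: (mader (h := 4) thin_minor thin_no_K6). Qed.
End ThinGraphs.

Lemma arcs_ge (X T : finType) (A : {set X}) (r : rel X) (D : {set T}) (f : T -> X * X) :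
  {in D &, injective f} ->
  (forall t, t \in D -> [/\ (f t).1 \in A, (f t).2 \in A & r (f t).1 (f t).2]) ->
  (#|D| <= arcs_in A r)%N.
Proof.
move=> fi h; rewrite /arcs_in pair_big /= -(card_in_imset fi) -sum1_card.
rewrite [leqRHS](bigID (mem (f @: D))) /=; apply: leq_trans (leq_addr _ _).
rewrite leq_eqVlt; apply/orP; left; apply/eqP; apply: eq_big => [z|z].
  apply/idP/idP => [hz|/andP[//]]; rewrite hz andbT.
  by case/imsetP: hz => t /h [h1 h2 _] ->; rewrite h1 h2.
by case/imsetP=> t /h [_ _ h3] ->; rewrite h3.
Qed.

Lemma card_dbl (T : finType) (D : {set T}) : #|[set t : T * bool | t.1 \in D]| = (2 * #|D|)%N.
Proof.
have -> : [set t : T * bool | t.1 \in D] = finset.setX D [set: bool].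
  by apply/setP => t; rewrite !inE andbT.
by rewrite cardsX cardsT card_bool mulnC.
Qed.

Section ThinBounds.
Variable R : realType.
Local Notation pt := (R * R)%type.
Variables (V Ed : finType) (pos : V -> pt) (ends : Ed -> V * V) (curve : Ed -> R -> pt).
Hypothesis G : simple_topgraph pos ends curve.
Local Notation cross := (xcross curve).
Local Notation src := (dsrc ends).
Local Notation tgt := (dtgt ends).

Definition touch (e f : Ed) : bool := (e == f) || cross e f.

Lemma touchC e f : touch e f = touch f e.
Proof. by rewrite /touch eq_sym crossC. Qed.

Lemma src_neq_tgt d : src d != tgt d.
Proof.
case: G => _ [h _]; apply/eqP; rewrite /dsrc /dtgt; case: ifP => _ e; apply: (h d.1).
  by rewrite e.
by rewrite e.
Qed.

Lemma dart_inj : injective (fun d => (src d, tgt d)).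
Proof.
move=> [e b] [f c] []; rewrite /dsrc /dtgt /= => h1 h2.
have ef : e = f.
  apply: contrapT => ef; case: G => _ [_ [h _]]; have [n1 n2] := h _ _ ef.
  case: b c h1 h2 => -[] h1 h2.
  - by apply: n1; rewrite [LHS]surjective_pairing h1 h2 -surjective_pairing.
  - by apply: n2; rewrite [LHS]surjective_pairing h1 h2.
  - by apply: n2; rewrite [LHS]surjective_pairing h1 h2.
  - by apply: n1; rewrite [LHS]surjective_pairing h1 h2 -surjective_pairing.
subst f; congr (_, _); case: b c h1 h2 => -[] // h1 h2; have := src_neq_tgt (e, true);
  by rewrite /dsrc /dtgt /= h1 eqxx.
Qed.

Lemma int_disjoint e f p : ~~ touch e f -> edge_int curve e p -> edge_int curve f p -> False.
Proof.
rewrite negb_or => /andP[ef]; rewrite /xcross ef /= => /asboolPn h h1 h2.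
by apply: h; exists p.
Qed.

Lemma pts_meet e f p : ~~ touch e f -> edge_pts curve e p -> edge_pts curve f p ->
  exists2 v, incident ends e v & incident ends f v.
Proof.
have one e' f' v : edge_pts curve f' (pos v) -> incident ends e' v ->
    exists2 v, incident ends e' v & incident ends f' v.
  by move=> h iv; exists v => //; apply: contraPT h => h; apply: pos_off_edge h.
move=> t h1 h2; have [i1|[v iv e1]] := pts_int G h1; last first.
  by apply: one iv; rewrite -e1.
have [i2|[v iv e1]] := pts_int G h2; first by case: (int_disjoint t i1 i2).
have [w w1 w2] : exists2 v, incident ends f v & incident ends e v.
  by apply: one iv; rewrite -e1.
by exists w.
Qed.

(** Non-crossing edges without a common end are disjoint by [pts_meet], so the given drawing is
    itself [thin]. *)
Lemma noncross_bound (F : {set Ed}) (U : {set V}) :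
  (forall e, e \in F -> (ends e).1 \in U /\ (ends e).2 \in U) ->
  (forall e f, e \in F -> f \in F -> ~~ cross e f) -> (#|F| <= 15 * #|U|)%N.
Proof.
move=> hU nc.
pose P u v := [pred d : Ed * bool | [&& d.1 \in F, src d == u & tgt d == v]].
pose r : rel V := fun u v => [exists d, P u v d].
pose E u v : set pt := if [pick d | P u v d] is Some d then edge_pts curve d.1 else classical_sets.set0.
have rE u v : r u v -> exists d, [/\ d.1 \in F, src d = u, tgt d = v & E u v = edge_pts curve d.1].
  move=> /existsP [d0 h0]; rewrite /E; case: pickP => [d /and3P[h1 /eqP h2 /eqP h3]|/(_ d0)]; last by rewrite h0.
  by exists d.
have sr u v : r u v -> r v u.
  move=> /existsP[[e b] /and3P[h1 /eqP h2 /eqP h3]]; apply/existsP; exists (e, ~~ b).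
  by rewrite /= h1 -h2 -h3 /dsrc /dtgt /=; case: (b); rewrite !eqxx.
have tr : thin R U r.
  split; first by move=> u v; apply/idP/idP; apply: sr.
    move=> u; apply/negbTE/negP => /rE [d [_ h1 h2 _]].
    by have := src_neq_tgt d; rewrite h1 h2 eqxx.
  exists pos, E; split=> [u v uU vU /rE [d [dF h1 h2 ->]]|].
    split; last 2 first.
    - by apply: (incident_pts G); rewrite -h1 incident_src.
    - by apply: (incident_pts G); rewrite -h2 incident_tgt.
    have -> : edge_pts curve d.1 = (ccurve curve d.1 @` (@I01 R))%classic.
      by apply/seteqP; split=> _ [s hs <-]; exists s => //; rewrite ccurveE.
    apply: pconn_curve; first exact: (ccurve_continuous G).
    by move=> s t w /andP[s0 s1] /andP[t0 t1] /andP[w0 w1]; apply/andP; split; nra.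
  move=> x y z w _ _ _ _ /rE [d [dF h1 h2 ->]] /rE [d' [dF' h1' h2' ->]] xz xw yz yw q q1 q2.
  have inc (b : Ed * bool) v : incident ends b.1 v -> v = src b \/ v = tgt b.
    by rewrite /incident /dsrc /dtgt; case: b.2 => /orP[] /eqP ->; auto.
  have sep v : incident ends d.1 v -> incident ends d'.1 v -> False.
    move=> /inc i1 /inc i2; move: xz xw yz yw; rewrite -h1 -h2 -h1' -h2'.
    by case: i1 i2 => -> [] ->; rewrite eqxx.
  have nt : ~~ touch d.1 d'.1.
    rewrite negb_or nc // andbT; apply/eqP => e; apply: (sep (src d)); first exact: incident_src.
    by rewrite -e incident_src.
  by have [v v1 v2] := pts_meet nt q1 q2; apply: sep v1 v2.
have := thin_bound tr; have : (2 * #|F| <= arcs_in U r)%N.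
  rewrite -card_dbl; apply: (arcs_ge (f := fun d => (src d, tgt d))); first by move=> ? ? _ _; apply: dart_inj.
  move=> d; rewrite inE => dF; have [u1 u2] := hU _ dF; split.
  - by rewrite /dsrc /=; case: ifP.
  - by rewrite /dtgt /=; case: ifP.
  - by apply/existsP; exists d; rewrite /= dF !eqxx.
by lia.
Qed.

(** The vertices are the edges [e i], represented by their midpoints, and the points [v j]; the hop
    from [i] to [j] follows [e i] and then [f i j] up to [v j]. Hops with a common [i] or [j] are
    adjacent and may overlap, so the resulting drawing is [thin]. *)
Lemma hop_bound (I J : finType) (e : I -> Ed) (v : J -> V) (f : I -> J -> Ed)
    (good : I -> J -> bool) :
  (forall i j, good i j -> cross (e i) (f i j) /\ incident ends (f i j) (v j)) ->
  (forall i j i' j', good i j -> good i' j' -> i != i' -> j != j' ->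
     [/\ ~~ touch (e i) (e i'), ~~ touch (e i) (f i' j'), ~~ touch (f i j) (f i' j') &
         v j != v j']) ->
  (#|[set ij : I * J | good ij.1 ij.2]| <= 15 * (#|I| + #|J|))%N.
Proof.
move=> hg hs; pose X := (I + J)%type.
pose r : rel X := fun x y => match x, y with
  | inl i, inr j => good i j | inr j, inl i => good i j | _, _ => false end.
pose mid e := ccurve curve e (1 / 2).
pose p (x : X) := match x with inl i => mid (e i) | inr j => pos (v j) end.
(* Interiors are taken, with the single end [v j] added, because edges of different hops may still
   share their other ends. *)
pose Eij i j : set pt := (edge_int curve (e i) `|`
  (edge_int curve (f i j) `|` (fun q => q = pos (v j))))%classic.
pose E (x y : X) : set pt := match x, y with
  | inl i, inr j => Eij i j | inr j, inl i => Eij i j | _, _ => classical_sets.set0 end.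
have im c : edge_int curve c = (ccurve curve c @` (@I01o R))%classic.
  apply/seteqP; split=> _ [s hs' <-]; exists s => //; rewrite ccurveE //;
    by case/andP: hs' => ? ?; rewrite !ltW.
have pc i j : good i j -> [/\ pconn (Eij i j), Eij i j (mid (e i)) & Eij i j (pos (v j))].
  move=> /hg [/andP[_ /asboolP [q [q1 q2]]] iv]; split; last 2 first.
  - by left; rewrite im; exists (1 / 2) => //; rewrite /I01o /=; lra.
  - by right; right.
  have c1 : pconn (edge_int curve (e i)).
    rewrite im; apply: pconn_curve; first exact: (ccurve_continuous G).
    move=> s t w /andP[s0 s1] /andP[t0 t1] /andP[w0 w1]; apply/andP; split.
      by have [h|h] := leP w (1 / 2); nra.
    by have [h|h] := leP w (1 / 2); nra.
  apply: (@pconnU _ _ _ q) => //; last by left.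
  pose z : R := if (ends (f i j)).1 == v j then 0 else 1.
  have z01 : 0 <= z <= 1 by rewrite /z; case: ifP => _; rewrite ?lexx ler01.
  have ze : z = 0 \/ z = 1 by rewrite /z; case: ifP; [left|right].
  have zE : ccurve curve (f i j) z = pos (v j).
    rewrite /z; case: ifP => [/eqP h|h]; first by rewrite (ccurve0 G) h.
    by move: iv; rewrite /incident h /= => /eqP <-; rewrite (ccurve1 G).
  have -> : (edge_int curve (f i j) `|` (fun q => q = pos (v j)))%classic =
      (ccurve curve (f i j) @` (fun s => I01o s \/ s = z))%classic.
    rewrite im; apply/seteqP; split=> [_ [[s hs' <-]|->]|_ [s [hs'|->] <-]].
    - by exists s => //; left.
    - by exists z => //; right.
    - by left; exists s.
    - by right.
  apply: pconn_curve; first exact: (ccurve_continuous G).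
  move=> s t w hs1 ht /andP[w0 w1].
  have inI s' : I01o s' \/ s' = z -> 0 <= s' <= 1.
    by case=> [/andP[? ?]|->] //; rewrite !ltW.
  have [Is It] := (inI _ hs1, inI _ ht).
  case: hs1 ht => [/andP[s0 s1]|->] [/andP[t0 t1]|->].
  - by left; apply/andP; split; have [h|h] := leP w (1 / 2); nra.
  - have [->|w1'] := eqVneq w 1; first by right; rewrite mul1r subrKC.
    left; have w1'' : w < 1 by rewrite lt_neqAle w1'.
    by apply/andP; split; nra.
  - have [->|w0'] := eqVneq w 0; first by right; rewrite mul0r addr0.
    left; have w0'' : 0 < w by rewrite lt_neqAle eq_sym w0'.
    by apply/andP; split; nra.
  - by right; rewrite subrr mulr0 addr0.
have dis i j i' j' q : good i j -> good i' j' -> i != i' -> j != j' ->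
    Eij i j q -> Eij i' j' q -> False.
  move=> g1 g2 ii jj.
  have [k1 k2 k3 k4] := hs i j i' j' g1 g2 ii jj.
  have [_ k5 _ _] := hs i' j' i j g2 g1 ltac:(by rewrite eq_sym) ltac:(by rewrite eq_sym).
  have nov c w : edge_int curve c (pos w) -> False.
    by case: G => _ [_ [_ [_ [h _]]]]; apply: h.
  move=> [q1|[q1|->]] [q2|[q2|e2]].
  - exact: int_disjoint k1 q1 q2.
  - exact: int_disjoint k2 q1 q2.
  - by rewrite e2 in q1; apply: nov q1.
  - exact: int_disjoint k5 q2 q1.
  - exact: int_disjoint k3 q1 q2.
  - by rewrite e2 in q1; apply: nov q1.
  - exact: nov q2.
  - exact: nov q2.
  - by move: k4; rewrite (pos_inj G e2) eqxx.
have tr : thin R [set: X] r.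
  split; first by case=> i [].
    by case.
  exists p, E; split.
    by case=> i [] j _ _ //= h; have [? ? ?] := pc _ _ h.
  case=> x [] y [] z [] w // _ _ _ _ g1 g2 h1 h2 h3 h4 q; exact: dis.
have := thin_bound tr; rewrite cardsT card_sum.
set D := [set ij | _]; have : (2 * #|D| <= arcs_in [set: X] r)%N.
  rewrite -card_dbl.
  apply: (arcs_ge (f := fun t : (I * J) * bool =>
    if t.2 then (inl t.1.1 : X, inr t.1.2 : X) else (inr t.1.2 : X, inl t.1.1 : X))).
    by move=> [[i j] []] [[i' j'] []] _ _ //= [] -> ->.
  by move=> [[i j] b]; rewrite !inE /= => g; case: b.
by lia.
Qed.
End ThinBounds.

(** * Families without k pairwise crossing edges *)

Section Marginals.
Variables (K : numFieldType) (I A : finType).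
Hypothesis A0 : (0 < #|A|)%N.

(** Independence of the coordinates of a uniformly random tuple, in unnormalised form; [marg1] and
    [marg2] are the expectations of functions of one and of two coordinates. *)
Lemma card_coords (D : {set I}) (c : I -> A) :
  \sum_(x : {ffun I -> A}) [forall i in D, x i == c i]%:R = #|A|%:R ^+ #|I| / #|A|%:R ^+ #|D| :> K.
Proof.
have AK : #|A|%:R != 0 :> K by rewrite pnatr_eq0 -lt0n.
pose F i (a : A) : K := if i \in D then (a == c i)%:R else 1.
transitivity (\sum_(x : {ffun I -> A}) \prod_i F i (x i)).
  apply: eq_bigr => x _; case: (boolP [forall i in D, _]) => h.
    rewrite big1 // => i _; rewrite /F; case: ifP => // iD.
    by rewrite (forall_inP h).
  have [i iD ne] : exists2 i, i \in D & x i != c i.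
    by move: h; rewrite negb_forall_in => /exists_inP.
  by rewrite (bigD1 i) //= /F iD (negbTE ne) mul0r.
rewrite -bigA_distr_bigA /= (bigID (mem D)) /= big1 ?mul1r; last first.
  move=> i iD; rewrite (bigD1 (c i)) //= /F iD eqxx big1 ?addr0 // => a /negbTE ne.
  by rewrite ne.
rewrite (eq_bigr (fun=> #|A|%:R)); last first.
  by move=> i /negbTE iD; rewrite /F iD sumr_const.
rewrite prodr_const; apply: (mulIf (expf_neq0 #|D| AK)); rewrite divfK ?expf_neq0 // -exprD.
by congr (_ ^+ _); rewrite addnC -(cardC (mem D)); congr (_ + _)%N; apply: eq_card => i; rewrite !inE.
Qed.

Lemma marg1 (i : I) (F : A -> K) :
  \sum_(x : {ffun I -> A}) F (x i) = #|A|%:R ^+ #|I| / #|A|%:R * \sum_a F a.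
Proof.
transitivity (\sum_(x : {ffun I -> A}) \sum_a [forall k in [set i], x k == a]%:R * F a).
  apply: eq_bigr => x _; rewrite (bigD1 (x i)) //= big1 ?addr0.
    by rewrite (_ : [forall k in [set i], _]) ?mul1r //; apply/forall_inP => k; rewrite inE => /eqP ->.
  move=> a ne; rewrite (_ : [forall k in [set i], _] = false) ?mul0r //.
  by apply/negbTE/forall_inPn; exists i; rewrite ?inE // eq_sym.
rewrite exchange_big /= mulr_sumr; apply: eq_bigr => a _.
by rewrite -mulr_suml (@card_coords [set i] (fun=> a)) cards1 expr1.
Qed.

Lemma marg2 (i k : I) (F : A -> A -> K) : i != k ->
  \sum_(x : {ffun I -> A}) F (x i) (x k) =
  #|A|%:R ^+ #|I| / #|A|%:R ^+ 2 * \sum_a \sum_b F a b.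
Proof.
move=> ik; have ki : (k == i) = false by rewrite eq_sym (negbTE ik).
pose c a b j : A := if j == i then a else b.
transitivity (\sum_(x : {ffun I -> A}) \sum_a \sum_b
    [forall j in [set i; k], x j == c a b j]%:R * F a b).
  apply: eq_bigr => x _; rewrite (bigD1 (x i)) //= (bigD1 (x k)) //= !big1 ?addr0.
  - rewrite (_ : [forall j in [set i; k], _]) ?mul1r //; apply/forall_inP => j.
    by rewrite !inE /c => /orP[] /eqP ->; rewrite ?eqxx ?ki.
  - move=> a ne; rewrite big1 // => b _; rewrite (_ : [forall j in [set i; k], _] = false) ?mul0r //.
    by apply/negbTE/forall_inPn; exists i; rewrite ?inE ?eqxx // /c eqxx eq_sym.
  - move=> b ne; rewrite (_ : [forall j in [set i; k], _] = false) ?mul0r //.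
    by apply/negbTE/forall_inPn; exists k; rewrite ?inE ?eqxx ?orbT // /c ki eq_sym.
rewrite exchange_big /= mulr_sumr; apply: eq_bigr => a _.
rewrite exchange_big /= mulr_sumr; apply: eq_bigr => b _.
by rewrite -mulr_suml (card_coords [set i; k] (c a b)) cards2 ik.
Qed.
End Marginals.

Section Sampling.
Variables (A B : finType) (rho : nat).
Variables (arc : A -> B -> bool) (b1 : A -> B -> A -> bool) (b2 : A -> B -> B -> bool).
Variable (b3 : A -> B -> A -> B -> bool).
Variables (M Q N be1 be2 be3 g : nat).
Local Notation I := 'I_rho.

(** A sampled arc without conflict: [b1] is a conflict with another sampled element of [A], [b2]
    with another one of [B], and [b3] with another pair. *)
Definition good_arc (x : I -> A) (z : I -> B) (i j : I) :=
  [&& arc (x i) (z j),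
      [forall i', (i' != i) ==> ~~ b1 (x i) (z j) (x i')],
      [forall j', (j' != j) ==> ~~ b2 (x i) (z j) (z j')] &
      [forall i', forall j', (i' != i) && (j' != j) ==> ~~ b3 (x i) (z j) (x i') (z j')]].

Lemma good_arcP (x : I -> A) (z : I -> B) i j :
  (arc (x i) (z j) <= good_arc x z i j +
   \sum_(i' | i' != i) (arc (x i) (z j) && b1 (x i) (z j) (x i')) +
   \sum_(j' | j' != j) (arc (x i) (z j) && b2 (x i) (z j) (z j')) +
   \sum_(i' | i' != i) \sum_(j' | j' != j) (arc (x i) (z j) && b3 (x i) (z j) (x i') (z j')))%N.
Proof.
rewrite /good_arc; case a : (arc _ _) => //=.
case h1: [forall i', _] => /=; last first.
  move/negbT: h1; rewrite negb_forall => /existsP [i']; rewrite negb_imply negbK => /andP[ne h].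
  by rewrite (bigD1 i') //= h; lia.
case h2: [forall j', _] => /=; last first.
  move/negbT: h2; rewrite negb_forall => /existsP [j']; rewrite negb_imply negbK => /andP[ne h].
  by rewrite [X in (_ + _ + X + _)%N](bigD1 j') //= h; lia.
case h3: [forall i', _] => //=.
move/negbT: h3; rewrite negb_forall => /existsP [i']; rewrite negb_forall => /existsP [j'].
rewrite negb_imply negbK => /andP[/andP[ni nj] h].
apply: leq_trans (leq_addl _ _); rewrite (bigD1 i') //= (bigD1 j') //= h.
by rewrite !addSn.
Qed.

Hypotheses (cA : #|A| = M) (cB : #|B| = Q) (M0 : (0 < M)%N) (Q0 : (0 < Q)%N).
Hypothesis cN : (N <= \sum_a \sum_b arc a b)%N.
Hypothesis hb1 : forall a b, arc a b -> (\sum_a' b1 a b a' <= be1)%N.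
Hypothesis hb2 : forall a b, arc a b -> (\sum_b' b2 a b b' <= be2)%N.
Hypothesis hb3 : forall a b, arc a b -> (\sum_a' \sum_b' b3 a b a' b' <= be3)%N.
Hypotheses (h1 : (6 * rho * be1 <= M)%N) (h2 : (6 * rho * be2 <= Q)%N).
Hypothesis h3 : (6 * (rho * rho) * be3 <= M * Q)%N.
Hypothesis hg : forall (x : {ffun I -> A}) (z : {ffun I -> B}),
  (\sum_i \sum_j good_arc x z i j <= g)%N.

(** By [h1], [h2] and [h3] each kind of conflict spoils on average at most a sixth of the sampled
    arcs. Half of the expected number [rho * rho * N / (M * Q)] survives, and it is at most [g]. *)
Lemma sampling : (rho * rho * N <= 2 * g * M * Q)%N.
Proof.
pose T : rat := M%:R ^+ rho * Q%:R ^+ rho.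
have MR : 0 < M%:R :> rat by rewrite ltr0n. have QR : 0 < Q%:R :> rat by rewrite ltr0n.
have [M1 Q1] : M%:R != 0 :> rat /\ Q%:R != 0 :> rat by rewrite !gt_eqF.
have T0 : 0 < T by rewrite mulr_gt0 // exprn_gt0.
pose n := (\sum_a \sum_b arc a b)%N.
have A0 : (0 < #|A|)%N by rewrite cA. have B0 : (0 < #|B|)%N by rewrite cB.
pose Ex (F : {ffun I -> A} -> {ffun I -> B} -> rat) := \sum_x \sum_z F x z.
have m11 i j (F : A -> B -> rat) : Ex (fun x z => F (x i) (z j)) =
    T / (M%:R * Q%:R) * \sum_a \sum_b F a b.
  rewrite /Ex; under eq_bigr do rewrite (marg1 B0 j (F _)) cB card_ord.
  rewrite -mulr_sumr (marg1 A0 i (fun a => \sum_b F a b)) cA card_ord /T.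
  by field; rewrite M1 Q1.
have m21 i i' j (F : A -> B -> A -> rat) : i != i' ->
    Ex (fun x z => F (x i) (z j) (x i')) =
    T / (M%:R ^+ 2 * Q%:R) * \sum_a \sum_b \sum_a' F a b a'.
  move=> ii; rewrite /Ex; under eq_bigr => x _ do
    rewrite (marg1 B0 j (fun b => F (x i) b (x i'))) cB card_ord.
  rewrite -mulr_sumr (marg2 A0 (fun a a' => \sum_b F a b a') ii) cA card_ord /T.
  under [in RHS]eq_bigr do rewrite exchange_big /=.
  by move: (\sum_a _) => S; field; rewrite M1 Q1.
have m12 i j j' (F : A -> B -> B -> rat) : j != j' ->
    Ex (fun x z => F (x i) (z j) (z j')) =
    T / (M%:R * Q%:R ^+ 2) * \sum_a \sum_b \sum_b' F a b b'.
  move=> jj; rewrite /Ex; under eq_bigr => x _ do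
    rewrite (marg2 B0 (fun b b' => F (x i) b b') jj) cB card_ord.
  rewrite -mulr_sumr (marg1 A0 i (fun a => \sum_b \sum_b' F a b b')) cA card_ord /T.
  by move: (\sum_a _) => S; field; rewrite M1 Q1.
have m22 i i' j j' (F : A -> B -> A -> B -> rat) : i != i' -> j != j' ->
    Ex (fun x z => F (x i) (z j) (x i') (z j')) =
    T / (M%:R ^+ 2 * Q%:R ^+ 2) * \sum_a \sum_b \sum_a' \sum_b' F a b a' b'.
  move=> ii jj; rewrite /Ex; under eq_bigr => x _ do
    rewrite (marg2 B0 (fun b b' => F (x i) b (x i') b') jj) cB card_ord.
  rewrite -mulr_sumr (marg2 A0 (fun a a' => \sum_b \sum_b' F a b a' b') ii) cA card_ord /T.
  under [in RHS]eq_bigr do rewrite exchange_big /=.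
  by move: (\sum_a _) => S; field; rewrite M1 Q1.
have ExD F F' : Ex (fun x z => F x z + F' x z) = Ex F + Ex F'.
  by rewrite /Ex -big_split /=; apply: eq_bigr => x _; rewrite -big_split.
have ExS (P : pred I) (F : I -> {ffun I -> A} -> {ffun I -> B} -> rat) :
    Ex (fun x z => \sum_(k | P k) F k x z) = \sum_(k | P k) Ex (F k).
  rewrite /Ex [RHS]exchange_big /=; apply: eq_bigr => x _; by rewrite exchange_big.
have Exle F F' : (forall x z, F x z <= F' x z) -> Ex F <= Ex F'.
  by move=> h; apply: ler_sum => x _; apply: ler_sum => z _; apply: h.
have sumle (P : pred I) (c : rat) : 0 <= c -> \sum_(k | P k) c <= rho%:R * c.
  move=> c0; have -> : rho%:R * c = \sum_(k : I) c by rewrite sumr_const card_ord mulr_natl.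
  by rewrite [leRHS](bigID P) /= lerDl sumr_ge0.
have T1 : 0 <= T by apply: ltW.
have key i j : T * n%:R / (2 * M%:R * Q%:R) <= Ex (fun x z => (good_arc x z i j)%:R).
  pose F1 a b a' : rat := (arc a b && b1 a b a')%:R.
  pose F2 a b b' : rat := (arc a b && b2 a b b')%:R.
  pose F3 a b a' b' : rat := (arc a b && b3 a b a' b')%:R.
  have le0 : Ex (fun x z => (arc (x i) (z j))%:R) <= Ex (fun x z => (good_arc x z i j)%:R +
      \sum_(i' | i' != i) F1 (x i) (z j) (x i') + \sum_(j' | j' != j) F2 (x i) (z j) (z j') +
      \sum_(i' | i' != i) \sum_(j' | j' != j) F3 (x i) (z j) (x i') (z j')).
    apply: Exle => x z; have := good_arcP x z i j; rewrite -(ler_nat rat) !natrD !natr_sum => h.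
    apply: le_trans h _; rewrite lerD2l; apply: ler_sum => i' _; by rewrite natr_sum.
  move: le0; rewrite !ExD !ExS (m11 i j (fun a b => (arc a b)%:R)).
  have nE : \sum_a \sum_b (arc a b)%:R = n%:R :> rat.
    by rewrite /n natr_sum; apply: eq_bigr => a _; rewrite natr_sum.
  rewrite nE.
  have tot (c : A -> B -> rat) be : (forall a b, arc a b -> c a b <= be%:R) ->
      (forall a b, ~~ arc a b -> c a b = 0) -> \sum_a \sum_b c a b <= n%:R * be%:R.
    move=> k1 k2; rewrite -nE mulr_suml; apply: ler_sum => a _; rewrite mulr_suml.
    apply: ler_sum => b _; case: (boolP (arc a b)) => ab; first by rewrite mul1r k1.
    by rewrite mul0r k2.
  have s1 : \sum_(i' | i' != i) Ex (fun x z => F1 (x i) (z j) (x i')) <= T * n%:R / (6 * M%:R * Q%:R).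
    apply: (@le_trans _ _ (\sum_(i' | i' != i) (T / (M%:R ^+ 2 * Q%:R) * (n%:R * be1%:R)))).
      apply: ler_sum => i' ne; rewrite (m21 i i' j F1) 1?eq_sym //.
      rewrite ler_wpM2l ?divr_ge0 ?mulr_ge0 ?exprn_ge0 //.
      apply: tot => a b ab; last by rewrite big1 // => a' _; rewrite /F1 (negbTE ab).
      rewrite /F1 -natr_sum ler_nat ab; exact: hb1.
    apply: le_trans (sumle _ _ _) _; first by rewrite !mulr_ge0 ?invr_ge0 ?mulr_ge0 ?exprn_ge0.
    have -> : rho%:R * (T / (M%:R ^+ 2 * Q%:R) * (n%:R * be1%:R)) =
      (T * n%:R / (6 * M%:R * Q%:R)) * ((6 * rho * be1)%:R / M%:R).
      by rewrite !natrM; field; rewrite M1 Q1.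
    rewrite ler_piMr ?divr_ge0 ?mulr_ge0 //.
    by rewrite ler_pdivrMr // mul1r ler_nat.
  have s2 : \sum_(j' | j' != j) Ex (fun x z => F2 (x i) (z j) (z j')) <= T * n%:R / (6 * M%:R * Q%:R).
    apply: (@le_trans _ _ (\sum_(j' | j' != j) (T / (M%:R * Q%:R ^+ 2) * (n%:R * be2%:R)))).
      apply: ler_sum => j' ne; rewrite (m12 i j j' F2) 1?eq_sym //.
      rewrite ler_wpM2l ?divr_ge0 ?mulr_ge0 ?exprn_ge0 //.
      apply: tot => a b ab; last by rewrite big1 // => a' _; rewrite /F2 (negbTE ab).
      rewrite /F2 -natr_sum ler_nat ab; exact: hb2.
    apply: le_trans (sumle _ _ _) _; first by rewrite !mulr_ge0 ?invr_ge0 ?mulr_ge0 ?exprn_ge0.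
    have -> : rho%:R * (T / (M%:R * Q%:R ^+ 2) * (n%:R * be2%:R)) =
      (T * n%:R / (6 * M%:R * Q%:R)) * ((6 * rho * be2)%:R / Q%:R).
      by rewrite !natrM; field; rewrite M1 Q1.
    rewrite ler_piMr ?divr_ge0 ?mulr_ge0 //.
    by rewrite ler_pdivrMr // mul1r ler_nat.
  have s3 : \sum_(i' | i' != i) Ex (fun x z => \sum_(j' | j' != j) F3 (x i) (z j) (x i') (z j'))
      <= T * n%:R / (6 * M%:R * Q%:R).
    have c0 : 0 <= T / (M%:R ^+ 2 * Q%:R ^+ 2) * (n%:R * be3%:R).
      by rewrite !mulr_ge0 ?invr_ge0 ?mulr_ge0 ?exprn_ge0.
    apply: (@le_trans _ _ (\sum_(i' | i' != i) (rho%:R * (T / (M%:R ^+ 2 * Q%:R ^+ 2) * (n%:R * be3%:R))))).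
      apply: ler_sum => i' ne; rewrite ExS; apply: le_trans (sumle (fun j' => j' != j) _ c0).
      apply: ler_sum => j' ne'; rewrite (m22 i i' j j' F3) 1?eq_sym // 1?eq_sym //.
      rewrite ler_wpM2l ?divr_ge0 ?mulr_ge0 ?exprn_ge0 //.
      apply: tot => a b ab; last first.
        by rewrite big1 // => a' _; rewrite big1 // => b' _; rewrite /F3 (negbTE ab).
      rewrite /F3 ab; under eq_bigr do rewrite -natr_sum.
      rewrite -natr_sum ler_nat; exact: hb3.
    apply: le_trans (sumle _ _ _) _; first by rewrite mulr_ge0.
    have -> : rho%:R * (rho%:R * (T / (M%:R ^+ 2 * Q%:R ^+ 2) * (n%:R * be3%:R))) =
      (T * n%:R / (6 * M%:R * Q%:R)) * ((6 * (rho * rho) * be3)%:R / (M * Q)%:R).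
      by rewrite !natrM; field; rewrite M1 Q1.
    rewrite ler_piMr ?divr_ge0 ?mulr_ge0 //.
    by rewrite ler_pdivrMr ?ltr0n ?muln_gt0 ?M0 // mul1r ler_nat.
  have e6 : T * n%:R / (2 * M%:R * Q%:R) = 3 * (T * n%:R / (6 * M%:R * Q%:R)).
    by field; rewrite M1 Q1.
  have e6' : T / (M%:R * Q%:R) * n%:R = 6 * (T * n%:R / (6 * M%:R * Q%:R)).
    by field; rewrite M1 Q1.
  rewrite e6 e6'; move: s1 s2 s3; move: (T * n%:R / _) => c.
  by move: (Ex _) (\sum_(_ | _) _) (\sum_(_ | _) _) (\sum_(_ | _) _) => u v w t; lra.
have lo : rho%:R * (rho%:R * (T * n%:R / (2 * M%:R * Q%:R))) <= T * g%:R.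
  apply: (@le_trans _ _ (Ex (fun x z => \sum_i \sum_j (good_arc x z i j)%:R))).
    have cst (c : rat) : rho%:R * c = \sum_(k : I) c by rewrite sumr_const card_ord mulr_natl.
    rewrite ExS cst; apply: ler_sum => i _; rewrite ExS cst; apply: ler_sum => j _.
    exact: key.
  apply: (@le_trans _ _ (Ex (fun x z => g%:R))).
    apply: Exle => x z; have := hg x z; rewrite -(ler_nat rat) natr_sum.
    by under eq_bigr do rewrite natr_sum.
  rewrite /Ex !sumr_const !card_ffun cA cB card_ord -(mulr_natr g%:R) -(mulr_natr (_ * _)).
  by rewrite !natrX /T le_eqVlt; apply/orP; left; apply/eqP; ring.
have {}lo : rho%:R * rho%:R * n%:R <= 2 * g%:R * M%:R * Q%:R :> rat.
  have e : rho%:R * (rho%:R * (T * n%:R / (2 * M%:R * Q%:R))) =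
    T * ((rho%:R * rho%:R * n%:R) / (2 * M%:R * Q%:R)) by field; rewrite M1 Q1.
  move: lo; rewrite e ler_pM2l // ler_pdivrMr; first by move=> h; apply: le_trans h _; lra.
  by rewrite !mulr_gt0.
rewrite -(ler_nat rat) !natrM; apply: le_trans lo.
by rewrite ler_wpM2l ?mulr_ge0 // ler_nat.
Qed.
End Sampling.

Section Degrees.
Variables (V Ed : finType) (ends : Ed -> V * V).
Implicit Types (N F : {set Ed}) (U : {set V}).

Definition within F U := forall e, e \in F -> (ends e).1 \in U /\ (ends e).2 \in U.
Definition hdeg N v := #|[set f in N | incident ends f v]|.

Lemma within_sub F F' U : F' \subset F -> within F U -> within F' U.
Proof. by move=> /fintype.subsetP s h e /s /h. Qed.

Lemma incident_le2 f : (\sum_v incident ends f v <= 2)%N.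
Proof.
apply: leq_trans (_ : \sum_v ((v == (ends f).1) + (v == (ends f).2)) <= 2)%N.
  by apply: leq_sum => v _; rewrite /incident ![_ == v]eq_sym; do 2!case: eqP.
by rewrite big_split /= -!big_mkcond !big_pred1_eq.
Qed.

Lemma sum_hdeg N U : (\sum_(v in U) hdeg N v <= 2 * #|N|)%N.
Proof.
apply: leq_trans (_ : \sum_(v in U) \sum_(f in N) incident ends f v <= _)%N.
  apply: leq_sum => v _; rewrite /hdeg -sum1_card [leqRHS]big_mkcond [leqLHS]big_mkcond /=.
  by apply: leq_sum => f _; rewrite inE; case: (f \in N); case: incident.
rewrite exchange_big /= mulnC -sum_nat_const; apply: leq_sum => f _.
apply: leq_trans (incident_le2 f); rewrite [leqRHS](bigID (mem U)) /=; exact: leq_addr.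
Qed.

(** Sparsity, applied to the vertices of degree above [4 * q], whose number times [2 * q] is at most
    [#|N|], shows that they span at most half of the edges. *)
Lemma half_low N U q : within N U ->
  (forall (N' : {set Ed}) (U' : {set V}), N' \subset N -> within N' U' -> (#|N'| <= q * #|U'|)%N) ->
  (#|N| <= 2 * \sum_(v in U | (hdeg N v <= 4 * q)%N) hdeg N v)%N.
Proof.
move=> wN hq; pose U1 := [set v in U | (4 * q < hdeg N v)%N].
pose N1 := [set f in N | ((ends f).1 \in U1) && ((ends f).2 \in U1)].
have h1 : (#|N1| <= q * #|U1|)%N.
  apply: hq; first by apply/fintype.subsetP => f; rewrite inE => /andP[].
  by move=> f; rewrite inE => /and3P[].
have h2 : (4 * q * #|U1| <= 2 * #|N|)%N.
  apply: leq_trans (sum_hdeg N U1); rewrite mulnC -sum_nat_const.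
  by apply: leq_sum => v; rewrite inE => /andP[_ /ltnW].
have h3 : (#|N :\: N1| <= \sum_(v in U | (hdeg N v <= 4 * q)%N) hdeg N v)%N.
  apply: leq_trans (_ : \sum_(v in U | (hdeg N v <= 4 * q)%N) \sum_(f in N) incident ends f v <= _)%N; last first.
    apply: leq_sum => v _; rewrite /hdeg -sum1_card [leqRHS]big_mkcond [leqLHS]big_mkcond /=.
    by apply: leq_sum => f _; rewrite inE; case: (f \in N); case: incident.
  rewrite exchange_big /= -sum1_card [leqRHS](bigID (mem N1)) /=.
  apply: leq_trans (leq_addl _ _); rewrite (eq_bigl (fun f => (f \in N) && (f \notin N1))); last first.
    by move=> f; rewrite inE andbC.
  apply: leq_sum => f /andP[fN]; rewrite inE fN /= negb_and.
  have [u1 u2] := wN f fN; rewrite !inE u1 u2 /= -!leqNgt => /orP[h|h].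
    by rewrite (bigD1 (ends f).1) ?u1 //= /incident eqxx.
  by rewrite (bigD1 (ends f).2) ?u2 //= /incident eqxx orbT.
have : (#|N| = #|N1| + #|N :\: N1|)%N.
  by rewrite -(cardsID N1 N); congr (_ + _)%N; apply: eq_card => f; rewrite !inE; case: (f \in N).
by lia.
Qed.
End Degrees.

Lemma sum_slots (T : eqType) (x0 : T) (L : seq T) (P : pred T) m :
  (\sum_(s < m) ((s < size L)%N && P (nth x0 L s)) <= count P L)%N.
Proof.
elim: L m => [|x L IH] m; first by rewrite big1.
case: m => [|m]; first by rewrite big_ord0.
by rewrite big_ord_recl /=; apply: leq_add => //; apply: IH.
Qed.

Lemma sum_lt_ord m n : (n <= m)%N -> (\sum_(s < m) (s < n) = n)%N.
Proof.
move=> h; rewrite -[RHS]card_ord -sum1_card (big_ord_widen m (fun=> 1%N) h) [RHS]big_mkcond /=.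
by apply: eq_bigr => s _; case: (s < n)%N.
Qed.

Lemma sum_sig (T : finType) (H : {set T}) (P : T -> nat) :
  (\sum_(a : {x | x \in H}) P (val a) = \sum_(x in H) P x)%N.
Proof.
rewrite [RHS](reindex_omap (val : {x | x \in H} -> T) insub) /=.
  by apply: eq_bigl => a; rewrite (valP a) valK eqxx.
by move=> x hx; rewrite insubT.
Qed.

Section DenseClass.
Variable R : realType.
Local Notation pt := (R * R)%type.
Variables (V Ed : finType) (pos : V -> pt) (ends : Ed -> V * V) (curve : Ed -> R -> pt).
Hypothesis G : simple_topgraph pos ends curve.
Local Notation cross := (xcross curve).
Local Notation touch := (touch curve).
Local Notation within := (within ends).

Definition nbs (F : {set Ed}) e := [set f in F | cross e f].

Lemma card_touch (F : {set Ed}) e : (\sum_(f in F) touch e f <= #|nbs F e|.+1)%N.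
Proof.
apply: leq_trans (_ : \sum_(f in F) ((f == e) + cross e f) <= _)%N.
  by apply: leq_sum => f _; rewrite /touch eq_sym; case: eqP; case: (cross e f).
rewrite big_split /= -addn1 addnC; apply: leq_add.
  by rewrite /nbs -sum1_card [leqRHS](eq_bigl (fun f => (f \in F) && cross e f)) ?big_mkcondr // => f; rewrite inE.
apply: leq_trans (_ : \sum_(f | f == e) 1 <= _)%N; last by rewrite big_pred1_eq.
rewrite [leqLHS]big_mkcond [leqRHS]big_mkcond; apply: leq_sum => f _.
by case: (f \in F); case: eqP.
Qed.

Variables (F : {set Ed}) (U : {set V}) (q y : nat).
Hypothesis wF : within F U.
Hypothesis hq : forall e (N' : {set Ed}) (U' : {set V}), e \in F -> N' \subset nbs F e -> within N' U' ->
  (#|N'| <= q * #|U'|)%N.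
Hypotheses (q0 : (0 < q)%N) (yq : (10 ^ 4 * q <= y)%N).
Hypothesis hdeg2 : forall e, e \in F -> (#|nbs F e| <= 2 * y)%N.

Let H := [set e in F | (y <= #|nbs F e|)%N].
(** The edges at [v] that cross [e], listed only if there are few of them; by [half_low] this
    retains a fixed share of the crossings of [e]. *)
Let L e v := if (hdeg ends (nbs F e) v <= 4 * q)%N
  then enum [set f in nbs F e | incident ends f v] else [::].
Let A := {e : Ed | e \in H}.
(** A vertex together with a slot in the lists [L], so that a sampled pair designates one definite
    crossing edge [fe]. *)
Let B := ({v : V | v \in U} * 'I_(4 * q))%type.
Let arc (a : A) (b : B) := (b.2 < size (L (val a) (val b.1)))%N.
Let fe (a : A) (b : B) := nth (val a) (L (val a) (val b.1)) b.2.

Let mem_L e v f : f \in L e v -> [/\ f \in F, cross e f & incident ends f v].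
Proof. by rewrite /L; case: ifP => // _; rewrite mem_enum !inE => /andP[/andP[]]. Qed.

Let arcE a b : arc a b -> [/\ fe a b \in F, cross (val a) (fe a b) & incident ends (fe a b) (val b.1)].
Proof. by move=> h; apply: mem_L; rewrite mem_nth. Qed.

Let HP (a : A) : (val a \in F) && (y <= #|nbs F (val a)|)%N.
Proof. by have := valP a; rewrite inE. Qed.

Let HF (a : A) : val a \in F. Proof. by case/andP: (HP a). Qed.

Let arcs_lb : (#|H| * y <= 2 * \sum_a \sum_b arc a b)%N.
Proof.
have -> : #|H| = #|{: A}| by rewrite card_sig.
rewrite -sum_nat_const big_distrr /=; apply: leq_sum => a _; have /andP[aF ya] := HP a.
apply: leq_trans ya _; have wN : within (nbs F (val a)) U.
  by apply: within_sub wF; apply/fintype.subsetP => f; rewrite inE => /andP[].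
apply: leq_trans (half_low wN (fun N' U' => @hq _ N' U' aF)) _; rewrite leq_pmul2l //.
rewrite -(pair_bigA _ (fun v s => arc a (v, s) : nat)) /arc /=.
rewrite (sum_sig U (fun v => \sum_(s < 4 * q) (s < size (L (val a) v)) : nat)) big_mkcondr /=.
apply: leq_sum => v _; rewrite /L; case: ifP => // h.
by rewrite sum_lt_ord -cardE.
Qed.

(** The three conflicts are what must be absent for the hops of sampled pairs to satisfy the
    separation hypothesis of [hop_bound]. *)
Let b1 (a : A) b (a' : A) := touch (val a) (val a') || touch (fe a b) (val a').
Let b2 (a : A) (b b' : B) := val b.1 == val b'.1.
Let b3 a b a' b' := arc a' b' && touch (fe a b) (fe a' b').

Let b1_le a b : arc a b -> (\sum_a' b1 a b a' <= 4 * y + 2)%N.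
Proof.
move=> h; have [fF _ _] := arcE h.
have t e : e \in F -> (\sum_(a' : A) touch e (val a') <= 2 * y + 1)%N.
  move=> eF; rewrite (sum_sig H (fun x => touch e x : nat)) addn1.
  apply: leq_trans (leq_trans (card_touch F e) (_ : _ <= (2 * y).+1)%N); last by rewrite ltnS hdeg2.
  rewrite [leqLHS]big_mkcond [leqRHS]big_mkcond /=; apply: leq_sum => x _.
  by rewrite inE; case: (x \in F); case: (y <= _)%N.
apply: (@leq_trans (\sum_(a' : A) touch (val a) (val a') + \sum_(a' : A) touch (fe a b) (val a'))%N).
  by rewrite -big_split /=; apply: leq_sum => a' _; rewrite /b1; case: (touch (val a) _); case: touch.
by apply: leq_trans (leq_add (t _ (HF a)) (t _ fF)) _; lia.
Qed.

Let b2_le a b : arc a b -> (\sum_b' b2 a b b' <= 4 * q)%N.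
Proof.
move=> _; rewrite -(pair_bigA _ (fun v s => b2 a b (v, s) : nat)) /b2 /=.
under eq_bigr do rewrite sum_nat_const card_ord.
rewrite -big_distrr /= -[leqRHS]muln1 leq_pmul2l ?muln_gt0 //.
rewrite (sum_sig U (fun v => val b.1 == v : nat)) [leqRHS](_ : _ = \sum_(v | v == val b.1) 1)%N; last first.
  by rewrite big_pred1_eq.
rewrite [leqLHS]big_mkcond [leqRHS]big_mkcond; apply: leq_sum => v _.
by rewrite eq_sym; case: (v \in U); case: eqP.
Qed.

(** At most [2 * y + 1] edges [g] touch [f]; each crosses at most [2 * y] edges and has two ends. *)
Let b3_le a b : arc a b -> (\sum_a' \sum_b' b3 a b a' b' <= 12 * y ^ 2)%N.
Proof.
move=> h; have [fF _ _] := arcE h; set f := fe a b in fF *.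
apply: leq_trans (_ : \sum_(e in F) \sum_v \sum_(g in F)
    (touch f g && (cross g e && incident ends g v)) <= _)%N.
  apply: leq_trans (_ : \sum_(a' : A) \sum_(v : V) \sum_(g in F)
    (touch f g && (cross g (val a') && incident ends g v)) <= _)%N; last first.
    rewrite (sum_sig H (fun e => \sum_v \sum_(g in F) (touch f g && (cross g e && incident ends g v))))%N.
    rewrite [leqLHS]big_mkcond [leqRHS]big_mkcond /=; apply: leq_sum => x _.
    by rewrite inE; case: (x \in F); case: (y <= _)%N.
  apply: leq_sum => a' _; rewrite -(pair_bigA _ (fun v s => b3 a b a' (v, s) : nat)) /b3 /=.
  pose K v := (\sum_(g in F) (touch f g && (cross g (val a') && incident ends g v)))%N.
  apply: leq_trans (_ : \sum_(v in U) K v <= _)%N; last first.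
    by rewrite [leqRHS](bigID (mem U)) /=; apply: leq_addr.
  rewrite -sum_sig; apply: leq_sum => v _.
  apply: leq_trans (sum_slots (val a') (L (val a') (val v)) (touch f) (4 * q)) _.
  rewrite -size_filter -(card_uniqP _) ?filter_uniq //; last first.
    by rewrite /L; case: ifP => // _; apply: enum_uniq.
  rewrite -sum1_card /K [leqLHS]big_mkcond [leqRHS]big_mkcond; apply: leq_sum => g _.
  by rewrite mem_filter; case t: (touch f g) => //=; case: ifP => // /mem_L [-> c ->]; rewrite crossC c.
apply: leq_trans (_ : \sum_(g in F) (touch f g * (2 * (2 * y))) <= _)%N; last first.
  rewrite -big_distrl /=.
  have := leq_trans (card_touch F f) (_ : _ <= (2 * y).+1)%N.
  by rewrite ltnS hdeg2 // => /(_ isT); nia.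
under eq_bigr do rewrite exchange_big /=.
rewrite exchange_big /=; apply: leq_sum => g gF; case: (touch f g); last first.
  by rewrite mul0n big1 // => ? _; rewrite big1.
rewrite mul1n mulnC; apply: leq_trans (_ : \sum_(e in F) cross g e * 2 <= _)%N.
  apply: leq_sum => e _; case: (cross g e); rewrite ?mul1n ?incident_le2 //.
  by rewrite big1.
rewrite -big_distrl /= leq_pmul2r //; apply: leq_trans (hdeg2 gF).
rewrite /nbs -sum1_card [leqLHS]big_mkcond [leqRHS]big_mkcond; apply: leq_sum => e _.
by rewrite inE; case: (e \in F); case: (cross g e).
Qed.

Let good_le rho (x : {ffun 'I_rho -> A}) (z : {ffun 'I_rho -> B}) :
  (\sum_i \sum_j good_arc arc b1 b2 b3 x z i j <= 30 * rho)%N.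
Proof.
pose good i j := good_arc arc b1 b2 b3 x z i j.
have := @hop_bound R V Ed pos ends curve G 'I_rho 'I_rho (fun i => val (x i)) (fun j => val (z j).1)
  (fun i j => fe (x i) (z j)) good.
have -> : #|[set ij : 'I_rho * 'I_rho | good ij.1 ij.2]| = (\sum_i \sum_j good i j)%N.
  rewrite pair_bigA /= -sum1_card big_mkcond /=; apply: eq_bigr => ij _.
  by rewrite inE; case: good.
rewrite !card_ord => h; apply: leq_trans (h _ _) _; last by lia.
  by move=> i j /and4P[/arcE [_ c iv] _ _ _].
move=> i j i' j' /and4P[a1 /forallP u1 /forallP u2 /forallP u3].
move=> /and4P[a1' /forallP u1' /forallP u2' /forallP u3'] ni nj.
have ni' : i' != i by rewrite eq_sym.
have nj' : j' != j by rewrite eq_sym.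
have := u1 i'; rewrite ni' /= /b1 negb_or => /andP[t1 _].
have := u1' i; rewrite ni /= /b1 negb_or => /andP[_ t2].
have := u2 j'; rewrite nj' /= /b2 => t3.
have := u3 i' => /forallP /(_ j'); rewrite ni' nj' /= /b3 a1' /= => t4.
by split => //; rewrite touchC.
Qed.

(** [hop_bound] allows only linearly many conflict-free sampled arcs, whereas [sampling] produces
    more than that if [H] is large. The factor [10 ^ 7] serves the conflicts [b3]: it exceeds 72 *
    481^2 / 4. *)
Lemma dense_class : (#|H| <= 10 ^ 7 * q * #|U|)%N.
Proof.
rewrite leqNgt; apply/negP => hM.
have M0 : (0 < #|H|)%N by lia.
have [e eH] : exists e, e \in H by apply/set0Pn; rewrite -card_gt0.
have yn : (y <= q * #|U|)%N.
  have /andP[eF ye] : (e \in F) && (y <= #|nbs F e|)%N by have := eH; rewrite inE.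
  apply: leq_trans ye _; apply: (hq eF) => //.
  by apply: within_sub wF; apply/fintype.subsetP => f; rewrite inE => /andP[].
have n0 : (10 ^ 4 <= #|U|)%N by nia.
(* With [30 * rho] good arcs, [4 * q * n] slots and at least [#|H| * y / 2] arcs, [sampling] would
   give [rho * y <= 480 * q * n], as 480 = 2 * 2 * 30 * 4; [rho] is the least integer violating
   this. *)
pose n := #|U|; pose rho := ((480 * q * n) %/ y).+1.
have y0 : (0 < y)%N by lia.
have r1 : (480 * q * n < rho * y)%N by rewrite -ltn_divLR.
have r2 : (rho * y <= 481 * q * n)%N.
  rewrite mulSn; have := leq_trunc_div (480 * q * n) y; rewrite -/n in yn; lia.
have := @sampling A B rho arc b1 b2 b3 #|H| (4 * q * n)%N (\sum_a \sum_b arc a b)%N (4 * y + 2)%N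
  (4 * q)%N (12 * y ^ 2)%N (30 * rho)%N.
rewrite card_prod card_ord !card_sig => sp.
have {sp} := sp erefl _ M0 _ (leqnn _) b1_le b2_le b3_le _ _ _ (@good_le rho).
have -> : (#|U| * (4 * q) = 4 * q * n)%N by rewrite mulnC.
have -> : (0 < 4 * q * n)%N by rewrite !muln_gt0 q0 /=; lia.
move=> /(_ erefl isT); have := arcs_lb; set N := (\sum_a _)%N => hN sp.
have {sp} : (rho * rho * N <= 2 * (30 * rho) * #|H| * (4 * q * n))%N.
  rewrite -/n in hM; apply: sp.
  - apply: leq_trans (ltnW hM); rewrite -/n.
    have : (6 * rho * (4 * y + 2) <= 36 * (rho * y))%N by nia.

    by nia.
  - nia.
  - nia.
move=> sp; have : (rho * #|H| * (rho * y) <= rho * #|H| * (480 * q * n))%N.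
  apply: (@leq_trans (rho * rho * (2 * N))%N); last by lia.
  have -> : (rho * #|H| * (rho * y) = rho * rho * (#|H| * y))%N by rewrite mulnACA.
  exact: leq_mul.
by rewrite leq_pmul2l ?muln_gt0 ?M0 // leqNgt r1.
Qed.
End DenseClass.

Section QuasiPlanar.
Variable R : realType.
Local Notation pt := (R * R)%type.
Variables (V Ed : finType) (pos : V -> pt) (ends : Ed -> V * V) (curve : Ed -> R -> pt).
Hypothesis G : simple_topgraph pos ends curve.
Local Notation cross := (xcross curve).
Local Notation nbs := (nbs curve).
Local Notation within := (within ends).

Definition clique_free m (F : {set Ed}) :=
  forall C : {set Ed}, C \subset F -> #|C| = m -> clique cross C -> False.

(** A maximal non-crossing subset has linear size, and by maximality every edge is touched by one of
    its members, each of which touches at most [d.+1] edges. *)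
Lemma low_degree_bound (F : {set Ed}) U d : within F U ->
  (forall e, e \in F -> (#|nbs F e| <= d)%N) -> (#|F| <= d.+1 * (15 * #|U|))%N.
Proof.
move=> wF hd.
pose ind (I : {set Ed}) := (I \subset F) && [forall e in I, forall f in I, ~~ cross e f].
have ind0 : ind finset.set0.
  by rewrite /ind finset.sub0set; apply/forall_inP => e; rewrite inE.
have [I /maxsetP [/andP[sI /forall_inP nI] mI] _] := maxset_exists ind0.
have {}nI e f : e \in I -> f \in I -> ~~ cross e f.
  by move=> /nI /forall_inP h /h.
have dom f : f \in F -> exists2 i, i \in I & touch curve i f.
  move=> fF; case: (boolP [exists i in I, touch curve i f]) => [/exists_inP //|].
  rewrite negb_exists_in => /forall_inP h.
  have fI : f \in f |: I by rewrite !inE eqxx.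
  have e : f |: I = I; last by have := h f; rewrite -e fI => /(_ isT); rewrite /touch eqxx.
  apply: mI; last exact: finset.subsetUr.
  rewrite /ind finset.subUset finset.sub1set fF sI; apply/forall_inP => x hx; apply/forall_inP => z.
  have nf i : i \in I -> ~~ cross i f by move=> /h; rewrite negb_or => /andP[].
  have ff : ~~ cross f f by rewrite /xcross eqxx.
  move: hx; rewrite !inE => /orP[/eqP ->|xI] /orP[/eqP ->|zI] //.
  - by rewrite crossC nf.
  - exact: nf.
  - exact: nI.
have bI : (#|I| <= 15 * #|U|)%N.
  by apply: (noncross_bound G) => // e eI; apply: wF; apply: (fintype.subsetP sI).
apply: leq_trans (leq_mul (leqnn _) bI); rewrite -sum1_card.
apply: leq_trans (_ : \sum_(f in F) \sum_(i in I) touch curve i f <= _)%N.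
  by apply: leq_sum => f /dom [i iI t]; rewrite (bigD1 i) //= t.
rewrite exchange_big mulnC -sum_nat_const; apply: leq_sum => i iI.
by apply: leq_trans (card_touch _ F i) _; rewrite ltnS hd // (fintype.subsetP sI).
Qed.

(** The edges in the upper dyadic range of crossing degrees are removed by [dense_class]; degrees
    only drop afterwards. After [t] rounds [low_degree_bound] takes the rest. *)
Lemma degree_classes (U : {set V}) q t (F : {set Ed}) : (0 < q)%N -> within F U ->
  (forall e (N' : {set Ed}) (U' : {set V}), e \in F -> N' \subset nbs F e -> within N' U' ->
     (#|N'| <= q * #|U'|)%N) ->
  (forall e, e \in F -> (#|nbs F e| <= 10 ^ 4 * q * 2 ^ t)%N) ->
  (#|F| <= t * (10 ^ 7 * q * #|U|) + (10 ^ 4 * q).+1 * (15 * #|U|))%N.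
Proof.
move=> q0; elim: t F => [|t IH] F wF hq hd.
  by rewrite mul0n add0n; apply: low_degree_bound => // e /hd; rewrite muln1.
pose y := (10 ^ 4 * q * 2 ^ t)%N; pose H := [set e in F | (y <= #|nbs F e|)%N].
have HH : (#|H| <= 10 ^ 7 * q * #|U|)%N.
  apply: (dense_class G) => //; first by rewrite leq_pmulr // expn_gt0.
  by move=> e /hd; rewrite /y (expnS 2) mulnCA.
have sF : F :\: H \subset F by apply: finset.subsetDl.
have sN e : nbs (F :\: H) e \subset nbs F e.
  by apply/fintype.subsetP => f; rewrite !inE => /andP[/andP[_ ->]].
have := IH (F :\: H) (within_sub sF wF) _ _.
have -> : #|F| = (#|H| + #|F :\: H|)%N.
  by rewrite -(cardsID H F); congr (_ + _)%N; apply: eq_card => f; rewrite !inE; case: (f \in F).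
move=> h; have {h} : (#|F :\: H| <= t * (10 ^ 7 * q * #|U|) + (10 ^ 4 * q).+1 * (15 * #|U|))%N.
  apply: h => [e N' U' eF hN|e].
    by apply: hq (fintype.subset_trans hN (sN e)); apply: (fintype.subsetP sF).
  rewrite !inE negb_and -ltnNge => /andP[/orP[/negP //|lt] eF].
  by apply: leq_trans (subset_leq_card (sN e)) (ltnW _).
by move=> h; rewrite (mulSn t) -addnA; apply: leq_add HH h.
Qed.

(** Adding [e] to a clique among the edges crossing [e] enlarges it, so these edges are sparse by
    induction, with constant [q]. All degrees are then at most [q * 2 ^ lam], and each induction
    step costs a factor proportional to the number [lam] of dyadic classes. *)
Lemma quasi_bound lam m (F : {set Ed}) (U : {set V}) : (0 < lam)%N -> (#|V| <= 2 ^ lam)%N ->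
  within F U -> clique_free m.+2 F -> (#|F| <= 15 * (2 * 10 ^ 7 * lam) ^ m * #|U|)%N.
Proof.
move=> l0 hV; elim: m F U => [|m IH] F U wF cf.
  rewrite muln1; apply: (noncross_bound G) => // e f eF fF; apply/negP => c.
  have ef : e != f by case/andP: c.
  apply: (cf [set e; f]); rewrite ?cards2 ?ef //.
    by apply/fintype.subsetP => x; rewrite !inE => /orP[]/eqP->.
  move=> x z; rewrite !inE => /orP[]/eqP-> /orP[]/eqP->; rewrite ?eqxx //.
  by rewrite crossC.
set q := (15 * (2 * 10 ^ 7 * lam) ^ m)%N in IH *.
have q0 : (0 < q)%N by rewrite muln_gt0 expn_gt0 /= !muln_gt0 l0.
have hq e (N' : {set Ed}) (U' : {set V}) : e \in F -> N' \subset nbs F e -> within N' U' ->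
    (#|N'| <= q * #|U'|)%N.
  move=> eF sN wN; apply: IH => // C sC cC kC.
  have ce f : f \in C -> (f \in F) && cross e f.
    by move=> fC; have := fintype.subsetP (fintype.subset_trans sC sN) f fC; rewrite inE.
  have eC : e \notin C by apply/negP => /ce; rewrite /xcross eqxx andbF.
  apply: (cf (e |: C)); rewrite ?cardsU1 ?eC ?cC //.
    by rewrite finset.subUset finset.sub1set eF; apply/fintype.subsetP => f /ce /andP[].
  move=> x z; rewrite !inE => /orP[/eqP->|xC] /orP[/eqP->|zC]; rewrite ?eqxx // => xz.
  - by case/andP: (ce z zC).
  - by rewrite crossC; case/andP: (ce x xC).
  - exact: kC.
have := degree_classes (t := lam) q0 wF hq.
have -> : (15 * (2 * 10 ^ 7 * lam) ^ m.+1 = q * (2 * 10 ^ 7 * lam))%N.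
  by rewrite expnS /q; ring.
move=> h; have {h} : (#|F| <= lam * (10 ^ 7 * q * #|U|) + (10 ^ 4 * q).+1 * (15 * #|U|))%N.
  apply: h => e eF; apply: (@leq_trans (q * 2 ^ lam)%N); last first.
    by rewrite leq_mul2r leq_pmull ?orbT.
  apply: leq_trans (leq_mul (leqnn q) hV).
  apply: leq_trans (hq e _ U eF _ _) _ => //; last by rewrite leq_mul2l max_card orbT.
  by apply: within_sub wF; apply/fintype.subsetP => f; rewrite inE => /andP[].
have e1 : (lam * (10 ^ 7 * q * #|U|) = 10 ^ 7 * (lam * (q * #|U|)))%N by ring.
have e2 : (q * (2 * 10 ^ 7 * lam) * #|U| = 2 * 10 ^ 7 * (lam * (q * #|U|)))%N by ring.
have e3 : ((10 ^ 4 * q).+1 * (15 * #|U|) = 15 * 10 ^ 4 * (q * #|U|) + 15 * #|U|)%N by rewrite -addn1; ring.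
have e4 : (#|U| <= q * #|U|)%N by rewrite leq_pmull.
have e5 : (q * #|U| <= lam * (q * #|U|))%N by rewrite leq_pmull.
by rewrite e1 e2 e3 => h; clear -h e4 e5; lia.
Qed.
End QuasiPlanar.

(** * Short walks in minimal dense vertex sets *)

Section Growth.
Variable R : realType.
Implicit Types n u w x t : R.

Lemma ln_le_sub1 x : 0 < x -> ln x <= x - 1.
Proof. by move=> x0; have := @le_ln1Dx R (x - 1); rewrite subrKC; apply; lra. Qed.

Lemma ln_ge_half x : 2 <= x -> 1 / 2 <= ln x.
Proof.
move=> x2; have x0 : 0 < x by lra.
have := ln_le_sub1 (x := x^-1); rewrite invr_gt0 lnV ?posrE // => /(_ x0).
suff : x^-1 <= 1 / 2 by lra.
by rewrite div1r lef_pV2 ?posrE.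
Qed.

Lemma ln1D_ge t : 0 <= t <= 1 -> t / 2 <= ln (1 + t).
Proof.
move=> /andP[t0 t1]; have p : 0 < 1 + t by lra.
have := ln_le_sub1 (x := (1 + t)^-1); rewrite invr_gt0 lnV ?posrE // => /(_ p).
suff : t / 2 <= 1 - (1 + t)^-1 by lra.
have -> : 1 - (1 + t)^-1 = t / (1 + t) by field; rewrite gt_eqF.
by rewrite ler_wpM2l // lef_pV2 ?posrE //; lra.
Qed.

(** The function u ln(n/u) increases only up to n/e; the factor 2 covers the remaining range up to
    n/2. *)
Lemma ulnu_mono n u w : 0 < w -> w <= u -> u <= n / 2 ->
  w * ln (n / w) <= 2 * (u * ln (n / u)).
Proof.
move=> w0 wu un; have u0 : 0 < u by lra.
have n0 : 0 < n by lra.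
have e : ln (n / w) = ln (n / u) + ln (u / w).
  rewrite -lnM ?posrE ?divr_gt0 //; congr ln; field.
  by rewrite !gt_eqF.
have l : 1 / 2 <= ln (n / u) by apply: ln_ge_half; rewrite ler_pdivlMr //; lra.
have l2 : w * ln (u / w) <= u - w.
  have := ln_le_sub1 (x := u / w); rewrite divr_gt0 // => /(_ isT) h.
  apply: le_trans (ler_wpM2l (ltW w0) h) _.
  by rewrite mulrBr mulr1 mulrC divfK ?gt_eqF.
rewrite e mulrDr; move: (ln (n / u)) l => a l; nra.
Qed.

Lemma bernoulli2 k t : 0 <= t ->
1 + k%:R * t + k%:R * (k%:R - 1) / 2 * t ^+ 2 <= (1 + t) ^+ k.
Proof.
move=> t0.
elim: k => [|k IH]; first by rewrite !mul0r !addr0 expr0.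
rewrite [(1 + t) ^+ k.+1]exprSr; apply: (@le_trans _ _ ((1 + k%:R * t + k%:R * (k%:R - 1) / 2 * t ^+ 2) * (1 + t))); last first.
  by rewrite ler_wpM2r //; lra.
rewrite -[k.+1]addn1 natrD.
have : 0 <= k%:R * (k%:R - 1) :> R.
  case: (k) => [|k']; first by rewrite mul0r.
  by rewrite -addn1 natrD addrK mulr_ge0 // addr_ge0.
move: (k%:R) => z hz.
rewrite -subr_ge0 [leRHS](_ : _ = z * (z - 1) * (t ^+ 3 / 2)); last by field.
by rewrite mulr_ge0 // divr_ge0 // exprn_ge0.
Qed.

(** The quantity [x j], the logarithm of [n / w j], shrinks by a factor [1 - t] in each step but
    stays at least 1/2. So [(1 + t) ^+ i <= 2 * L], and the quadratic term of the binomial expansion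
    already bounds [i]; the slightly sharper bound of order L ln L is not pursued. *)
Lemma growth n (u w : nat -> R) i : 1 <= n ->
  (forall j, (j <= i.+1)%N -> u j <= n / 2) ->
  (forall j, (j <= i.+1)%N -> w j <= u j) -> 3 / 4 <= w 1%N ->
  (forall j, (0 < j <= i)%N -> w j + u j * (ln (n / u j) - 1 / 4) / (1 + ln n) <= w j.+1) ->
  i%:R ^+ 2 < 256 * (1 + ln n) ^+ 3.
Proof.
move=> n1 hu hw w1 hs; rewrite ltNge; apply/negP => hi.
have n0 : 0 < n by lra.
have L1 : 1 <= 1 + ln n by rewrite lerDl ln_ge0.
set L := 1 + ln n in L1 hs hi *; have L0 : 0 < L by lra.
(* The 8 collects three factors 2: [ln (n / U) - 1 / 4] is at least half of the logarithm,
   [ulnu_mono] loses a factor 2, and so does the logarithm of [1 + s]. *)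
pose t := 1 / (8 * L); have t0 : 0 < t by rewrite divr_gt0 // mulr_gt0.
have t1 : t <= 1 / 8 by rewrite /t ler_pdivrMr ?mulr_gt0 //; nra.
pose x j := ln (n / w j).
have main j : (j <= i)%N -> [/\ 3 / 4 <= w j.+1, x j.+1 <= L & x j.+1 <= L * (1 - t) ^+ j].
  elim: j => [|j IH] ji.
    have h : x 1%N <= L.
      rewrite /x lnM ?posrE ?invr_gt0 ?lnV ?posrE //; try lra.
      suff : - ln (w 1%N) <= 1 / 3 by rewrite /L; lra.
      rewrite -lnV ?posrE; last lra.
      have := ln_le_sub1 (x := (w 1%N)^-1); rewrite invr_gt0 => h.
      apply: le_trans (h _) _; first lra.
      suff : (w 1%N)^-1 <= 4 / 3 by lra.
      by rewrite -[4 / 3]invf_div lef_pV2 ?posrE //; lra.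
    by rewrite expr0 mulr1; split.
  have [wj xj1 xj2] := IH (ltnW ji).
  have wu := hw j.+1 (leqW ji); have un := hu j.+1 (leqW ji).
  set W := w j.+1 in wj wu xj1 xj2; set U := u j.+1 in wu un.
  have W0 : 0 < W by lra. have U0 : 0 < U by lra.
  have l : 1 / 2 <= ln (n / U) by apply: ln_ge_half; rewrite ler_pdivlMr //; lra.
  have st := hs j.+1 ji; rewrite -/W -/U in st.
  have mo := ulnu_mono W0 wu un; rewrite -/(x j.+1) in mo; set X := x j.+1 in mo xj1 xj2.
  have X0 : 1 / 2 <= X by apply: ln_ge_half; rewrite -/W ler_pdivlMr //; lra.
  pose s := X / (4 * L).
  have s01 : 0 <= s <= 1.
    rewrite /s divr_ge0 ?mulr_ge0 ?ler_pdivrMr ?mulr_gt0 //; lra.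
  have st2 : W * (1 + s) <= w j.+2.
    apply: le_trans st; rewrite mulrDr mulr1 lerD2l /s.
    rewrite [leLHS](_ : _ = (W * X) / 4 / L); last by field; rewrite gt_eqF.
    rewrite ler_pM2r ?invr_gt0 //; move: (ln (n / U)) l mo => a l mo; nra.
  have s0 : 0 <= s by case/andP: s01.
  have W1 : 0 < W * (1 + s) by rewrite mulr_gt0 //; lra.
  have x2 : x j.+2 <= X - ln (1 + s).
    rewrite /x /X /x -/W.
    have -> : ln (n / W) - ln (1 + s) = ln (n / (W * (1 + s))).
      rewrite invfM mulrA [in RHS]lnM ?posrE ?divr_gt0 ?invr_gt0 ?lnV ?posrE //; lra.
    rewrite ler_ln ?posrE ?divr_gt0 //; last lra.
    by rewrite ler_wpM2l ?(ltW n0) // lef_pV2 ?posrE //; lra.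
  have x3 : x j.+2 <= X * (1 - t).
    apply: le_trans x2 _; have := ln1D_ge s01.
    have -> : s / 2 = X * t by rewrite /s /t; field; rewrite gt_eqF.
    by lra.
  split; first nra.
    by apply: le_trans x3 _; nra.
  apply: le_trans x3 _; rewrite exprSr mulrA ler_wpM2r //; lra.
have [wi _ xi] := main i (leqnn _).
have X0 : 1 / 2 <= x i.+1.
  have := hw _ (leqnn i.+1); have := hu _ (leqnn i.+1) => h1 h2.
  by apply: ln_ge_half; rewrite ler_pdivlMr; lra.
have key := bernoulli2 i (ltW t0).
have p : (1 - t) ^+ i * (1 + t) ^+ i <= 1.
  rewrite -exprMn exprn_ile1 //; nra.
have q : (1 + t) ^+ i <= 2 * L.
  have p0 : 0 < (1 + t) ^+ i by rewrite exprn_gt0 //; lra.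
  have : 1 / 2 * (1 + t) ^+ i <= L * (1 - t) ^+ i * (1 + t) ^+ i by rewrite ler_pM2r //; lra.
  by rewrite -mulrA => h; have := ler_wpM2l (ltW L0) p; lra.
have := le_trans key q.
have -> : 1 + i%:R * t + i%:R * (i%:R - 1) / 2 * t ^+ 2 =
    1 + (i%:R ^+ 2 + i%:R * (16 * L - 1)) / (128 * L ^+ 2).
  by rewrite /t; field; rewrite gt_eqF.
have h2 : 2 * L <= (i%:R ^+ 2 + i%:R * (16 * L - 1)) / (128 * L ^+ 2).
  rewrite ler_pdivlMr ?mulr_gt0 ?exprn_gt0 //.
  have : 0 <= i%:R * (16 * L - 1) by rewrite mulr_ge0 //; lra.
  by move: hi; rewrite (exprS L 2); lra.
by lra.
Qed.
End Growth.

Section Expansion.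
Variable R : realType.
Variables (V Ed : finType) (ends : Ed -> V * V).
Implicit Types (E Z : {set Ed}) (S U B : {set V}).
Local Notation src := (dsrc ends).
Local Notation tgt := (dtgt ends).

Definition inside E U := [set e in E | ((ends e).1 \in U) && ((ends e).2 \in U)].

Lemma inside_subl E E' U : E \subset E' -> inside E U \subset inside E' U.
Proof. by move=> /fintype.subsetP s; apply/fintype.subsetP => e; rewrite !inE => /andP[/s -> ->]. Qed.

Lemma inside_del E Z U : (#|inside E U| <= #|inside (E :\: Z) U| + #|Z|)%N.
Proof.
apply: leq_trans (_ : #|inside (E :\: Z) U :|: Z| <= _)%N; last by rewrite cardsU leq_subr.
apply/subset_leq_card/fintype.subsetP => e; rewrite !inE => /and3P[-> -> ->].
by case: (e \in Z).
Qed.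

Definition grow E S B :=
  B :|: [set w in S | [exists d, [&& d.1 \in E, src d \in B & tgt d == w]]].

Definition hball E S v j := iter j (grow E S) [set v].

Lemma hball_sub E S v j : v \in S -> hball E S v j \subset S.
Proof.
move=> vS; elim: j => [|j IH]; first by rewrite finset.sub1set.
rewrite /hball iterS finset.subUset -/(hball E S v j) IH /=.
by apply/fintype.subsetP => w; rewrite inE => /andP[].
Qed.

Lemma hball_mono E S v j : hball E S v j \subset hball E S v j.+1.
Proof. by rewrite /hball iterS; apply: finset.subsetUl. Qed.

Lemma hball_card E S v j k : (j <= k)%N -> (#|hball E S v j| <= #|hball E S v k|)%N.
Proof.
move=> /subnK <-; elim: (k - j)%N => // m IH.
by apply: leq_trans IH (subset_leq_card (hball_mono _ _ _ _)).
Qed.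

Lemma inside_grow E S B : B \subset S ->
  (#|inside E S| <= #|inside E (S :\: B)| + #|inside E (grow E S B)|)%N.
Proof.
move=> sB; apply: leq_trans (_ : #|inside E (S :\: B) :|: inside E (grow E S B)| <= _)%N; last first.
  by rewrite cardsU leq_subr.
apply/subset_leq_card/fintype.subsetP => e; rewrite !inE => /and3P[eE s1 s2].
rewrite eE s1 s2 /= !andbT.
case b1 : ((ends e).1 \in B) => /=.
  apply/orP; right; apply/existsP; exists (e, false).
  by rewrite /= eE /dsrc /dtgt /= b1 eqxx.
case b2 : ((ends e).2 \in B) => //=; rewrite ?andbT ?orbT.
apply/existsP; exists (e, true).
by rewrite /= eE /dsrc /dtgt /= b2 eqxx.
Qed.

Lemma walk_cat a p b p' c : is_walk ends a p b -> is_walk ends b p' c -> is_walk ends a (p ++ p') c.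
Proof. by elim: p a => [a /= /eqP ->|d p IH a /= /andP[-> h] h'] //=; apply: IH. Qed.

Definition rdart (d : Ed * bool) := (d.1, ~~ d.2).

Lemma walk_rev a p b : is_walk ends a p b -> is_walk ends b (rev (map rdart p)) a.
Proof.
elim: p a b => [a b /= /eqP ->|[e c] p IH a b /= /andP[/eqP <- h]]; first by rewrite /= eqxx.
rewrite rev_cons -cats1; apply: walk_cat (IH _ _ h) _.
by rewrite /= /dsrc /dtgt /=; case: c {h}; rewrite !eqxx.
Qed.

Lemma hball_walk E S v w j : w \in hball E S v j ->
  exists p, [/\ is_walk ends v p w, (size p <= j)%N & all (fun d => d.1 \in E) p].
Proof.
elim: j w => [w|j IH w]; first by rewrite inE => /eqP ->; exists [::]; rewrite /= eqxx.
rewrite /hball iterS inE -/(hball E S v j) => /orP[/IH [p [h1 h2 h3]]|].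
  by exists p; split => //; apply: leqW.
rewrite inE => /andP[_ /existsP [d /and3P[dE /IH [p [h1 h2 h3]] /eqP <-]]].
exists (p ++ [:: d]); split; last by rewrite all_cat h3 /= dE.
  by apply: walk_cat h1 _; rewrite /= !eqxx.
by rewrite size_cat addn1.
Qed.

Variables (kap : R) (E Z : {set Ed}) (S : {set V}).
Let n : R := #|S|%:R.
Let L := 1 + ln n.
Let D := kap * L ^+ 4.
Hypotheses (kap0 : 0 < kap) (n0 : (0 < #|S|)%N).
Hypothesis dens : D * n < #|inside E S|%:R.
Hypothesis mini : forall U, U \proper S ->
  #|inside E U|%:R <= kap * #|U|%:R * (1 + ln (#|U|%:R : R)) ^+ 4.
Hypothesis hZ : 16 * #|Z|%:R * L <= D * n.

Let n1 : 1 <= n. Proof. by rewrite /n ler1n. Qed.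
Let L1 : 1 <= L. Proof. by rewrite /L lerDl ln_ge0. Qed.
Let D0 : 0 < D. Proof. by rewrite /D mulr_gt0 // exprn_gt0 //; have := L1; lra. Qed.

(* [(1 + ln u)^4 <= L^3 (1 + ln u)], and [1 + ln u = L - ln (n/u)]. *)
Lemma inside_le U : U \proper S -> (0 < #|U|)%N ->
  #|inside (E :\: Z) U|%:R <= D * #|U|%:R * (1 - ln (n / #|U|%:R) / L).
Proof.
move=> pU u0; have u1 : 1 <= #|U|%:R :> R by rewrite ler1n.
have un : #|U|%:R <= n by rewrite ler_nat subset_leq_card // proper_sub.
have l1 : 0 <= ln (#|U|%:R : R) by rewrite ln_ge0.
have l2 : ln (#|U|%:R : R) <= ln n by rewrite ler_ln ?posrE //; lra.
have L0 := L1.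
apply: (@le_trans _ _ (#|inside E U|%:R)).
  by rewrite ler_nat subset_leq_card // inside_subl // finset.subsetDl.
apply: le_trans (mini pU) _.
have -> : 1 - ln (n / #|U|%:R) / L = (1 + ln #|U|%:R) / L.
  rewrite lnM ?posrE ?invr_gt0 ?lnV ?posrE; try lra.
  by rewrite /L; field; rewrite gt_eqF //; rewrite -/L; lra.
rewrite /D; move: (ln #|U|%:R) l1 l2 => x l1 l2.
have -> : kap * L ^+ 4 * #|U|%:R * ((1 + x) / L) = kap * #|U|%:R * ((1 + x) * L ^+ 3).
  by field; rewrite gt_eqF //; lra.
apply: ler_wpM2l; first by rewrite mulr_ge0 // ltW.
rewrite exprS; apply: ler_wpM2l; first lra.
by apply: lerXn2r; rewrite ?nnegrE /L in L0 *; lra.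
Qed.

(** A maximiser of edges minus [c] times vertices: deleting [U] cannot help, hence destroys at least
    [c * #|U|] edges. The value at [S] exceeds 3/4 of [D * n / (4 * L)], as [Z] uses up at most a
    quarter, while by [inside_le] a proper subset [S'] reaches at most [D * #|S'| / (4 * L)]; this
    forces the size. *)
Lemma exists_expander : exists S' : {set V}, [/\ S' \subset S, (3 * #|S| <= 4 * #|S'|)%N &
  forall U, U \subset S' -> D * #|U|%:R * (1 - 1 / (4 * L)) <=
    #|inside (E :\: Z) S'|%:R - #|inside (E :\: Z) (S' :\: U)|%:R].
Proof.
have L0 := L1; have Dp := D0.
pose c := D * (1 - 1 / (4 * L)).
pose Phi U : R := #|inside (E :\: Z) U|%:R - c * #|U|%:R.
have [S' sS' mS'] : exists2 S' : {set V}, S' \subset S & forall U, U \subset S -> Phi U <= Phi S'.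
  by case: (@Order.TotalTheory.arg_maxP _ _ _ S (fun U : {set V} => U \subset S) Phi (subxx _)) => S' h1 h2; exists S'.
have cE : c = D - D / (4 * L) by rewrite /c; field; rewrite gt_eqF //; lra.
have DL : 0 < D / (4 * L) by rewrite divr_gt0 // mulr_gt0 //; lra.
exists S'; split => //.
  have [->|ne] := eqVneq S' S; first by lia.
  have pS' : S' \proper S by rewrite finset.properEneq ne.
  have h1 : 3 * (D / (4 * L)) * n < 4 * Phi S'.
    have := mS' S (subxx _); have := inside_del E Z S; rewrite -(ler_nat R) natrD.
    have : #|Z|%:R <= D / (4 * L) * n / 4.
      have -> : D / (4 * L) * n / 4 = D * n / (16 * L) by field; rewrite gt_eqF //; lra.
      by rewrite ler_pdivlMr ?mulr_gt0 ?(lt_le_trans ltr01 L0) // mulrCA mulrA.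
    have e : Phi S = #|inside (E :\: Z) S|%:R - D * n + D / (4 * L) * n.
      by rewrite /Phi cE -/n; ring.
    rewrite e -[3 * _ * n]mulrA; move: dens; move: (D * n) (D / (4 * L) * n) => x y.
    by lra.
  have h2 : Phi S' <= D / (4 * L) * #|S'|%:R.
    case: (posnP #|S'|) => [z|u0].
      have : Phi S' = 0.
        rewrite /Phi z mulr0 subr0; move/eqP: z; rewrite cards_eq0 => /eqP ->.
        rewrite (_ : inside _ _ = finset.set0) ?cards0 //.
        by apply/setP => e; rewrite !inE /= andbF.
      by move=> ->; rewrite z mulr0.
    have := inside_le pS' u0; rewrite /Phi cE.
    have : 0 <= D * #|S'|%:R * (ln (n / #|S'|%:R) / L).
      apply: mulr_ge0; first by apply: mulr_ge0; rewrite ?(ltW Dp).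
      apply: divr_ge0; last lra.
      rewrite ln_ge0 // ler_pdivlMr ?ltr0n // mul1r ler_nat.
      exact: subset_leq_card.
    by rewrite mulrBl mulrBr mulr1; lra.
  rewrite -(ler_nat R) !natrM -/n.
  have : 3 * (D / (4 * L)) * n <= 4 * (D / (4 * L) * #|S'|%:R) by lra.
  by rewrite mulrAC [X in _ <= X]mulrCA mulrC ler_pM2l.
move=> U sU; have := mS' (S' :\: U) (fintype.subset_trans (finset.subsetDl _ _) sS').
have e : #|S'|%:R = #|U|%:R + #|S' :\: U|%:R :> R.
  by rewrite -natrD -(cardsID U S') (finset.setIidPr sU).
rewrite /Phi e (_ : D * #|U|%:R * _ = c * #|U|%:R); last by rewrite /c mulrAC.
by rewrite mulrDr; lra.
Qed.

(** A ball spans few edges by minimality of [S], but many edges touch it and all of them lie in the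
    next ball. With edge numbers divided by [D] this is the recursion of [growth], so a ball of
    radius [i.+1] exceeds half of [S], and two such balls meet. *)
Lemma short_walks i : 256 * L ^+ 3 <= i%:R ^+ 2 ->
  exists S' : {set V}, [/\ S' \subset S, (3 * #|S| <= 4 * #|S'|)%N &
  forall a b, a \in S' -> b \in S' -> exists p, [/\ is_walk ends a p b,
    (size p <= 2 * i.+1)%N & all (fun d => d.1 \in E :\: Z) p]].
Proof.
move=> hi; have [S' [sS' cS' hS']] := exists_expander; exists S'; split => //.
have L0 := L1; have Dp := D0.
pose E' := E :\: Z; pose B v := hball E' S' v.
have large v : v \in S' -> (#|S| < 2 * #|B v i.+1|)%N.
  move=> vS; rewrite ltnNge; apply/negP => hB.
  have sB j : B v j \subset S' by apply: hball_sub.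
  have u1 j : (0 < #|B v j|)%N by apply: leq_trans (hball_card _ _ _ (leq0n j)); rewrite cards1.
  have un j : (j <= i.+1)%N -> (2 * #|B v j| <= #|S|)%N.
    by move=> ji; apply: leq_trans hB; rewrite leq_mul2l hball_card.
  have pB j : (j <= i.+1)%N -> B v j \proper S.
    move=> ji; rewrite properEcard (fintype.subset_trans (sB j) sS') /=.
    by have := un j ji; have := u1 j; lia.
  pose u j : R := #|B v j|%:R; pose w j : R := #|inside E' (B v j)|%:R / D.
  have st j : u j * (1 - 1 / (4 * L)) <= w j.+1.
    rewrite /w ler_pdivlMr // mulrC mulrA; apply: le_trans (hS' _ (sB j)) _.
    by rewrite lerBlDr addrC -natrD ler_nat; apply: inside_grow.
  have hw j : (j <= i.+1)%N -> w j <= u j * (1 - ln (n / u j) / L).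
    move=> ji; rewrite /w ler_pdivrMr // [leRHS]mulrC mulrA.
    by apply: inside_le; rewrite ?pB.
  have := @growth R n u w i n1; rewrite -/L ltNge hi /= => h.
  suff : false by [].
  apply: h => [j ji|j ji||j /andP[_ ji]].
  - by rewrite ler_pdivlMr // /u /n mulrC -natrM ler_nat un.
  - apply: le_trans (hw j ji) _; rewrite ler_piMr // gerBl divr_ge0 //; last lra.
    rewrite ln_ge0 // ler_pdivlMr ?ltr0n ?u1 // mul1r ler_nat.
    by apply: subset_leq_card; apply: proper_sub; apply: pB.
  - have := st 0%N; rewrite /u /B /hball /= cards1 mul1r.
    have : 1 / (4 * L) <= 1 / 4 by rewrite ler_pdivrMr ?mulr_gt0 //; lra.
    by lra.
  - apply: le_trans (st j); have := hw j (leqW ji).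
    have -> : u j * (1 - 1 / (4 * L)) = u j * (1 - ln (n / u j) / L) +
        u j * (ln (n / u j) - 1 / 4) / L by field; rewrite gt_eqF //; lra.
    by rewrite lerD2r.
move=> a b aS bS; have /set0Pn [c] : B a i.+1 :&: B b i.+1 != finset.set0.
  apply/negP => /eqP e0; have := large a aS; have := large b bS.
  have := subset_leq_card sS'.
  have : (#|B a i.+1 :|: B b i.+1| <= #|S'|)%N.
    by apply: subset_leq_card; rewrite finset.subUset !hball_sub.
  by rewrite cardsU e0 cards0 subn0; lia.
rewrite inE => /andP[/hball_walk [p [p1 p2 p3]] /hball_walk [p' [q1 q2 q3]]].
exists (p ++ rev (map rdart p')); split.
- exact: walk_cat p1 (walk_rev q1).
- by rewrite size_cat size_rev size_map mul2n -addnn leq_add.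
- by rewrite all_cat p3 all_rev all_map.
Qed.
End Expansion.

(** * Routings *)

Section UnionBound.
Variables (A : finType) (bad : A -> A -> A -> A -> bool) (B : nat).
Hypothesis hB : (\sum_a \sum_a' \sum_b \sum_b' bad a b a' b' <= B)%N.
Hypothesis hA : (81 * B + 18 * #|A| ^ 3 < #|A| ^ 4)%N.

(** For uniformly random [a] and [b] the 9 + 9 possible coincidences have probability at most 1/N
    each, and the 81 quadruples of indices are bad with probability at most B/N^4 each, where N is
    the size of [A]. *)
Lemma union_bound : exists a b : 'I_3 -> A, [/\ injective a, forall i j, a i != b j &
  forall i j k l, i != k -> j != l -> ~~ bad (a i) (b j) (a k) (b l)].
Proof.
have A0 : (0 < #|A|)%N by case: #|A| hA.
pose T := {ffun 'I_3 -> A}; pose N : rat := #|A|%:R.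
have N0 : 0 < N by rewrite ltr0n.
have Nn : N != 0 by rewrite gt_eqF.
pose X1 (a b : T) : rat := \sum_(t : 'I_3 * 'I_3) ((t.1 != t.2) && (a t.1 == a t.2))%:R.
pose X2 (a b : T) : rat := \sum_(t : 'I_3 * 'I_3) (a t.1 == b t.2)%:R.
pose X3 (a b : T) : rat := \sum_(t : ('I_3 * 'I_3) * ('I_3 * 'I_3))
  [&& t.1.1 != t.2.1, t.1.2 != t.2.2 & bad (a t.1.1) (b t.1.2) (a t.2.1) (b t.2.2)]%:R.
have cT : \sum_(a : T) (1 : rat) = N ^+ 3.
  by rewrite sumr_const card_ffun card_ord natrX.
have diag : \sum_(x : A) \sum_(y : A) (x == y)%:R = N.
  rewrite (eq_bigr (fun=> 1)); first by rewrite sumr_const.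
  move=> x _; rewrite (bigD1 x) //= eqxx big1 ?addr0 // => y /negbTE.
  by rewrite eq_sym => ->.
have b1 : \sum_a \sum_b X1 a b <= 9 * N ^+ 5.
  have -> : \sum_(a : T) \sum_(b : T) X1 a b =
      \sum_(t : 'I_3 * 'I_3) \sum_(a : T) N ^+ 3 * ((t.1 != t.2) && (a t.1 == a t.2))%:R.
    rewrite [RHS]exchange_big; apply: eq_bigr => a _; rewrite exchange_big; apply: eq_bigr => t _.
    by rewrite -cT mulr_suml; apply: eq_bigr => b _; rewrite mul1r.
  apply: (@le_trans _ _ (\sum_(t : 'I_3 * 'I_3) N ^+ 5)); last first.
    by rewrite sumr_const card_prod card_ord mulr_natl.
  apply: ler_sum => -[i k] _ /=; rewrite -mulr_sumr.
  have [->|ik] := eqVneq i k; first by rewrite big1 ?mulr0 ?exprn_ge0 // ltW.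
  rewrite /= (marg2 A0 (fun x y => (x == y)%:R) ik) diag card_ord -/N.
  by rewrite le_eqVlt; apply/orP; left; apply/eqP; field.
have b2 : \sum_a \sum_b X2 a b <= 9 * N ^+ 5.
  have -> : \sum_(a : T) \sum_(b : T) X2 a b =
      \sum_(t : 'I_3 * 'I_3) \sum_(a : T) \sum_(b : T) (a t.1 == b t.2)%:R.
    rewrite [RHS]exchange_big; apply: eq_bigr => a _; rewrite exchange_big; exact: eq_bigr.
  apply: (@le_trans _ _ (\sum_(t : 'I_3 * 'I_3) N ^+ 5)); last first.
    by rewrite sumr_const card_prod card_ord mulr_natl.
  apply: ler_sum => -[i k] _ /=.
  under eq_bigr => a _ do rewrite (marg1 A0 k (fun y => (a i == y)%:R)).
  rewrite -mulr_sumr (marg1 A0 i (fun x => \sum_y (x == y)%:R)) diag card_ord -/N.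
  by rewrite le_eqVlt; apply/orP; left; apply/eqP; field.
have b3 : \sum_a \sum_b X3 a b <= 81 * (N ^+ 2 * B%:R).
  have -> : \sum_(a : T) \sum_(b : T) X3 a b =
      \sum_(t : ('I_3 * 'I_3) * ('I_3 * 'I_3)) \sum_(a : T) \sum_(b : T)
  [&& t.1.1 != t.2.1, t.1.2 != t.2.2 & bad (a t.1.1) (b t.1.2) (a t.2.1) (b t.2.2)]%:R.
    rewrite [RHS]exchange_big; apply: eq_bigr => a _; rewrite exchange_big; exact: eq_bigr.
  apply: (@le_trans _ _ (\sum_(t : ('I_3 * 'I_3) * ('I_3 * 'I_3)) N ^+ 2 * B%:R)); last first.
    by rewrite sumr_const !card_prod card_ord mulr_natl.
  apply: ler_sum => -[[i j] [k l]] _ /=.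
  have nn : 0 <= N ^+ 2 * B%:R by rewrite mulr_ge0 ?exprn_ge0 // ltW.
  have [_|ik] := eqVneq i k; first by rewrite big1 // => a _; rewrite big1.
  have [_|jl] := eqVneq j l; first by rewrite big1 // => a _; rewrite big1.
  under eq_bigr => a _ do rewrite /= (marg2 A0 (fun x y => (bad (a i) x (a k) y)%:R) jl).
  rewrite -mulr_sumr (marg2 A0 (fun x y => \sum_z \sum_w (bad x z y w)%:R) ik) card_ord -/N.
  rewrite mulrA (_ : N ^+ 3 / N ^+ 2 * (N ^+ 3 / N ^+ 2) = N ^+ 2); last by field.
  rewrite ler_wpM2l ?exprn_ge0 ?(ltW N0) //.
  suff -> : \sum_a \sum_b \sum_z \sum_w (bad a z b w)%:R =
    (\sum_a \sum_b \sum_z \sum_w bad a z b w)%N%:R :> rat by rewrite ler_nat.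
  rewrite natr_sum; apply: eq_bigr => a _; rewrite natr_sum; apply: eq_bigr => b _.
  by rewrite natr_sum; apply: eq_bigr => z _; rewrite natr_sum.
have tot : \sum_(a : T) \sum_(b : T) (X1 a b + X2 a b + X3 a b) < \sum_(a : T) \sum_(b : T) 1.
  have -> : \sum_(a : T) \sum_(b : T) (1 : rat) = N ^+ 6.
    by rewrite cT sumr_const card_ffun card_ord -mulr_natr natrX -exprD.
  apply: (@le_lt_trans _ _ (9 * N ^+ 5 + 9 * N ^+ 5 + 81 * (N ^+ 2 * B%:R))).
    under eq_bigr => a _ do rewrite !big_split.
    by rewrite !big_split; apply: lerD b3; apply: lerD.
  have : N ^+ 2 * (81 * B + 18 * #|A| ^ 3)%N%:R < N ^+ 2 * (#|A| ^ 4)%N%:R.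
    by rewrite ltr_pM2l ?exprn_gt0 // ltr_nat.
  rewrite natrD (natrM _ 81) (natrM _ 18) !natrX -/N -exprD.
  by move=> h; apply: le_lt_trans h; rewrite le_eqVlt; apply/orP; left; apply/eqP; ring.
have [a [b h]] : exists a b : T, X1 a b + X2 a b + X3 a b < 1.
  apply: contrapT => hn; move: tot; rewrite ltNge => /negP; apply.
  apply: ler_sum => a _; apply: ler_sum => b _; rewrite leNgt; apply/negP => h.
  by apply: hn; exists a, b.
have X1p : 0 <= X1 a b by apply: sumr_ge0.
have X2p : 0 <= X2 a b by apply: sumr_ge0.
have X3p : 0 <= X3 a b by apply: sumr_ge0.
have sum_lt1 (J : finType) (P : J -> bool) : \sum_j (P j)%:R < 1 :> rat -> forall j, ~~ P j.
  move=> hs j; apply/negP => Pj; move: hs; rewrite (bigD1 j) //= Pj ltNge => /negP; apply.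
  by rewrite lerDl sumr_ge0.
have h1 := sum_lt1 _ _ (_ : X1 a b < 1); have h2 := sum_lt1 _ _ (_ : X2 a b < 1).
have h3 := sum_lt1 _ _ (_ : X3 a b < 1).
exists a, b; split => [i k|i j|i j k l ik jl].
- by apply: contraPeq => ne e; have := h1 _ (i, k); rewrite /= ne e eqxx => /(_ ltac:(lra)).
- by have := h2 _ (i, j) => /(_ ltac:(lra)).
- by have := h3 _ ((i, j), (k, l)); rewrite /= ik jl => /(_ ltac:(lra)).
Qed.
End UnionBound.

Lemma card_set_sum (T : finType) (P : {set T}) (b : pred T) :
  #|[set p in P | b p]| = (\sum_(p in P) b p)%N.
Proof. by rewrite -sum1dep_card big_mkcondr; apply: eq_bigr => p _; case: (b p). Qed.

Section Routing.
Variables (V Ed : finType) (ends : Ed -> V * V) (E : {set Ed}) (Y : {set V}) (r c : nat).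
Implicit Types (P : {set V * V}) (W : V * V -> seq (Ed * bool)).

Definition route (p : V * V) (w : seq (Ed * bool)) :=
  [/\ is_walk ends p.1 w p.2, (size w <= r)%N & all (fun d => d.1 \in E) w].

Definition load P W e := #|[set p in P | e \in map fst (W p)]|.

Definition routing P W := [/\ forall p, p \in P -> (p.1 \in Y) && (p.2 \in Y),
  forall p, p \in P -> route p (W p) & forall e, (load P W e <= c)%N].

(** A routing with the largest number of pairs: a further pair whose walk meets only edges of load
    below [c] could be added. *)
Lemma max_routing : exists P W, routing P W /\
  forall p w, p.1 \in Y -> p.2 \in Y -> p \notin P -> route p w ->
  exists2 d, d \in w & load P W d.1 = c.
Proof.
pose Q m := `[< exists P W, routing P W /\ #|P| = m >].
have Q0 : exists m, Q m.
  exists 0%N; apply/asboolP; exists finset.set0, (fun=> [::]); rewrite cards0; split => //.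
  split=> [p|p|e]; rewrite ?inE // /load (_ : [set p in _ | _] = finset.set0) ?cards0 //.
  by apply/setP => p; rewrite !inE.
have Qb m : Q m -> (m <= #|{: V * V}|)%N by move=> /asboolP [P [W [_ <-]]]; apply: max_card.
case: (ex_maxnP Q0 Qb) => m /asboolP [P [W [[h1 h2 h3] cP]]] mm.
exists P, W; split => // p w py1 py2 pP hw; apply: contrapT => hn.
have free d : d \in w -> (load P W d.1 < c)%N.
  by move=> dw; rewrite ltn_neqAle h3 andbT; apply/eqP => e; apply: hn; exists d.
pose W' q := if q == p then w else W q.
have W'E q : q \in P -> W' q = W q.
  by move=> qP; rewrite /W'; case: eqP => // e; rewrite -e qP in pP.
suff : Q m.+1 by move=> /mm; rewrite ltnn.
apply/asboolP; exists (p |: P), W'; split; last by rewrite cardsU1 pP cP.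
split=> [q|q|e].
- by rewrite !inE => /orP[/eqP ->|/h1 //]; rewrite py1.
- rewrite !inE => /orP[/eqP ->|qP]; first by rewrite /W' eqxx.
  by rewrite W'E //; apply: h2.
- have l1 : (load (p |: P) W' e <= (e \in map fst w) + load P W e)%N.
    rewrite /load; have -> : [set q in p |: P | e \in map fst (W' q)] =
        (if e \in map fst w then [set p] else finset.set0) :|: [set q in P | e \in map fst (W q)].
      apply/setP => q; rewrite !inE; case: (eqVneq q p) => [->|qp].
        by rewrite /W' eqxx (negbTE pP) /= orbF; case: ifP; rewrite !inE ?eqxx.
      by case: ifP => _; rewrite !inE ?(negbTE qp) /=; case qP : (q \in P) => //=; rewrite W'E.
    rewrite cardsU; apply: leq_trans (leq_subr _ _) _.
    by rewrite leq_add2r; case: ifP; rewrite ?cards1 ?cards0.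
  apply: leq_trans l1 _; case: (boolP (e \in map fst w)) => [/mapP [d dw ->]|_]; last by rewrite add0n.
  by rewrite add1n free.
Qed.

Lemma sum_load P W : routing P W -> (\sum_e load P W e <= r * #|Y| ^ 2)%N.
Proof.
move=> [h1 h2 _].
have -> : (\sum_e load P W e = \sum_(p in P) \sum_e (e \in map fst (W p)))%N.
  by rewrite exchange_big; apply: eq_bigr => e _; rewrite -card_set_sum.
apply: (@leq_trans (\sum_(p in P) r)%N).
  apply: leq_sum => p /h2 [_ s _].
  have -> : (\sum_e (e \in map fst (W p)) = #|map fst (W p)|)%N.
    by rewrite -sum1_card [RHS]big_mkcond; apply: eq_bigr => e _; case: (e \in _).
  by apply: leq_trans (card_size _) _; rewrite size_map.
rewrite sum_nat_const mulnC leq_mul2l; apply/orP; right.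
rewrite -mulnn -cardsX; apply/subset_leq_card/fintype.subsetP => p /h1.
by case: p => a b; rewrite inE.
Qed.

Lemma saturated_card P W : routing P W ->
  (#|[set e | load P W e == c]| * c <= r * #|Y| ^ 2)%N.
Proof.
move=> h; apply: leq_trans (sum_load h); rewrite -sum_nat_const.
rewrite big_mkcond [leqRHS](eq_bigr (fun e => load P W e)) //=; apply: leq_sum => e _.
by rewrite inE; case: eqP => [->|].
Qed.

Variable cross : rel Ed.
Variable t : nat.
Hypothesis ht : forall e, e \in E -> (#|[set f in E | ~~ cross e f]| <= t)%N.

(** Each of the at most [r] edges on a route misses at most [t] edges, and each of these carries at
    most [c] routes. *)
Lemma bad_count P W (A : {set V}) : routing P W ->
  (forall a b, a \in A -> b \in A -> (a, b) \in P) ->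
  (\sum_(p in finset.setX A A) \sum_(p' in finset.setX A A) ~~ allrel (fun d d' => cross d.1 d'.1) (W p) (W p') <= #|A| ^ 2 * (r * (t * c)))%N.
Proof.
move=> [h1 h2 h3] hA; rewrite -mulnn -cardsX -sum_nat_const.
have inP p : p \in finset.setX A A -> p \in P by case: p => a b; rewrite inE => /andP[]; apply: hA.
apply: leq_sum => p /inP /h2 [_ sp /allP aE].
apply: (@leq_trans (\sum_(d <- W p) \sum_(f in E | ~~ cross d.1 f) load P W f)%N); last first.
  apply: (@leq_trans (\sum_(d <- W p) (t * c))%N); last first.
    by rewrite big_const_seq count_predT iter_addn_0 mulnC leq_mul2r sp orbT.
  rewrite !big_seq; apply: leq_sum => d /aE dE.
  apply: (@leq_trans (\sum_(f in E | ~~ cross d.1 f) c)%N); first by apply: leq_sum.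
  rewrite sum_nat_const leq_mul2r; apply/orP; right; apply: leq_trans (ht dE).
  by apply: eq_leq; apply: eq_card => f; rewrite !inE.
apply: (@leq_trans (\sum_(p' in P) \sum_(d <- W p) \sum_(f in E | ~~ cross d.1 f) (f \in map fst (W p')))%N).
  rewrite big_mkcond [leqRHS]big_mkcond; apply: leq_sum => p' _; case: ifP => // /inP p'P.
  rewrite p'P; case: allrelP => // hn.
  have [d [d' [dw dw' nc]]] : exists d d', [/\ d \in W p, d' \in W p' & ~~ cross d.1 d'.1].
    apply: contrapT => hh; apply: hn => d d' dw dw'; apply/negPn/negP => nc.
    by apply: hh; exists d, d'.
  rewrite (big_rem d) //= (bigD1 d'.1) /=; first by rewrite map_f.
  by rewrite nc; case: (h2 _ p'P) => _ _ /allP ->.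
rewrite exchange_big; apply: leq_sum => d _; rewrite exchange_big; apply: leq_sum => f _.
by rewrite /load card_set_sum.
Qed.
End Routing.

Lemma sum_sig_pairs (V : finType) (A : {set V}) (F : V * V -> V * V -> nat) :
  (\sum_(a : {v | v \in A}) \sum_(a' : {v | v \in A}) \sum_(b : {v | v \in A})
     \sum_(b' : {v | v \in A}) F (val a, val b) (val a', val b') =
   \sum_(p in finset.setX A A) \sum_(p' in finset.setX A A) F p p')%N.
Proof.
have sumX (f : V * V -> nat) : (\sum_(p in finset.setX A A) f p =
    \sum_(a : {v | v \in A}) \sum_(b : {v | v \in A}) f (val a, val b))%N.
  rewrite (sum_sig A (fun a => \sum_(b : {v | v \in A}) f (a, val b))%N).
  under [RHS]eq_bigr => a _ do rewrite (sum_sig A (fun b => f (a, b))).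
  by rewrite pair_big; apply: eq_big => [[a b]|[a b] _] //; rewrite inE.
rewrite sumX; apply: eq_bigr => a _; rewrite exchange_big; apply: eq_bigr => b _.
by rewrite sumX.
Qed.

Lemma union_bound_numbers N X : (162 * X < N ^ 2)%N -> (36 < N)%N ->
  (81 * (N ^ 2 * X) + 18 * N ^ 3 < N ^ 4)%N.
Proof.
move=> h1 h2; have N0 : (0 < N)%N by lia.
have : (36 * N ^ 3 < N ^ 4)%N by rewrite (expnS N 3) ltn_pmul2r // expn_gt0 N0.
have : (162 * X * N ^ 2 < N ^ 4)%N by rewrite (expnD N 2 2) ltn_pmul2r // expn_gt0 N0.
move: (N ^ 4)%N (N ^ 3)%N (N ^ 2)%N => x y z; rewrite -mulnA (mulnC X); lia.
Qed.

(** For a bipartite graph with class [Y0], walks between vertices of [Y] have even length. *)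
Lemma larger_side (V : finType) (S Y0 : {set V}) : exists Y : {set V},
  [/\ Y \subset S, (#|S| <= 2 * #|Y|)%N &
     forall a b, a \in Y -> b \in Y -> (a \in Y0) = (b \in Y0)].
Proof.
have := cardsID Y0 S; case: (leqP #|S| (2 * #|S :&: Y0|)) => h e.
  exists (S :&: Y0); split => //; first exact: finset.subsetIl.
  by move=> a b; rewrite !inE => /andP[_ ->] /andP[_ ->].
exists (S :\: Y0); split; first exact: finset.subsetDl.
  by lia.
by move=> a b; rewrite !inE => /andP[/negbTE -> _] /andP[/negbTE -> _].
Qed.

Section FlowBound.
Variable R : realType.
Local Notation pt := (R * R)%type.
Variables (V Ed : finType) (pos : V -> pt) (ends : Ed -> V * V) (curve : Ed -> R -> pt).
Hypothesis G : simple_topgraph pos ends curve.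
Local Notation cross := (xcross curve).
Local Notation inside := (inside ends).

Lemma walk_parity (E : {set Ed}) (Y : {set V}) a p b :
  (forall e, e \in E -> ((ends e).1 \in Y) != ((ends e).2 \in Y)) ->
  is_walk ends a p b -> all (fun d => d.1 \in E) p ->
  odd (size p) = (a \in Y) (+) (b \in Y).
Proof.
move=> bip; elim: p a => [a /= /eqP -> _|d p IH a /= /andP[/eqP <- h] /andP[dE hE]].
  by rewrite addbb.
rewrite (IH _ h hE); have := bip _ dE; rewrite /dsrc /dtgt.
by case: d.2; case: (_ \in Y); case: (_ \in Y); case: (b \in Y).
Qed.

Lemma inside_le_sqr (E : {set Ed}) U : (#|inside E U| <= #|U| ^ 2)%N.
Proof.
have inj : injective ends.
  move=> e f h; have := @dart_inj _ _ _ _ _ _ G (e, false) (f, false).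
  by rewrite /dsrc /dtgt /= h => /(_ erefl) [].
rewrite -(card_imset _ inj) -mulnn -cardsX; apply/subset_leq_card/fintype.subsetP => p.
by move=> /imsetP [e]; rewrite inE => /and3P[_ h1 h2] ->; rewrite !inE h1.
Qed.

(** The constant [2 * 10 ^+ 8] is chosen for 162 * 32 * 2304 to be less than a sixteenth of it; the
    16 comes from [n <= 4 * N], squared. *)
Lemma flow_numbers (n L D t r c N : R) : 1 <= n -> 1 <= L -> 1 <= t ->
  D = 2 * 10 ^+ 8 * t * L ^+ 4 -> D < n -> 0 <= r -> r ^+ 2 <= 2304 * L ^+ 3 ->
  c * D <= 32 * n * r * L -> n <= 4 * N -> 162 * (r * (t * n * c)) < N ^+ 2.
Proof.
move=> n1 L1 t1; have n0 : 0 < n by lra.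
have L0 : 0 < L by lra.
have t0 : 0 < t by lra.
have [nn Ln tn] : [/\ 0 <= n, 0 <= L & 0 <= t] by rewrite !ltW.
move=> eD Dn r0 hr hc hN.
have T0 : 0 < t * L ^+ 4 * n ^+ 2 by rewrite !mulr_gt0 ?exprn_gt0.
have D0 : 0 < D by rewrite eD !mulr_gt0 ?exprn_gt0.
rewrite -(ltr_pM2r D0).
apply: (@le_lt_trans _ _ (162 * 32 * 2304 * (t * L ^+ 4 * n ^+ 2))).
  apply: (@le_trans _ _ (162 * (r * (t * n)) * (32 * n * r * L))).
    rewrite (_ : _ * D = 162 * (r * (t * n)) * (c * D)); last by ring.
    by apply: ler_wpM2l hc; apply: mulr_ge0 (ler0n _ _) _; rewrite !mulr_ge0.
  rewrite (_ : _ * (32 * n * r * L) = 162 * 32 * (t * n ^+ 2 * L) * r ^+ 2); last by ring.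
  apply: (@le_trans _ _ (162 * 32 * (t * n ^+ 2 * L) * (2304 * L ^+ 3))).
    by apply: ler_wpM2l hr; apply: mulr_ge0 (mulr_ge0 (ler0n _ _) (ler0n _ _)) _; rewrite !mulr_ge0 ?exprn_ge0.
  by rewrite le_eqVlt; apply/orP; left; apply/eqP; ring.
apply: (@lt_le_trans _ _ (2 * 10 ^+ 8 / 16 * (t * L ^+ 4 * n ^+ 2))).
  by rewrite ltr_pM2r //; lra.
have hn : n ^+ 2 / 16 <= N ^+ 2.
  rewrite (_ : n ^+ 2 / 16 = (n / 4) ^+ 2); last by field.
  apply: lerXn2r; rewrite ?nnegrE ?divr_ge0 // ?ler_pdivrMr ?(mulrC N) //.
  by rewrite -(pmulr_rge0 _ (_ : 0 < 4)) //; apply: le_trans hN.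
rewrite (_ : 2 * 10 ^+ 8 / 16 * _ = n ^+ 2 / 16 * D); first by rewrite ler_wpM2r // ltW.
by rewrite eD; field.
Qed.
Variables (E : {set Ed}) (Y0 : {set V}) (t : nat).
Hypothesis bip : forall e, e \in E -> ((ends e).1 \in Y0) != ((ends e).2 \in Y0).
Hypothesis t0 : (0 < t)%N.
Hypothesis ht : forall e (U : {set V}), e \in E ->
  (#|[set f in inside E U | ~~ cross e f]| <= t * #|U|)%N.

(* The walks that avoid the saturated edges would extend the maximal routing; hence it already
   routes all pairs of [A]. *)
Lemma flow_bound (S : {set V}) :
  #|inside E S|%:R <= 2 * 10 ^+ 8 * t%:R * #|S|%:R * (1 + ln (#|S|%:R : R)) ^+ 4.
Proof.
pose kap : R := 2 * 10 ^+ 8 * t%:R.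
have t1 : 1 <= t%:R :> R by rewrite ler1n.
have kap0 : 0 < kap by rewrite /kap !mulr_gt0 ?exprn_gt0 //; lra.
rewrite -/kap leNgt; apply/negP => big0.
pose big (S : {set V}) := kap * #|S|%:R * (1 + ln (#|S|%:R : R)) ^+ 4 < #|inside E S|%:R.
have [{big0}S /minsetP [bigS minS] _] := minset_exists (P := big) big0.
pose n : R := #|S|%:R; pose L := 1 + ln n; pose D := kap * L ^+ 4.
have mini (U : {set V}) : U \proper S -> #|inside E U|%:R <= kap * #|U|%:R * (1 + ln (#|U|%:R : R)) ^+ 4.
  move=> pU; rewrite leNgt; apply/negP => bU.
  by have := proper_card pU; rewrite (minS _ bU (proper_sub pU)) ltnn.
have n0 : (0 < #|S|)%N.
  rewrite lt0n; apply/negP => /eqP z; have := inside_le_sqr E S.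
  by move: bigS; rewrite /big z mulr0 mul0r ltr0n exp0n // lt0n => /negbTE; rewrite leqn0 => ->.
have n1 : 1 <= n by rewrite ler1n.
have L1 : 1 <= L by rewrite /L lerDl ln_ge0.
have D0 : 0 < D by rewrite /D mulr_gt0 // exprn_gt0 //; lra.
have dens : D * n < #|inside E S|%:R by move: bigS; rewrite /big /D -/n -/L mulrAC.
have Dn : D < n.
  have : D * n < n ^+ 2 by apply: lt_le_trans dens _; rewrite -natrX ler_nat inside_le_sqr.
  by rewrite expr2 ltr_pM2r //; lra.
pose s := Num.sqrt (256 * L ^+ 3).
have L0 : 0 <= L by lra.
have s2 : s ^+ 2 = 256 * L ^+ 3 by rewrite sqr_sqrtr; last exact: mulr_ge0 (ler0n _ _) (exprn_ge0 _ L0).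
have s16 : 16 <= s.
  rewrite -(@ler_pXn2r _ 2) ?nnegrE ?sqrtr_ge0 // s2.
  have : 1 <= L ^+ 3 by rewrite exprn_ege1.
  by lra.
(* As [i] exceeds [s], [short_walks] applies; [r] bounds its walks, and [r <= 3 * s] yields 2304 = 9
   * 256. *)
pose i := (Num.truncn s).+1; pose r := (2 * i.+1)%N.
have s0 : 0 <= s by lra.
have /andP[s1 s1'] := truncn_itv s0.
have hi : 256 * L ^+ 3 <= i%:R ^+ 2 by rewrite -s2 lerXn2r ?nnegrE // ltW.
have hr : (r%:R : R) ^+ 2 <= 2304 * L ^+ 3.
  have : r%:R <= 3 * s by rewrite /r natrM /i -!natr1; lra.
  move=> h; apply: (@le_trans _ _ ((3 * s) ^+ 2)); first by rewrite lerXn2r ?nnegrE //; lra.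
  by rewrite exprMn s2; lra.
have r1 : 1 <= r%:R :> R by rewrite ler1n.
(* At congestion [x] the bound r n^2 / x on the number of saturated edges is D n / (16 L), the loss
   that the expander tolerates. Rounding up costs at most a factor 2, since [1 <= x]. *)
pose x := 16 * n * r%:R * L / D; pose c := (Num.truncn x).+1.
have x1 : 1 <= x.
  rewrite /x ler_pdivlMr // mul1r; apply: le_trans (ltW Dn) _.
  rewrite (_ : 16 * n * _ * L = n * (16 * (r%:R * L))); last by ring.
  apply: ler_peMr; first by lra.
  have : 1 <= r%:R * L by apply: mulr_ege1.
  by lra.
have x0 : 0 <= x by lra.
have /andP[c1 c2] := truncn_itv x0.
have hc : c%:R * D <= 32 * n * r%:R * L.
  apply: (@le_trans _ _ (2 * x * D)).
    by rewrite ler_wpM2r ?(ltW D0) // /c -natr1; lra.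
  by rewrite /x -mulrA divfK ?gt_eqF //; lra.
have [Y [Y_S Y_half Ypar]] := larger_side S Y0.
pose ES := inside E S.
have [P [W [rPW maxPW]]] := max_routing ends ES Y r c.
pose Z := [set e | load P W e == c].
have hZ : 16 * #|Z|%:R * L <= D * n.
  have : (#|Z| * c)%N%:R <= (r * #|Y| ^ 2)%N%:R :> R by rewrite ler_nat (saturated_card rPW).
  rewrite natrM [in X in _ <= X]natrM natrX => h1.
  have h2 : (#|Y|%:R : R) ^+ 2 <= n ^+ 2 by rewrite lerXn2r ?nnegrE // ler_nat subset_leq_card.
  have h3 : #|Z|%:R * x <= r%:R * n ^+ 2.
    apply: (@le_trans _ _ (#|Z|%:R * c%:R)); first by rewrite ler_wpM2l // ltW.
    by apply: le_trans h1 _; rewrite ler_wpM2l.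
  have rn : 0 < r%:R * n by rewrite mulr_gt0 //; lra.
  rewrite -(ler_pM2r rn) (_ : 16 * _ * L * _ = #|Z|%:R * x * D).
    rewrite (_ : D * n * _ = r%:R * n ^+ 2 * D); last by ring.
    by rewrite ler_wpM2r // ltW.
  by rewrite /x; field; rewrite gt_eqF.
have subES : ES \subset E by apply/fintype.subsetP => e; rewrite inE => /andP[].
have mini' (U : {set V}) : U \proper S -> #|inside ES U|%:R <= kap * #|U|%:R * (1 + ln (#|U|%:R : R)) ^+ 4.
  move=> /mini; apply: le_trans; rewrite ler_nat; apply: subset_leq_card.
  exact: inside_subl.
have dens' : kap * (1 + ln n) ^+ 4 * n < #|inside ES S|%:R.
  apply: lt_le_trans dens _; rewrite ler_nat; apply/subset_leq_card/fintype.subsetP => e.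
  by rewrite !inE => /and3P[-> -> ->].
have [S' [sS' cS' hS']] := short_walks kap0 n0 dens' mini' hZ hi.
(* [S'] has at least three quarters of the vertices of [S] and [Y] at least half of them, so a
   quarter is common to both. *)
pose A := S' :&: Y.
have cA : (#|S| <= 4 * #|A|)%N.
  have : (#|S' :|: Y| <= #|S|)%N by apply: subset_leq_card; rewrite finset.subUset sS'.
  have := cardsUI S' Y; rewrite -/A; clear -cS' Y_half; lia.
have inP a b : a \in A -> b \in A -> (a, b) \in P.
  rewrite !inE => /andP[aS aY] /andP[bS bY]; apply/negPn/negP => nP.
  have [p [p1 p2 p3]] := hS' a b aS bS.
  have rp : route ends ES r (a, b) p.
    by split=> //; apply: sub_all p3 => d; rewrite inE => /andP[].
  have [d dp] := maxPW (a, b) p aY bY nP rp.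
  by have /allP /(_ d dp) := p3; rewrite !inE => /andP[/eqP h _] /h.
have ht' e : e \in ES -> (#|[set f in ES | ~~ cross e f]| <= t * #|S|)%N.
  by move=> eE; apply: ht; apply: (fintype.subsetP subES).
have bc := bad_count ht' rPW inP.
have rt (a b : {v | v \in A}) : route ends ES r (val a, val b) (W (val a, val b)).
  by case: rPW => _ h _; apply: h; apply: inP; apply: valP.
have Dbig : 2 * 10 ^+ 8 <= D.
  rewrite /D /kap -[X in _ <= X]mulrA ler_peMr ?mulr_ge0 ?exprn_ge0 //.
  by rewrite mulr_ege1 ?exprn_ege1.
pose bad (a b a' b' : {v | v \in A}) :=
  ~~ allrel (fun d d' => cross d.1 d'.1) (W (val a, val b)) (W (val a', val b')).
have [a [b [inja ab ok]]] : exists a b : 'I_3 -> {v | v \in A},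
    [/\ injective a, forall i j, a i != b j &
     forall i j k l, i != k -> j != l -> ~~ bad (a i) (b j) (a k) (b l)].
  apply: union_bound (_ : (_ <= #|A| ^ 2 * (r * (t * #|S| * c)))%N) _.
    by rewrite (sum_sig_pairs A (fun p p' =>
      nat_of_bool (~~ allrel (fun d d' => cross d.1 d'.1) (W p) (W p')))).
  rewrite card_sig (_ : #|[pred v | v \in A]| = #|A|); last by apply: eq_card.
  have cAn : n <= 4 * #|A|%:R by rewrite -natrM ler_nat.
  apply: union_bound_numbers.
    have := @flow_numbers n L D t%:R r%:R c%:R #|A|%:R n1 L1 t1 erefl Dn (ler0n _ _) hr hc cAn.
    by rewrite -!natrM -natrX ltr_nat.
  rewrite -(ltr_nat R).
  have : 2 * 10 ^+ 8 < 4 * #|A|%:R :> R by apply: le_lt_trans Dbig _; apply: lt_le_trans Dn cAn.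
  by move: (#|A|%:R) => z; lra.
apply: (no_even_K33 G (a := val \o a) (b := val \o b)
  (W := fun i j => W (val (a i), val (b j)))).
- by move=> j k /= /val_inj /inja.
- by move=> j k /=; rewrite (inj_eq val_inj).
- by move=> j k; case: (rt (a j) (b k)).
- move=> j k; case: (rt (a j) (b k)) => /= h _ h'.
  rewrite (walk_parity (E := E) (Y := Y0) bip h); last first.
    by apply: sub_all h' => d; apply: (fintype.subsetP subES).
  rewrite (Ypar (val (a j)) (val (b k))) ?addbb //.
    by have := valP (a j); rewrite inE => /andP[].
  by have := valP (b k); rewrite inE => /andP[].
- move=> j k l m y z jl km hy hz; have := ok j k l m jl km; rewrite negbK => /allrelP.
  exact.
Qed.
End FlowBound.

(** * Passage to a bipartite subgraph and the final bound *)

(** A uniformly random vertex set separates the ends of each edge with probability 1/2. *)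
Lemma half_cut (V Ed : finType) (ends : Ed -> V * V) : (forall e, (ends e).1 != (ends e).2) ->
  exists Y : {set V}, (#|Ed| <= 2 * #|[set e | ((ends e).1 \in Y) != ((ends e).2 \in Y)]|)%N.
Proof.
move=> ne; pose T := {ffun V -> bool}; pose N : rat := 2 ^+ #|V|.
have b0 : (0 < #|{: bool}|)%N by rewrite card_bool.
have N0 : 0 < N by rewrite exprn_gt0.
have sum_e e : \sum_(x : T) (x (ends e).1 != x (ends e).2)%:R = N / 2 :> rat.
  rewrite (marg2 b0 (fun x y => (x != y)%:R) (ne e)) card_bool !big_bool /= -/N.
  by field.
have [x hx] : exists x : T, (#|Ed| <= 2 * \sum_e (x (ends e).1 != x (ends e).2))%N.
  apply: contrapT => hn.
  have {}hn (x : T) : (2 * \sum_e (x (ends e).1 != x (ends e).2) < #|Ed|)%N.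
    by rewrite ltnNge; apply/negP => h; apply: hn; exists x.
  have : \sum_(x : T) 2 * \sum_e (x (ends e).1 != x (ends e).2)%:R < \sum_(x : T) #|Ed|%:R :> rat.
    apply: ltr_sum => [|x _]; first by apply/hasP; exists [ffun=> true]; rewrite ?mem_index_enum.
    by rewrite -natr_sum -natrM ltr_nat.
  rewrite -mulr_sumr exchange_big (eq_bigr _ (fun e _ => sum_e e)) !sumr_const.
  rewrite card_ffun card_bool -[ltRHS]mulr_natr natrX -/N -[X in 2 * X]mulr_natl.
  by rewrite mulrCA mulrC (mulrC 2) divfK // mulrC ltxx.
exists [set v | x v]; apply: leq_trans hx _; rewrite leq_mul2l /= -sum1dep_card [leqRHS]big_mkcond.
by apply: leq_sum => e _; rewrite !inE; case: (_ != _).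
Qed.

Section EdgeBound.
Variable R : realType.
Local Notation pt := (R * R)%type.
Variables (V Ed : finType) (pos : V -> pt) (ends : Ed -> V * V) (curve : Ed -> R -> pt).
Hypothesis G : simple_topgraph pos ends curve.
Local Notation cross := (xcross curve).
Local Notation inside := (inside ends).

Lemma incident_card (E : {set Ed}) (U : {set V}) v :
  (#|[set f in inside E U | incident ends f v]| <= #|U|)%N.
Proof.
pose d f := (f, (ends f).2 == v).
have sd f : incident ends f v -> dsrc ends (d f) = v.
  by rewrite /incident /dsrc /d /=; case: (eqVneq (ends f).2 v) => //= _; rewrite orbF => /eqP.
pose g f := dtgt ends (d f).
have injg : {in [set f in inside E U | incident ends f v] &, injective g}.
  move=> e f; rewrite inE => /andP[_ /sd he]; rewrite inE => /andP[_ /sd hf] h.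
  have [] // : d e = d f.
  by apply: (@dart_inj _ _ _ _ _ _ G); rewrite he hf -/(g e) h.
rewrite -(card_in_imset injg); apply/subset_leq_card/fintype.subsetP => w /imsetP [f].
rewrite !inE => /andP[/and3P[_ h1 h2] _] ->.
by rewrite /g /d /dtgt /=; case: ifP.
Qed.

(** An edge that does not cross [e] is disjoint from [e] or meets it in a common end. Disjoint ones
    contain no [k.+2] pairwise crossing edges, as [e] would complete the family, so [quasi_bound]
    applies; at each end of [e] there are at most [#|U|] others. *)
Lemma noncross_card k lam (E : {set Ed}) (U : {set V}) e : (0 < lam)%N -> (#|V| <= 2 ^ lam)%N ->
  ~ has_k1_family curve k.+2 ->
  (#|[set f in inside E U | ~~ cross e f]| <= (15 * (2 * 10 ^ 7 * lam) ^ k + 2) * #|U|)%N.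
Proof.
move=> l0 hV nk; pose F := [set f in inside E U | `[< edisjoint curve f e >]].
pose I v := [set f in inside E U | incident ends f v].
have bF : (#|F| <= 15 * (2 * 10 ^ 7 * lam) ^ k * #|U|)%N.
  apply: (quasi_bound G l0 hV) => [f|C sC cC kC].
    by rewrite !inE => /andP[/and3P[_ h1 h2] _].
  apply: nk; exists (fun i => enum_val (cast_ord (esym cC) i)), e; split.
  - by move=> i j /enum_val_inj /cast_ord_inj.
  - move=> i j ij; have : enum_val (cast_ord (esym cC) i) != enum_val (cast_ord (esym cC) j).
      by rewrite (inj_eq enum_val_inj) (inj_eq (@cast_ord_inj _ _ _)); apply/eqP.
    by move=> /(kC _ _ (enum_valP _) (enum_valP _)) /andP[_ /asboolP].
  - move=> i; have /(fintype.subsetP sC) := enum_valP (cast_ord (esym cC) i).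
    by rewrite inE => /andP[_ /asboolP].
move: (15 * _ ^ k)%N bF => q bF.
rewrite mulnDl mul2n -addnn; apply: leq_trans (_ : (#|F| + (#|I (ends e).1| + #|I (ends e).2|) <= _)%N); last first.
  by apply: leq_add bF (leq_add _ _); apply: incident_card.
apply: (@leq_trans #|F :|: (I (ends e).1 :|: I (ends e).2)|); last first.
  by rewrite (leq_trans (leq_card_setU _ _)) // leq_add2l leq_card_setU.
apply/subset_leq_card/fintype.subsetP => f; rewrite inE => /andP[fE nc]; rewrite !finset.in_setU.
case: (boolP (f \in I (ends e).1)) => [|n1]; first by rewrite orbT.
case: (boolP (f \in I (ends e).2)) => [|n2]; first by rewrite !orbT.
rewrite !orbF /F finset.in_set fE /=; apply/asboolP => p [pf pe].
have nt : ~~ touch curve e f.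
  rewrite negb_or nc andbT; apply: contra n1 => /eqP ->.
  by rewrite /I finset.in_set fE /incident eqxx.
have [v] := pts_meet G nt pe pf.
rewrite {1}/incident => /orP[] /eqP <- h; first by move: n1; rewrite /I finset.in_set fE h.
by move: n2; rewrite /I finset.in_set fE h.
Qed.
End EdgeBound.

Lemma trunc_log_ln (R : realType) n : (2 <= n)%N ->
  ((trunc_log 2 n).+1)%:R <= 4 * ln (n%:R : R).
Proof.
move=> n2; have h : 1 / 2 <= ln (n%:R : R) by apply: ln_ge_half; rewrite ler_nat.
have : (2 ^ trunc_log 2 n <= n)%N by rewrite trunc_logP // (leq_trans _ n2).
rewrite -(ler_nat R) natrX -ler_ln ?posrE ?exprn_gt0 ?ltr0n ?(leq_trans _ n2) //.
rewrite lnXn // -[ln 2 *+ _]mulr_natr => h2.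
have l2 : 1 / 2 <= ln (2 : R) by apply: ln_ge_half.
have : 1 / 2 * (trunc_log 2 n)%:R <= ln (2 : R) * (trunc_log 2 n)%:R by rewrite ler_wpM2r.
by rewrite -[X in _ -> X <= _]natr1; lra.
Qed.

(** Of the exponent [k + 4], [k] comes from [quasi_bound] and 4 from [flow_bound]. *)
Lemma edge_bound (R : realType) k : exists C : R, 0 < C /\
  forall (V Ed : finType) (pos : V -> (R * R)%type) (ends : Ed -> V * V)
         (curve : Ed -> R -> (R * R)%type),
    simple_topgraph pos ends curve -> (2 <= #|V|)%N -> ~ has_k1_family curve k.+2 ->
    (#|Ed|%:R : R) <= C * #|V|%:R * (ln (#|V|%:R : R)) ^+ (k + 4).
Proof.
have [B [B0 eB]] : exists B, (0 < B)%N /\ B = (2 * 10 ^ 7)%N by exists (2 * 10 ^ 7)%N; split.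
have B1 : 1 <= B%:R :> R by rewrite ler1n.
pose C0 : R := 2 * 10 ^+ 8.
have C00 : 0 <= C0 by rewrite mulr_ge0 ?exprn_ge0.
have C0p : 0 < C0 by rewrite mulr_gt0 ?exprn_gt0.
have B4 : 0 < 4 * B%:R :> R by lra.
(* The 2 is due to [half_cut], [C0] to [flow_bound], 17 to [15 + 2] in [t], the inner 4 to [hlam],
   and 81 = 3^4 to [1 + x <= 3 * x]. *)
exists (2 * (C0 * (17 * (4 * B%:R) ^+ k)) * 81); split.
  by rewrite !mulr_gt0 ?exprn_gt0.
move=> V Ed pos ends curve G n2 nk.
set n : R := #|V|%:R; set x := ln n.
have xh : 1 / 2 <= x by apply: ln_ge_half; rewrite ler_nat.
pose lam := (trunc_log 2 #|V|).+1.
have hlam : lam%:R <= 4 * x by apply: trunc_log_ln.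
have hV : (#|V| <= 2 ^ lam)%N by rewrite ltnW // trunc_log_ltn.
have ne e : (ends e).1 != (ends e).2 by case: G => _ [h _]; apply/eqP.
have [Y hY] := half_cut ne.
pose E := [set e | ((ends e).1 \in Y) != ((ends e).2 \in Y)].
pose t := (15 * (B * lam) ^ k + 2)%N.
have fb : #|E|%:R <= C0 * t%:R * n * (1 + x) ^+ 4.
  have EE : inside ends E [set: V] = E by apply/setP => e; rewrite !inE !andbT.
  have := @flow_bound R V Ed pos ends curve G E Y t; rewrite -/C0.
  move=> /(_ _ _ _ [set: V]); rewrite EE cardsT; apply; first by move=> e; rewrite inE.
    by rewrite /t addn2.
  by move=> e U _; rewrite /t eB; apply: (noncross_card G).
have y1 : 1 <= 4 * B%:R * x.
  have : 1 * (1 / 2) <= B%:R * x by apply: ler_pM => //; lra.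
  by rewrite -mulrA; lra.
have ht : t%:R <= 17 * (4 * B%:R * x) ^+ k.
  rewrite /t natrD natrM natrX natrM.
  have h1 : (B%:R * lam%:R : R) ^+ k <= (4 * B%:R * x) ^+ k.
    apply: lerXn2r; rewrite ?nnegrE ?mulr_ge0 //; try lra.
    by rewrite (mulrC 4) -mulrA ler_wpM2l //; lra.
  have h2 : 1 <= (4 * B%:R * x) ^+ k by rewrite exprn_ege1.
  by move: ((_ * x) ^+ k) ((_ * lam%:R) ^+ k) h1 h2 => u v; lra.
have hx : (1 + x) ^+ 4 <= 81 * x ^+ 4.
  apply: (@le_trans _ _ ((3 * x) ^+ 4)); first by apply: lerXn2r; rewrite ?nnegrE; lra.
  by rewrite exprMn le_eqVlt; apply/orP; left; apply/eqP; congr (_ * _); ring.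
have n0 : 0 <= n by rewrite ler0n.
apply: (@le_trans _ _ (2 * #|E|%:R)); first by rewrite -natrM ler_nat.
apply: (@le_trans _ _ (2 * (C0 * (17 * (4 * B%:R * x) ^+ k) * n * (81 * x ^+ 4)))).
  apply: ler_wpM2l => //; apply: le_trans fb _.
  apply: ler_pM => //; first by rewrite !mulr_ge0.
  - by rewrite exprn_ge0 //; lra.
  - by rewrite ler_wpM2r // ler_wpM2l.
by rewrite exprMn exprD le_eqVlt; apply/orP; left; apply/eqP; ring.
Qed.

(** The logarithm of 2 is less than 1, so raising the exponent may cost a constant factor; a factor
    2 for each power suffices. *)
Lemma pow_ln_weaken (R : realType) (x : R) a b : 1 / 2 <= x -> (a <= b)%N ->
  x ^+ a <= 2 ^+ (b - a) * x ^+ b.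
Proof.
move=> hx /subnKC {2}<-; rewrite exprD mulrCA ler_peMr ?exprn_ge0 //; first lra.
by rewrite -exprMn exprn_ege1 //; lra.
Qed.

Theorem theorem12 (R : realType) :
  (forall k : nat, (4 < k)%N ->
    exists C : R, 0 < C /\
      forall (V Ed : finType) (pos : V -> (R * R)%type) (ends : Ed -> V * V)
             (curve : Ed -> R -> (R * R)%type),
        simple_topgraph pos ends curve -> (2 <= #|V|)%N ->
        ~ has_k1_family curve k ->
        (#|Ed|%:R : R) <= C * #|V|%:R * (ln (#|V|%:R : R)) ^+ (2 * k + 2))
  /\
  (forall k : nat, (2 <= k <= 4)%N ->
    exists C : R, 0 < C /\
      forall (V Ed : finType) (pos : V -> (R * R)%type) (ends : Ed -> V * V)
             (curve : Ed -> R -> (R * R)%type),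
        simple_topgraph pos ends curve -> (2 <= #|V|)%N ->
        ~ has_k1_family curve k ->
        (#|Ed|%:R : R) <= C * #|V|%:R * (ln (#|V|%:R : R)) ^+ 6).
Proof.
(* Both claims weaken the exponent [k + 2], to [2 * k + 2] and, for [k] at most 4, to 6. *)
have weak k p : (2 <= k)%N -> (k + 2 <= p)%N -> exists C : R, 0 < C /\
    forall (V Ed : finType) (pos : V -> (R * R)%type) (ends : Ed -> V * V)
           (curve : Ed -> R -> (R * R)%type),
      simple_topgraph pos ends curve -> (2 <= #|V|)%N -> ~ has_k1_family curve k ->
      (#|Ed|%:R : R) <= C * #|V|%:R * (ln (#|V|%:R : R)) ^+ p.
  case: k => [|[|k]] // _ kp; have [C [C0 hC]] := edge_bound R k.
  exists (C * 2 ^+ (p - (k + 4))); split; first by rewrite mulr_gt0 ?exprn_gt0.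
  move=> V Ed pos ends curve G n2 nk; apply: le_trans (hC _ _ _ _ _ G n2 nk) _.
  have kp' : (k + 4 <= p)%N by lia.
  have hx : 1 / 2 <= ln (#|V|%:R : R) by apply: ln_ge_half; rewrite ler_nat.
  rewrite (_ : C * 2 ^+ _ * _ * _ = C * #|V|%:R * (2 ^+ (p - (k + 4)) * ln #|V|%:R ^+ p)); last by ring.
  by rewrite ler_wpM2l ?mulr_ge0 ?(ltW C0) ?pow_ln_weaken.
split=> k hk; apply: weak; lia.
Qed.
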